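(* Let $d\in\mathbb{N}$, $L\in\mathbb{N}_0$, $\kappa\ge 0$. Let $B_L^X\subset B_{L-1}^X\subset\cdots\subset B_{-L}^X$ and $B_L^Y\subset B_{L-1}^Y\subset\cdots\subset B_{-L}^Y$ be two nested sequences of boxes in $\mathbb{R}^d$, $B_\ell^X=[\boldsymbol a_\ell^x,\boldsymbol b_\ell^x]$, $B_\ell^Y=[\boldsymbol a_\ell^y,\boldsymbol b_\ell^y]$, and let $x_\ell\in B_\ell^X$, $y_\ell\in B_\ell^Y$ for $\ell=-L,\dots,L$. Let $k(x,y)=\exp(\mathbf{i}\kappa\Phi(x,y))A(x,y)$, where $\Phi$ is real-valued on $B_{-L}^X\times B_{-L}^Y$. Assume: (1) (analyticity of $\Phi$ and $A$) $\rho_\Phi>1$ and $\rho_A>1$ are such that $A$ is holomorphic on $\mathcal{E}_{\rho_A}^{[\boldsymbol a_0^x,\boldsymbol b_0^x]}\times\mathcal{E}_{\rho_A}^{[\boldsymbol a_0^y,\boldsymbol b_0^y]}$ and $\Phi$ is holomorphic on an open set $\Omega\subset\mathbb{C}^{2d}$ with $$\Omega\supset\mathcal{E}_{\rho_\Phi}^{[\boldsymbol a_{-L}^x,\boldsymbol b_{-L}^x]}\times\mathcal{E}_{\rho_\Phi}^{[\boldsymbol a_{-L}^y,\boldsymbol b_{-L}^y]}\supset\mathcal{E}_{\rho_A}^{[\boldsymbol a_0^x,\boldsymbol b_0^x]}\times\mathcal{E}_{\rho_A}^{[\boldsymbol a_0^y,\boldsymbol b_0^y]}.$$ Set $M_A:=\|A\|_{L^\infty(\mathcal{E}_{\rho_A}^{[\boldsymbol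 a_0^x,\boldsymbol b_0^x]}\times\mathcal{E}_{\rho_A}^{[\boldsymbol a_0^y,\boldsymbol b_0^y]})}$, $M_\Phi:=\|\Phi\|_{L^\infty(\Omega)}$ (both finite), and $$d_\Omega:=\sup\Big\{\varepsilon>0 \;\Big|\; B_\varepsilon(x)\times B_\varepsilon(y)\subset\Omega\ \text{ for all }(x,y)\in \mathcal{E}_{\rho_A}^{[\boldsymbol a_0^x,\boldsymbol b_0^x]}\times\mathcal{E}_{\rho_\Phi}^{[\boldsymbol a_{-L}^y,\boldsymbol b_{-L}^y]}\ \cup\ \mathcal{E}_{\rho_\Phi}^{[\boldsymbol a_{-L}^x,\boldsymbol b_{-L}^x]}\times\mathcal{E}_{\rho_A}^{[\boldsymbol a_0^y,\boldsymbol b_0^y]}\Big\},$$ and suppose $d_\Omega>0$. (2) (shrinking condition) $\overline q\in(0,1)$ is such that, for all $i=1,\dots,d$ and $\ell=-L,\dots,L-1$, $$b_{\ell+1,i}^x-a_{\ell+1,i}^x\le\overline q\,(b_{\ell,i}^x-a_{\ell,i}^x),\qquad b_{\ell+1,i}^y-a_{\ell+1,i}^y\le\overline q\,(b_{\ell,i}^y-a_{\ell,i}^y).$$ (3) $\gamma>0$ is such that $$\kappa\,\operatorname{diam}B_\ell^X\,\|y_{-\ell}-y_{-\ell-1}\|\,\frac{M_\Phi}{d_\Omega^2}\le\gamma,\qquad \kappa\,\operatorname{diam}B_\ell^Y\,\|x_{-\ell}-x_{-\ell-1}\|\,\frac{M_\Phi}{d_\Omega^2}\le\gamma\qquad(\ell=0,\dots,L-1),$$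 $$\kappa\,\operatorname{diam}B_0^X\,\operatorname{diam}B_0^Y\,\frac{M_\Phi}{d_\Omega^2}\le\gamma.$$ (4) (polynomial growth of the Lebesgue constant) $C_\Lambda>0$ and $\lambda>0$ are such that $\Lambda_m\le C_\Lambda(m+1)^\lambda$ for all $m\in\mathbb{N}_0$. Then there exist constants $C,b,b'>0$ depending only on $\gamma,\rho_A,\rho_\Phi,\overline q,d,C_\Lambda,\lambda$ such that, whenever $m\ge b'\log(L+2)$, $$\Big\|k-\Big(\mathfrak{I}^{B_L^X,x}_{y_{-L}}\circ\cdots\circ\mathfrak{I}^{B_0^X,x}_{y_0}\Big)\otimes\Big(\mathfrak{I}^{B_L^Y,y}_{x_{-L}}\circ\cdots\circ\mathfrak{I}^{B_0^Y,y}_{x_0}\Big)k\Big\|_{L^\infty(B_L^X\times B_L^Y)}\le C\exp(-bm)\,M_A.$$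
   Context: A box is a product $[\boldsymbol a,\boldsymbol b]=\prod_{i=1}^d[a_i,b_i]\subset\mathbb{R}^d$ of compact intervals with $a_i<b_i$; $\|\cdot\|$ is the Euclidean norm, $\operatorname{diam}$ the Euclidean diameter, and $B_\varepsilon(z)$ the Euclidean ball of radius $\varepsilon>0$ about $z\in\mathbb{C}^d$. Bernstein elliptic discs: for $\rho>1$, $\mathcal{E}_\rho:=\{z\in\mathbb{C}: |z-1|+|z+1|<\rho+1/\rho\}$, $\mathcal{E}_\rho^{[a,b]}:=\frac{a+b}{2}+\frac{b-a}{2}\mathcal{E}_\rho$, and $\mathcal{E}_\rho^{[\boldsymbol a,\boldsymbol b]}:=\prod_{i=1}^d\mathcal{E}_\rho^{[a_i,b_i]}\subset\mathbb{C}^d$. The phase $\Phi$ is real-valued at real arguments of the boxes; the amplitude $A$ may be complex-valued (or even vector-valued, in which case interpolation acts componentwise). Interpolation: for each $m\in\mathbb{N}_0$, $I_m:C([-1,1])\to\mathcal{P}_m$ is a polynomial interpolation operator at $m+1$ distinct points of $[-1,1]$ (e.g. Chebyshev interpolation), $\mathcal{P}_m$ being the univariate polynomials (complex coefficients) of degree at most $m$; $\Lambda_m$ is its Lebesgue constant (operator norm on $C([-1,1])$). $I_m^{[a,b]}$ is the operator obtained by affine transformation to $[a,b]$, and for a box $B$, $I_m^{B}:C(B)\to\mathcal{Q}_m$ is the tensor product interpolation operator, where $\mathcal{Q}_m$ is the space of $d$-variate polynomials of degree at most $m$ in each variable. For a box $B\subset\mathbb{R}^d$ and a point $z\in\mathbb{R}^d$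 define, for fixed $m$, $$\mathfrak{I}^{B,x}_z[f]:=\exp(\mathbf{i}\kappa\Phi(\cdot,z))\,I_m^B\big[\exp(-\mathbf{i}\kappa\Phi(\cdot,z))f\big],\qquad \mathfrak{I}^{B,y}_z[f]:=\exp(\mathbf{i}\kappa\Phi(z,\cdot))\,I_m^B\big[\exp(-\mathbf{i}\kappa\Phi(z,\cdot))f\big].$$ In compositions, the result of one operator is restricted to the next smaller box before applying the next operator. The tensor product $S\otimes T$ of an operator $S$ acting on functions of $x$ and an operator $T$ acting on functions of $y$ means that $S$ is applied with respect to the variable $x$ and $T$ with respect to the variable $y$. *)

(* Defs.v *)
From mathcomp Require Import all_boot all_order all_algebra.
From mathcomp Require Import all_classical all_reals all_analysis.
From mathcomp Require Import complex.

Set Implicit Arguments.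
Unset Strict Implicit.
Unset Printing Implicit Defensive.

Import Order.TTheory GRing.Theory Num.Theory.
Import numFieldNormedType.Exports.
Import ComplexField.Normc.

Local Open Scope classical_set_scope.
Local Open Scope ring_scope.
Local Open Scope complex_scope.

(* R[i]^o is R[i] with its normed topology: 'rV[R[i]^o]_d is C^d as a normed
   space over R[i]. *)

Section Norms.
Context {R : realType}.

(* Moduli and Euclidean norms take values in R, whereas the norm `|_| of R[i]
   takes values in R[i], and `|_| on row vectors is the max norm. *)
Definition rnorm {d : nat} (v : 'rV[R]_d) : R :=
  Num.sqrt (\sum_(i < d) v 0 i ^+ 2).

Definition cnorm {d : nat} (v : 'rV[R[i]^o]_d) : R :=
  Num.sqrt (\sum_(i < d) normc (v 0 i) ^+ 2).

Definition cball {d : nat} (z : 'rV[R[i]^o]_d) (e : R) : set 'rV[R[i]^o]_d :=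
  [set w | cnorm (w - z) < e].

Definition diam {d : nat} (S : set 'rV[R]_d) : R :=
  sup [set rnorm (uv.1 - uv.2) | uv in S `*` S].

(* L^oo norm over D of a function of pointwise modulus g.  It is only used for
   functions that are continuous on D, where D is open or a nondegenerate box,
   so the supremum is the essential supremum. *)
Definition Linfty {T : Type} (D : set T) (g : T -> R) : \bar R :=
  ereal_sup [set (g z)%:E | z in D].

Definition cexp (z : R[i]) : R[i] :=
  (expR (complex.Re z))%:C * (cos (complex.Im z) +i* sin (complex.Im z)).

End Norms.

Section Domains.
Context {R : realType} {d : nat}.

Definition box (a b : 'rV[R]_d) : set 'rV[R]_d :=
  [set u | forall i, a 0 i <= u 0 i <= b 0 i].

Definition to_complex (u : 'rV[R]_d) : 'rV[R[i]^o]_d :=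
  map_mx (fun t : R => t%:C) u.

Definition bernstein_disc (rho : R) : set R[i] :=
  [set z | normc (z - 1) + normc (z + 1) < rho + rho^-1].

Definition bernstein_disc_on (rho a b : R) : set R[i] :=
  [set ((a + b) / 2)%:C + ((b - a) / 2)%:C * w | w in bernstein_disc rho].

Definition bernstein_polydisc (rho : R) (a b : 'rV[R]_d) : set 'rV[R[i]^o]_d :=
  [set z | forall i, bernstein_disc_on rho (a 0 i) (b 0 i) (z 0 i)].

(* The value is +oo when Omega is the whole space, and then M / d_Omega ^+ 2 = 0
   in \bar R. *)
Definition omega_dist (Omega S : set ('rV[R[i]^o]_d * 'rV[R[i]^o]_d)) : \bar R :=
  ereal_sup [set e%:E | e in
    [set e : R | 0 < e /\
      forall p, S p -> cball p.1 e `*` cball p.2 e `<=` Omega]].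

End Domains.

(* Differentiability over the scalar field R[i] is complex differentiability. *)
Definition holomorphic_on {R : realType} {V W : normedModType R[i]}
    (U : set V) (f : V -> W) : Prop :=
  forall z, U z -> differentiable f z.

Section Interpolation.
Context {R : realType}.

Definition lagrange_poly {m : nat} (xi : 'I_m.+1 -> R) (j : 'I_m.+1) :
    {poly R} :=
  \prod_(k < m.+1 | k != j) ((xi j - xi k)^-1 *: ('X - (xi k)%:P)).

Definition interp {V : lmodType R[i]} {m : nat} (xi : 'I_m.+1 -> R)
    (f : R -> V) : R -> V :=
  fun t => \sum_(j < m.+1) ((lagrange_poly xi j).[t])%:C *: f (xi j).

(* Operator norm of I_m on complex-valued C([-1,1]). *)
Definition lebesgue_constant {m : nat} (xi : 'I_m.+1 -> R) : \bar R :=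
  let I : set R := `[-1, 1]%classic in
  ereal_sup
    [set Linfty I (fun t => normc (interp xi f t)) |
      f in [set f : R -> R[i]^o | {within I, continuous f} /\
              (Linfty I (fun t => normc (f t)) <= 1%:E)%E]].

Definition interp_on {V : lmodType R[i]} {m : nat} (xi : 'I_m.+1 -> R)
    (a b : R) (f : R -> V) : R -> V :=
  fun s => interp xi (fun t => f ((a + b) / 2 + (b - a) / 2 * t))
             ((s - (a + b) / 2) / ((b - a) / 2)).

Definition set_coord {d : nat} (u : 'rV[R]_d) (i : 'I_d) (s : R) : 'rV[R]_d :=
  \row_j (if j == i then s else u 0 j).

Definition interp_coord {V : lmodType R[i]} {d m : nat} (xi : 'I_m.+1 -> R)
    (a b : 'rV[R]_d) (i : 'I_d) (f : 'rV[R]_d -> V) : 'rV[R]_d -> V :=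
  fun u => interp_on xi (a 0 i) (b 0 i) (fun s => f (set_coord u i s)) (u 0 i).

(* The tensor product I_m^[a,b]: univariate interpolation in each variable. *)
Definition interp_box {V : lmodType R[i]} {d m : nat} (xi : 'I_m.+1 -> R)
    (a b : 'rV[R]_d) (f : 'rV[R]_d -> V) : 'rV[R]_d -> V :=
  foldr (fun i g => interp_coord xi a b i g) f (enum 'I_d).

Definition phase_interp {V : lmodType R[i]} {d m : nat} (xi : 'I_m.+1 -> R)
    (kappa : R) (phi : 'rV[R]_d -> R[i]) (a b : 'rV[R]_d)
    (f : 'rV[R]_d -> V) : 'rV[R]_d -> V :=
  fun u => cexp ((0 +i* kappa) * phi u) *:
    interp_box xi a b (fun v => cexp (- ((0 +i* kappa) * phi v)) *: f v) u.

(* Functions are total on R^d, so the restriction to the next smaller box needs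
   no explicit operation: the operator of level l only reads values in box l. *)
Fixpoint phase_interp_chain {V : lmodType R[i]} {d m : nat}
    (xi : 'I_m.+1 -> R) (kappa : R) (phi : nat -> 'rV[R]_d -> R[i])
    (a b : nat -> 'rV[R]_d) (n : nat) (f : 'rV[R]_d -> V) : 'rV[R]_d -> V :=
  let g := if n is n'.+1 then phase_interp_chain xi kappa phi a b n' f
           else f in
  phase_interp xi kappa (phi n) (a n) (b n) g.

Definition tensor_op {V : lmodType R[i]} {d : nat}
    (S T : ('rV[R]_d -> V) -> 'rV[R]_d -> V)
    (k : 'rV[R]_d -> 'rV[R]_d -> V) : 'rV[R]_d -> 'rV[R]_d -> V :=
  fun x y => S (fun x' => T (k x') y) x.

End Interpolation.

(* Main.v *)
(** Fix one side, say the x-side, and let J_0, ..., J_L be the phase-weighted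
    interpolation operators.  J_l f is a unimodular factor times a polynomial p
    of degree at most m in each variable, so (1 - J_(l+1)) J_l f is the
    interpolation error of e^{i kappa g} p on the box of level l+1, where g is
    the difference of two consecutive phases.  On the Bernstein disc of
    parameter rho of that smaller box, e^{i kappa g} is bounded: Cauchy
    estimates applied twice to Phi bound the mixed second difference
    Phi(x,y) - Phi(x,y') - Phi(x',y) + Phi(x',y') by a multiple of
    M_Phi |x-x'| |y-y'| / d_Omega^2, and g is real at real points.  By the
    shrinking condition this disc lies in the disc of parameter sigma < rho of
    the larger box, on which p has grown by at most O(m) sigma^m, whereas
    interpolation gains nearly rho^-m.  Hence each step costs a relative error
    eps of order (sigma/r)^m up to powers of m, for some r in (sigma, rho).
    Therefore |J_L ... J_0 f| <= (1 + eps)^L Lambda_m^d |f|, the errors of the L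
    steps telescope, and m >= b' log(L+2) absorbs the factor L.  The two sides
    are combined by
      k - J^X (x) J^Y k = (k - J^X k) + J^X (k - J^Y k),
    and vector-valued amplitudes are reduced to scalar ones by duality.

    Best polynomial approximation on Bernstein discs is derived from Goursat's
    lemma: for G(w) = f(cosh w), the Cauchy kernel in the variable e^w is
    integrated over a period rectangle |Re w| <= log r, whose horizontal sides
    cancel, and expanded in geometric series on the two vertical sides. *)
From HB Require Import structures.
Require Import Defs.
From mathcomp Require Import all_boot all_order all_algebra.
From mathcomp Require Import all_classical all_reals all_analysis.
From mathcomp Require Import complex.
From mathcomp Require Import ring lra zify.

Import Order.TTheory GRing.Theory Num.Theory.
Import numFieldNormedType.Exports.
Import ComplexField.Normc.

Local Open Scope classical_set_scope.
Local Open Scope ring_scope.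
Local Open Scope complex_scope.

Set Implicit Arguments.
Unset Strict Implicit.
Unset Printing Implicit Defensive.

(** * Moduli and pointwise complex differentiability *)

Section ComplexModulus.
Context {R : realType}.
Implicit Types (z w : R[i]) (x y : R).

(** Two quantities are unbounded a priori: the number L of levels and the frequency kappa. Bounding
    the composition factor by factor would cost Lambda_m^(d L); comparing each operator with the
    identity on the output of its predecessor pays Lambda_m^d only once. Likewise kappa g need not
    be small in modulus. Only Im g matters for |e^{i kappa g}|, and subtracting the real value of g
    at a real base point turns Im g into the imaginary part of a mixed second difference, the
    quantity that gamma controls. The three parameters have separate tasks: sigma measures the
    growth of the previous polynomial, r places the contour, and rho is the open disc on which
    bounds are available. The supremum d_Omega need not be attained, so an explicit radius of at
    least half its size is used, at the price of a factor 4. No residue is computed: the Cauchy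
    kernel acts on G - G(w0), whose quotient is bounded at w0. The Cauchy estimates need no formula
    of their own either: approximation by a constant on a thin Bernstein disc is already a Lipschitz
    bound, and two such bounds control the mixed difference. *)

Lemma normc_ge0 z : 0 <= normc z.
Proof. by case: z => a b; apply: sqrtr_ge0. Qed.

Lemma normE z : `|z| = (normc z)%:C.
Proof. by case: z. Qed.

Lemma normc_real x : normc x%:C = `|x|.
Proof. by rewrite /= expr0n addr0 sqrtr_sqr. Qed.

Lemma normci : normc ('i%C : R[i]) = 1.
Proof. by rewrite /= expr0n add0r expr1n sqrtr1. Qed.

Lemma normcB z w : normc (z - w) = normc (w - z).
Proof. by rewrite -normcN opprB. Qed.

Lemma le_normcB z w : normc (z - w) <= normc z + normc w.
Proof. by rewrite (le_trans (le_normcD _ _))// normcN. Qed.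

Lemma normc_eq0 z : (normc z == 0) = (z == 0).
Proof.
by apply/eqP/eqP => [/eq0_normc//|->]; rewrite normc0.
Qed.

Lemma normc_gt0 z : (0 < normc z) = (z != 0).
Proof. by rewrite lt_def normc_ge0 andbT normc_eq0. Qed.

Lemma normcX z n : normc (z ^+ n) = normc z ^+ n.
Proof.
by elim: n => [|n IH]; rewrite ?expr0 ?normc1// !exprS normcM IH.
Qed.

Lemma normc_sum (I : Type) (s : seq I) (P : pred I) (F : I -> R[i]) :
  normc (\sum_(i <- s | P i) F i) <= \sum_(i <- s | P i) normc (F i).
Proof.
elim/big_ind2: _ => [|a b c d h1 h2|//]; first by rewrite normc0.
by rewrite (le_trans (le_normcD _ _))// lerD.
Qed.

Lemma Re_le_normc z : `|complex.Re z| <= normc z.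
Proof.
by case: z => a b /=; rewrite -sqrtr_sqr ler_wsqrtr// lerDl sqr_ge0.
Qed.

Lemma Im_le_normc z : `|complex.Im z| <= normc z.
Proof.
by case: z => a b /=; rewrite -sqrtr_sqr ler_wsqrtr// lerDr sqr_ge0.
Qed.

Lemma normc_le_ReIm z : normc z <= `|complex.Re z| + `|complex.Im z|.
Proof.
case: z => a b /=.
rewrite -(ger0_norm (addr_ge0 (normr_ge0 a) (normr_ge0 b))) -sqrtr_sqr.
rewrite ler_wsqrtr// sqrrD !real_normK ?num_real// -addrA lerD2l lerDr.
by rewrite mulrn_wge0// mulr_ge0.
Qed.

(** The norm of [R[i]] takes values in [R[i]]; this is the epsilon-delta form with real radii and
    moduli on which later estimates rest. *)
Lemma diff_eps (f : R[i]^o -> R[i]^o) (z : R[i]^o) : differentiable f z ->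
  exists l : R[i], forall e : R, 0 < e -> exists2 d : R, 0 < d &
    forall w, normc (w - z) < d ->
      normc (f w - f z - l * (w - z)) <= e * normc (w - z).
Proof.
move=> df; exists ('d f z 1 : R[i]) => e e0.
have /diff_locallyP[_ h] := df.
have : \forall w \near (0 : R[i]^o),
    `|f (w + z) - f z - 'd f z w| <= e%:C * `|w|.
  have e0' : 0 < e%:C by rewrite ltcR.
  have /eqaddoP/(_ _ e0') := h; apply: filterS => w /=.
  by rewrite /= opprD addrA.
move=> /nbhs_ballP[d /= d0 H].
(* A positive element of [R[i]] is real, so the radius may be replaced by its real part. *)
have dR : d = (complex.Re d)%:C by rewrite RRe_real// gtr0_real.
exists (complex.Re d); first by move: d0; rewrite dR ltcR.
move=> w wz; have := H (w - z).
rewrite /ball/= sub0r normrN subrK normE {1}dR ltcR => /(_ wz).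
rewrite !normE -rmorphM lecR; congr (_ <= _).
congr normc; congr (_ - _).
by rewrite -[w - z in LHS]mulr1 -[_ * 1]/((w - z) *: (1 : R[i]^o)) linearZ/= mulrC.
Qed.

End ComplexModulus.
Section PointwiseDifferentiability.
Context {R : realType} {V : normedModType R[i]}.
Implicit Types (f g : V -> R[i]^o) (x : V).

Lemma differentiable_mul f g x : differentiable f x -> differentiable g x ->
  differentiable (fun w => f w * g w : R[i]^o) x.
Proof. by move=> df dg; exact: (differentiableM df dg). Qed.

Lemma differentiable_exp f n x : differentiable f x ->
  differentiable (fun w => f w ^+ n : R[i]^o) x.
Proof.
move=> df; elim: n => [|n IH]; first exact: differentiable_cst.
have -> : (fun w => f w ^+ n.+1 : R[i]^o) = (fun w => f w * f w ^+ n : R[i]^o).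
  by apply: funext => w; rewrite exprS.
exact: differentiable_mul.
Qed.

Lemma differentiable_inv f x : differentiable f x -> f x != 0 ->
  differentiable (fun w => (f w)^-1 : R[i]^o) x.
Proof. by move=> df fx; exact: (differentiableV df fx). Qed.

Lemma differentiable_add f g x : differentiable f x -> differentiable g x ->
  differentiable (fun w => f w + g w : R[i]^o) x.
Proof. by move=> df dg; exact: (differentiableD df dg). Qed.

Lemma differentiable_sub f g x : differentiable f x -> differentiable g x ->
  differentiable (fun w => f w - g w : R[i]^o) x.
Proof. by move=> df dg; exact: (differentiableB df dg). Qed.

Lemma differentiable_const (k : R[i]^o) x : differentiable (fun _ : V => k) x.
Proof. exact: differentiable_cst. Qed.

Lemma differentiable_scale f (k : R[i]) x : differentiable f x ->
  differentiable (fun w => k * f w : R[i]^o) x.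
Proof. by move=> df; apply: differentiable_mul => //; exact: differentiable_cst. Qed.

Lemma differentiable_sumr n (F : 'I_n -> V -> R[i]^o) x :
  (forall j, differentiable (F j) x) ->
  differentiable (fun w => \sum_j F j w : R[i]^o) x.
Proof.
move=> dF; have := differentiable_sum dF.
by congr (differentiable _ x); apply: funext => w; rewrite fct_sumE.
Qed.

End PointwiseDifferentiability.

Lemma differentiable_ident {R : realType} (z : R[i]^o) :
  differentiable (fun w : R[i]^o => w) z.
Proof. by have [] := is_diff_id z. Qed.

Lemma differentiable_polyC {R : realType} (p : {poly R[i]}) (z : R[i]^o) :
  differentiable (fun w : R[i]^o => p.[w] : R[i]^o) z.
Proof.
elim/poly_ind: p => [|p c IH].
  have -> : (fun w : R[i]^o => (0 : {poly R[i]}).[w] : R[i]^o) = fun=> 0.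
    by apply: funext => w; rewrite horner0.
  exact: differentiable_const.
have -> : (fun w : R[i]^o => (p * 'X + c%:P).[w] : R[i]^o) = fun w => p.[w] * w + c.
  by apply: funext => w; rewrite hornerD hornerM hornerX hornerC.
apply: differentiable_add; last exact: differentiable_const.
by apply: differentiable_mul.
Qed.

(** * Contour integrals and Goursat's lemma *)

Section LineIntegral.
Context {R : realType}.
Implicit Types (f g : R[i]^o -> R[i]^o) (p v : R[i]) (a b c M : R).
Local Notation mu := (@lebesgue_measure R).

(* There is no factor [v]: the contour integral is [v * lint f p v a b]. *)
Definition lint f p v a b : R[i] :=
  (\int[mu]_(t in `[a, b]) complex.Re (f (p + t%:C * v))) +i*
  (\int[mu]_(t in `[a, b]) complex.Im (f (p + t%:C * v))).

Definition diff_line f p v a b :=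
  forall t, a <= t <= b -> differentiable f (p + t%:C * v : R[i]^o).

Lemma diff_line_cts f p v t : differentiable f (p + t%:C * v : R[i]^o) ->
  forall e, 0 < e -> exists2 d, 0 < d & forall s, `|s - t| < d ->
    normc (f (p + s%:C * v) - f (p + t%:C * v)) <= e.
Proof.
move=> /diff_eps[l h] e e0; have [d d0 H] := h 1 ltr01.
(* [K] is a local Lipschitz constant along the line. The summands 1 in the radii below avoid a
   division by zero when [V] or [K] vanishes. *)
pose V := normc v; pose K := (1 + normc l) * V.
have V0 : 0 <= V by apply: normc_ge0.
have K0 : 0 <= K by rewrite mulr_ge0// addr_ge0// normc_ge0.
have m0 : 0 < Num.min (d / (V + 1)) (e / (K + 1)).
  by rewrite lt_min !divr_gt0// ltr_wpDl.
exists (Num.min (d / (V + 1)) (e / (K + 1))) => // s st.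
rewrite lt_min !ltr_pdivlMr ?ltr_wpDl// in st; case/andP: st => st1 st2.
have E : p + s%:C * v - (p + t%:C * v) = (s - t)%:C * v.
  by rewrite rmorphB/=; ring.
have N : normc (p + s%:C * v - (p + t%:C * v)) = `|s - t| * V.
  by rewrite E normcM normc_real.
have /H {}H : normc (p + s%:C * v - (p + t%:C * v)) < d.
  by rewrite N; apply: le_lt_trans st1; rewrite ler_wpM2l// lerDl.
rewrite -[f _ - f _](subrK (l * (p + s%:C * v - (p + t%:C * v)))).
apply: (le_trans (le_normcD _ _)); apply: (le_trans (lerD H (lexx _))).
rewrite normcM N; apply: le_trans (ltW st2).
by rewrite /K -mulrDl mulrDr mulr1 mulrCA ler_wpDr.
Qed.

Lemma lint_integrable f p v a b : diff_line f p v a b ->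
  mu.-integrable `[a, b] (EFin \o (fun t => complex.Re (f (p + t%:C * v)))) /\
  mu.-integrable `[a, b] (EFin \o (fun t => complex.Im (f (p + t%:C * v)))).
Proof.
move=> df; split; apply: continuous_compact_integrable;
  try exact: segment_compact.
all: apply: continuous_in_subspaceT => t; rewrite inE/= in_itv/= => /df dft.
all: apply/cvgrPdist_le => e e0; have [d d0 H] := diff_line_cts dft e0.
all: apply/nbhs_ballP; exists d => //= s; rewrite /ball/= distrC => /H {}H.
all: rewrite distrC -raddfB; apply: le_trans H.
  exact: Re_le_normc.
exact: Im_le_normc.
Qed.

Lemma lintD f g p v a b : diff_line f p v a b -> diff_line g p v a b ->
  lint (fun z => f z + g z) p v a b = lint f p v a b + lint g p v a b.
Proof.
move=> /lint_integrable[f1 f2] /lint_integrable[g1 g2].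
rewrite /lint; apply/eqP; rewrite eq_complex/=; apply/andP; split; apply/eqP.
  by rewrite -RintegralD//; apply: eq_Rintegral => t _; rewrite raddfD.
by rewrite -RintegralD//; apply: eq_Rintegral => t _; rewrite raddfD.
Qed.

Lemma lintZ f k p v a b : diff_line f p v a b ->
  lint (fun z => k * f z) p v a b = k * lint f p v a b.
Proof.
move=> /lint_integrable[f1 f2].
case: k => x y; rewrite /lint/=.
have iZ (h : R -> R) (k : R) : mu.-integrable `[a, b] (EFin \o h) ->
    mu.-integrable `[a, b] (EFin \o (fun t => k * h t)).
  by move=> ih; apply: (integrableZl _ _ ih).
apply/eqP; rewrite eq_complex/=; apply/andP; split; apply/eqP.
  rewrite -!RintegralZl// -RintegralB//; try exact: iZ.
  by apply: eq_Rintegral => t _; case: (f _).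
rewrite -!RintegralZl// -RintegralD//; try exact: iZ.
by apply: eq_Rintegral => t _; case: (f _).
Qed.

(* The factor 2 comes from bounding real and imaginary parts separately. *)
Lemma lint_bound f p v a b M : a <= b -> diff_line f p v a b ->
  (forall t, a <= t <= b -> normc (f (p + t%:C * v)) <= M) ->
  normc (lint f p v a b) <= 2 * (b - a) * M.
Proof.
move=> ab /lint_integrable[f1 f2] fM.
have H (h : R -> R) : mu.-integrable `[a, b] (EFin \o h) ->
    (forall t, a <= t <= b -> `|h t| <= M) ->
    `|\int[mu]_(t in `[a, b]) h t| <= (b - a) * M.
  move=> ih hM; apply: (le_trans (le_normr_Rintegral _ _)) => //.
  apply: (@le_trans _ _ (\int[mu]_(t in `[a, b]) M)).
    apply: le_Rintegral => //.
    - exact: (integrable_norm ih).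
    - apply: continuous_compact_integrable; first exact: segment_compact.
      by move=> ?; exact: cvg_cst.
  rewrite Rintegral_cst// /= lebesgue_measure_itv/= lte_fin.
  case: ltP => [_|ba]; first by rewrite /= mulrC.
  have -> : a = b by apply/eqP; rewrite eq_le ab ba.
  by rewrite subrr mulr0 mul0r.
rewrite mulrAC -mulrA mulr2n mulrDl !mul1r mulrC.
apply: (le_trans (normc_le_ReIm _)); apply: lerD; apply: H => // t /fM;
  apply: le_trans.
  exact: Re_le_normc.
exact: Im_le_normc.
Qed.

Lemma eq_lint f g p v a b :
  (forall t, a <= t <= b -> f (p + t%:C * v) = g (p + t%:C * v)) ->
  lint f p v a b = lint g p v a b.
Proof.
by move=> fg; rewrite /lint; congr (_ +i* _); apply: eq_Rintegral => t;
  rewrite inE/= in_itv/= => /fg ->.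
Qed.

Lemma lint_cst (k : R[i]) p v a b : a <= b ->
  lint (fun=> k) p v a b = (b - a)%:C * k.
Proof.
move=> ab; rewrite /lint !Rintegral_cst//= lebesgue_measure_itv/= lte_fin.
case: ltP => [_|ba] /=.
  by case: k => x y; apply/eqP; rewrite eq_complex/= !mul0r subr0 addr0
    ![(b - a) * _]mulrC !eqxx.
have -> : a = b by apply/eqP; rewrite eq_le ab ba.
by rewrite subrr rmorph0 mul0r !mulr0.
Qed.

Lemma lint_cat f p v a b c : a <= c <= b -> diff_line f p v a b ->
  lint f p v a b = lint f p v a c + lint f p v c b.
Proof.
move=> /andP[ac cb] /lint_integrable[f1 f2].
have H (h : R -> R) : mu.-integrable `[a, b] (EFin \o h) ->
    \int[mu]_(t in `[a, b]) h t =
    \int[mu]_(t in `[a, c]) h t + \int[mu]_(t in `[c, b]) h t.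
  move=> ih; apply/eqP; rewrite addrC -subr_eq; apply/eqP.
  rewrite Rintegral_itvB// ?bnd_simp//.
  apply: Rintegral_itv_obnd_cbnd; apply: integrableS ih => //.
  by apply: subset_itvr; rewrite bnd_simp.
by rewrite /lint; apply/eqP; rewrite eq_complex/= !H// !eqxx.
Qed.

Lemma diff_lineS f p v a b a' b' : a <= a' -> b' <= b ->
  diff_line f p v a b -> diff_line f p v a' b'.
Proof.
move=> aa bb df t /andP[h1 h2]; apply: df.
by rewrite (le_trans aa h1) (le_trans h2 bb).
Qed.

End LineIntegral.

Section Bisection.
Context {R : realType}.
Implicit Types a b c d : R.

(** Compactness of the rectangle in the form that Goursat's lemma needs: a property that always
    passes to one of the four quarters persists in arbitrarily small rectangles about one point.
    With [bad] abstract, the choice of quarters is separated from the integral estimates. *)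
Lemma bisection (bad : R -> R -> R -> R -> Prop) a b c d :
  a <= b -> c <= d -> bad a b c d ->
  (forall a b c d, a <= b -> c <= d -> bad a b c d ->
    let u := (a + b) / 2 in let v := (c + d) / 2 in
    [\/ bad a u c v, bad u b c v, bad a u v d | bad u b v d]) ->
  exists x y, [/\ a <= x <= b, c <= y <= d & forall e, 0 < e ->
    exists a' b' c' d', [/\ a <= a' /\ a' <= x <= b', b' <= b /\ c <= c',
      c' <= y <= d' /\ d' <= d, b' - a' + (d' - c') < e & bad a' b' c' d']].
Proof.
move=> ab cd bad0 split.
pose step (Q : R * R * (R * R)) :=
  let: ((a, b), (c, d)) := Q in
  let u := (a + b) / 2 in let v := (c + d) / 2 in
  if `[< bad a u c v >] then ((a, u), (c, v)) else
  if `[< bad u b c v >] then ((u, b), (c, v)) else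
  if `[< bad a u v d >] then ((a, u), (v, d)) else ((u, b), (v, d)).
pose Q n := iter n step ((a, b), (c, d)).
pose A n := (Q n).1.1; pose B n := (Q n).1.2.
pose C n := (Q n).2.1; pose D n := (Q n).2.2.
have inv n : [/\ A n <= B n, C n <= D n & bad (A n) (B n) (C n) (D n)] /\
    [/\ A n <= A n.+1, B n.+1 <= B n, C n <= C n.+1, D n.+1 <= D n &
       (B n.+1 - A n.+1 = (B n - A n) / 2) /\
       (D n.+1 - C n.+1 = (D n - C n) / 2)].
  have stepP m : [/\ A m <= B m, C m <= D m & bad (A m) (B m) (C m) (D m)] ->
    [/\ A m.+1 <= B m.+1, C m.+1 <= D m.+1 &
       bad (A m.+1) (B m.+1) (C m.+1) (D m.+1)] /\
    [/\ A m <= A m.+1, B m.+1 <= B m, C m <= C m.+1, D m.+1 <= D m &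
       (B m.+1 - A m.+1 = (B m - A m) / 2) /\
       (D m.+1 - C m.+1 = (D m - C m) / 2)].
    rewrite /A /B /C /D /Q iterS.
    case: (iter m step _) => [[a1 b1] [c1 d1]] /= [h1 h2 h3].
    have := split _ _ _ _ h1 h2 h3; cbv zeta.
    by case: asboolP => q1; [|case: asboolP => q2; [|case: asboolP => q3]];
      move=> sp /=; split; (split; [lra|lra|]) || split; try lra; case: sp.
  have : [/\ A n <= B n, C n <= D n & bad (A n) (B n) (C n) (D n)].
    by elim: n => [//|n /stepP[]].
  by move=> h; split=> //; have [] := stepP _ h.
have half n : B n - A n + (D n - C n) = (b - a + (d - c)) / 2 ^+ n.
  elim: n => [|n IH]; first by rewrite expr0 divr1.
  have [_ [_ _ _ _ [-> ->]]] := inv n.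
  by rewrite -mulrDl IH exprSr invfM mulrA.
have incA : nondecreasing_seq A by apply/nondecreasing_seqP => n; have [_ []] := inv n.
have incC : nondecreasing_seq C by apply/nondecreasing_seqP => n; have [_ []] := inv n.
have decB : nonincreasing_seq B by apply/nonincreasing_seqP => n; have [_ []] := inv n.
have decD : nonincreasing_seq D by apply/nonincreasing_seqP => n; have [_ []] := inv n.
(* Nested intervals: every left end lies below every right end, as one sees at the larger of the two
   indices, so the supremum of the left ends is a common point. *)
have limit (F G : nat -> R) : nondecreasing_seq F -> nonincreasing_seq G ->
    (forall n, F n <= G n) -> exists x, forall n, F n <= x <= G n.
  move=> incF decG FG; exists (sup (range F)) => n.
  have ub m : ubound (range F) (G m).
    move=> _ [k _ <-]; apply: (le_trans (incF _ _ (leq_maxl k m))).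
    by apply: (le_trans (FG _)); apply: decG; apply: leq_maxr.
  apply/andP; split; last by apply: ge_sup; [exists (F 0%N), 0%N|apply: ub].
  by apply: ub_le_sup; [exists (G 0%N); apply: ub|exists n].
have [x xP] := limit _ _ incA decB (fun n => let: conj (And3 h _ _) _ := inv n in h).
have [y yP] := limit _ _ incC decD (fun n => let: conj (And3 _ h _) _ := inv n in h).
exists x, y; split; [exact: (xP 0%N)|exact: (yP 0%N)|] => e e0.
have [n nP] : exists n, B n - A n + (D n - C n) < e.
  pose S := b - a + (d - c).
  have [n hn] : exists n : nat, S / e < n%:R.
    by exists (Num.truncn (S / e)).+1; apply: truncnS_gt.
  exists n; rewrite half -/S ltr_pdivrMr ?exprn_gt0//.
  move: hn; rewrite ltr_pdivrMr// => /lt_le_trans; apply.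
  by rewrite mulrC ler_wpM2l ?(ltW e0)// -natrX ler_nat ltnW// ltn_expl.
exists (A n), (B n), (C n), (D n); have [[_ _ hbad] _] := inv n; split=> //.
- by split; [apply: (incA 0%N n)|apply: xP].
- by split; [apply: (decB 0%N n)|apply: (incC 0%N n)].
- by split; [apply: yP|apply: (decD 0%N n)].
Qed.

End Bisection.

Section Goursat.
Context {R : realType}.
Implicit Types (f g : R[i]^o -> R[i]^o) (a b c d M : R).

(** The counterclockwise integral over the boundary of [a, b] x [c, d]. Since [lint] omits the
    direction of the segment, the vertical sides carry the factor i. *)
Definition rect f a b c d : R[i] :=
  lint f (0 +i* c) 1 a b - lint f (0 +i* d) 1 a b +
  'i%C * (lint f b%:C 'i%C c d - lint f a%:C 'i%C c d).

Definition diff_rect f a b c d :=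
  forall x y, a <= x <= b -> c <= y <= d -> differentiable f (x +i* y : R[i]^o).

Lemma hpointE (x y : R) : (0 +i* y) + x%:C * 1 = x +i* y.
Proof. by simpc. Qed.

Lemma vpointE (x y : R) : x%:C + y%:C * 'i%C = x +i* y.
Proof. by simpc. Qed.

Lemma diff_rect_h f a b c d y : diff_rect f a b c d -> c <= y <= d ->
  diff_line f (0 +i* y) 1 a b.
Proof. by move=> df cy t ta; rewrite hpointE; apply: df. Qed.

Lemma diff_rect_v f a b c d x : diff_rect f a b c d -> a <= x <= b ->
  diff_line f x%:C 'i%C c d.
Proof. by move=> df cy t ta; rewrite vpointE; apply: df. Qed.

Lemma diff_rectS f a b c d a' b' c' d' : a <= a' -> b' <= b -> c <= c' ->
  d' <= d -> diff_rect f a b c d -> diff_rect f a' b' c' d'.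
Proof.
move=> h1 h2 h3 h4 df x y /andP[xa xb] /andP[yc yd]; apply: df.
  by rewrite (le_trans h1)// (le_trans xb).
by rewrite (le_trans h3)// (le_trans yd).
Qed.

Lemma rect_hcat f a b c d u : c <= d -> a <= u <= b ->
  diff_line f (0 +i* c) 1 a b -> diff_line f (0 +i* d) 1 a b ->
  rect f a b c d = rect f a u c d + rect f u b c d.
Proof.
move=> cd au h1 h2; rewrite /rect (lint_cat au h1) (lint_cat au h2); ring.
Qed.

Lemma rect_vcat f a b c d u : a <= b -> c <= u <= d ->
  diff_line f a%:C 'i%C c d -> diff_line f b%:C 'i%C c d ->
  rect f a b c d = rect f a b c u + rect f a b u d.
Proof.
move=> cd au h1 h2; rewrite /rect (lint_cat au h1) (lint_cat au h2); ring.
Qed.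

Lemma rectD f g a b c d : a <= b -> c <= d ->
  diff_rect f a b c d -> diff_rect g a b c d ->
  rect (fun z => f z + g z) a b c d = rect f a b c d + rect g a b c d.
Proof.
move=> ab cd df dg; rewrite /rect !lintD; first ring.
all: try by [apply: (diff_rect_h df); rewrite lexx cd|
             apply: (diff_rect_h dg); rewrite lexx cd].
all: by [apply: (diff_rect_v df); rewrite lexx ab|
             apply: (diff_rect_v dg); rewrite lexx ab].
Qed.

(** The constant is the perimeter 2 (b - a + d - c), doubled by the factor of [lint_bound]. *)
Lemma rect_bound f a b c d M : a <= b -> c <= d ->
  diff_line f (0 +i* c) 1 a b -> diff_line f (0 +i* d) 1 a b ->
  diff_line f a%:C 'i%C c d -> diff_line f b%:C 'i%C c d ->
  (forall x y, a <= x <= b -> c <= y <= d ->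
     [|| x == a, x == b, y == c | y == d] -> normc (f (x +i* y)) <= M) ->
  normc (rect f a b c d) <= 4 * (b - a + (d - c)) * M.
Proof.
move=> ab cd d1 d2 d3 d4 fM; rewrite /rect.
have b1 : normc (lint f (0 +i* c) 1 a b) <= 2 * (b - a) * M.
  by apply: lint_bound => // t tab; rewrite hpointE; apply: fM => //; rewrite ?lexx ?cd ?eqxx ?orbT.
have b2 : normc (lint f (0 +i* d) 1 a b) <= 2 * (b - a) * M.
  by apply: lint_bound => // t tab; rewrite hpointE; apply: fM => //; rewrite ?lexx ?cd ?eqxx ?orbT.
have b3 : normc (lint f a%:C 'i%C c d) <= 2 * (d - c) * M.
  by apply: lint_bound => // t tab; rewrite vpointE; apply: fM => //; rewrite ?lexx ?ab ?eqxx ?orbT.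
have b4 : normc (lint f b%:C 'i%C c d) <= 2 * (d - c) * M.
  by apply: lint_bound => // t tab; rewrite vpointE; apply: fM => //; rewrite ?lexx ?ab ?eqxx ?orbT.
apply: (le_trans (le_normcD _ _)); rewrite normcM normci mul1r.
apply: (le_trans (lerD (le_normcB _ _) (le_normcB _ _))); lra.
Qed.

(** On two opposite sides the integrands differ by the constant l (q - p), and the contributions of
    the two pairs of sides cancel. *)
Lemma rect_affine (k l : R[i]) a b c d : a <= b -> c <= d ->
  rect (fun z => k + l * z) a b c d = 0.
Proof.
move=> ab cd.
have da p v (s t : R) (h : R[i]^o -> R[i]^o) :
    (forall z : R[i]^o, differentiable h z) -> diff_line h p v s t.
  by move=> dh ? _; apply: dh.
have dlin (q : R[i]) (z : R[i]^o) : differentiable (fun w : R[i]^o => q * w : R[i]^o) z.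
  by apply: (@differentiableZ _ _ _ (fun w : R[i]^o => w) q z).
have dcst (q : R[i]) (z : R[i]^o) : differentiable (fun w : R[i]^o => q : R[i]^o) z.
  exact: differentiable_cst.
have E p q v s t : s <= t ->
    lint (fun z => k + l * z) q v s t - lint (fun z => k + l * z) p v s t =
    (t - s)%:C * (l * (q - p)).
  move=> st; rewrite -(lint_cst _ p v st).
  apply/eqP; rewrite subr_eq addrC -lintD; last 2 first.
  - by apply: da => z; apply: differentiableD; [apply: dcst|apply: dlin].
  - by apply: da => z; apply: dcst.
  have Ek r : lint (fun z => k + l * z) r v s t = lint (fun z => k + l * (z - p + r)) p v s t.
    by rewrite /lint; congr (_ +i* _); apply: eq_Rintegral => u _;
      congr (_ (k + l * _)); rewrite [p + _]addrC addrK addrC.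
  by rewrite Ek; apply/eqP/eq_lint => u _; ring.
rewrite /rect !E//.
have -> : ((0 : R) +i* c) - (0 +i* d) = - 'i%C * (d - c)%:C.
  by apply/eqP; rewrite eq_complex/=; apply/andP; split; apply/eqP; ring.
have -> : b%:C - a%:C = (b - a)%:C :> R[i] by rewrite rmorphB.
ring.
Qed.

Lemma rectB_affine f (k l : R[i]) a b c d : a <= b -> c <= d ->
  diff_rect f a b c d ->
  rect f a b c d = rect (fun z => f z - (k + l * z)) a b c d.
Proof.
move=> ab cd df.
have -> : (fun z => f z - (k + l * z)) = (fun z => f z + (- k + - l * z)).
  by apply: funext => z; rewrite opprD mulNr.
rewrite (rectD ab cd df); last first.
  move=> x y _ _; apply: differentiableD; first exact: differentiable_cst.
  by apply: (@differentiableZ _ _ _ (fun w : R[i]^o => w) (- l)).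
by rewrite rect_affine// addr0.
Qed.

(** Goursat's quadrisection. The half-perimeter of a quarter is halved and its square quartered, so
    an integral exceeding 4 e times this square passes the excess on to some quarter. Near the limit
    point f is affine up to e |w - z|, and [rect_bound] contradicts the excess. *)
Lemma rect_eq0 f a b c d : a <= b -> c <= d -> diff_rect f a b c d ->
  rect f a b c d = 0.
Proof.
move=> ab cd df; apply/eqP; rewrite -normc_eq0; apply/negPn/negP => N0.
have {N0}N0 : 0 < normc (rect f a b c d) by rewrite lt_def N0 normc_ge0.
pose S := b - a + (d - c); set N := normc _ in N0.
have S0 : 0 <= S by rewrite addr_ge0// subr_ge0.
(* With [S + 1] in place of [S] the initial rectangle is strictly bad, degenerate ones included: 4 e
   S^2 = N (S / (S + 1))^2 < N. *)
pose e := N / (S + 1) ^+ 2 / 4.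
have e0 : 0 < e by rewrite !divr_gt0// exprn_gt0// ltr_wpDl.
pose bad (a b c d : R) : Prop := diff_rect f a b c d /\
  4 * e * (b - a + (d - c)) ^+ 2 < normc (rect f a b c d).
have : bad a b c d.
  split=> //; rewrite -/S /e -mulrA -/N.
  have -> : 4 * (N / (S + 1) ^+ 2 / 4 * S ^+ 2) = N * (S / (S + 1)) ^+ 2.
    by field; rewrite gt_eqF// ltr_wpDl.
  have T0 : 0 <= S / (S + 1) by rewrite divr_ge0// addr_ge0.
  have T1 : S / (S + 1) < 1 by rewrite ltr_pdivrMr ?ltr_wpDl// mul1r ltrDl.
  by rewrite gtr_pMr// expr_lt1.
move=> /(bisection ab cd)[|x [y [xab ycd H]]].
  move=> a1 b1 c1 d1 ab1 cd1 [df1 lt1] u v.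
  have au : a1 <= u by rewrite /u; lra.
  have ub : u <= b1 by rewrite /u; lra.
  have cv : c1 <= v by rewrite /v; lra.
  have vd : v <= d1 by rewrite /v; lra.
  have d11 : diff_rect f a1 u c1 v by apply: diff_rectS df1.
  have d12 : diff_rect f u b1 c1 v by apply: diff_rectS df1.
  have d21 : diff_rect f a1 u v d1 by apply: diff_rectS df1.
  have d22 : diff_rect f u b1 v d1 by apply: diff_rectS df1.
  have [Q1|Q1] := ltP (4 * e * (u - a1 + (v - c1)) ^+ 2) (normc (rect f a1 u c1 v)).
    by apply: Or41.
  have [Q2|Q2] := ltP (4 * e * (b1 - u + (v - c1)) ^+ 2) (normc (rect f u b1 c1 v)).
    by apply: Or42.
  have [Q3|Q3] := ltP (4 * e * (u - a1 + (d1 - v)) ^+ 2) (normc (rect f a1 u v d1)).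
    by apply: Or43.
  have [Q4|Q4] := ltP (4 * e * (b1 - u + (d1 - v)) ^+ 2) (normc (rect f u b1 v d1)).
    by apply: Or44.
  move: lt1; rewrite (@rect_hcat _ _ _ _ _ u) ?au ?ub//; last 2 first.
  - by apply: (diff_rect_h df1); rewrite lexx.
  - by apply: (diff_rect_h df1); rewrite lexx cd1.
  rewrite (@rect_vcat _ a1 u _ _ v) ?cv ?vd//; last 2 first.
  - by apply: (diff_rect_v df1); rewrite lexx.
  - by apply: (diff_rect_v df1); rewrite au.
  rewrite (@rect_vcat _ u b1 _ _ v) ?cv ?vd//; last 2 first.
  - by apply: (diff_rect_v df1); rewrite au.
  - by apply: (diff_rect_v df1); rewrite lexx ab1.
  rewrite ltNge => /negP[].
  apply: (le_trans (le_normcD _ _)).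
  apply: (le_trans (lerD (le_normcD _ _) (le_normcD _ _))).
  apply: (le_trans (lerD (lerD Q1 Q3) (lerD Q2 Q4))).
  have -> : u - a1 = (b1 - a1) / 2 by rewrite /u; field.
  have -> : b1 - u = (b1 - a1) / 2 by rewrite /u; field.
  have -> : v - c1 = (d1 - c1) / 2 by rewrite /v; field.
  have -> : d1 - v = (d1 - c1) / 2 by rewrite /v; field.
  by rewrite le_eqVlt; apply/orP; left; apply/eqP; field.
have [l hl] := diff_eps (df x y xab ycd); have [dl dl0 {}hl] := hl e e0.
have [a' [b' [c' [d' [[aa' xab'] [b'b cc'] [ycd' d'd] small [df' lt']]]]]] := H _ dl0.
have ab' : a' <= b' by case/andP: xab' => h1 h2; apply: le_trans h2.
have cd' : c' <= d' by case/andP: ycd' => h1 h2; apply: le_trans h2.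
set z := x +i* y in hl; pose k := f z - l * z.
move: lt'; rewrite (@rectB_affine _ k l)// ltNge => /negP[].
have dg : diff_rect (fun z => f z - (k + l * z)) a' b' c' d'.
  move=> s t sab tcd; apply: differentiableB; first exact: df'.
  apply: differentiableD; first exact: differentiable_cst.
  by apply: (@differentiableZ _ _ _ (fun w : R[i]^o => w) l).
apply: (le_trans (rect_bound (M := e * (b' - a' + (d' - c'))) ab' cd' _ _ _ _ _)).
- by apply: (diff_rect_h dg); rewrite lexx cd'.
- by apply: (diff_rect_h dg); rewrite lexx cd'.
- by apply: (diff_rect_v dg); rewrite lexx ab'.
- by apply: (diff_rect_v dg); rewrite lexx ab'.
- move=> s t /andP[as_ sb] /andP[ct td] _; set w := s +i* t.
  have nw : normc (w - z) <= b' - a' + (d' - c').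
    apply: (le_trans (normc_le_ReIm _)); rewrite /w /z /=.
    case/andP: xab' => ? ?; case/andP: ycd' => ? ?.
    by apply: lerD; rewrite ler_norml; apply/andP; split; lra.
  have -> : f w - (k + l * w) = f w - f z - l * (w - z) by rewrite /k; ring.
  apply: (le_trans (hl _ (le_lt_trans nw small))).
  by rewrite ler_wpM2l// ltW.
by rewrite le_eqVlt; apply/orP; left; apply/eqP; ring.
Qed.

(** The strips to the left, to the right, below and above the inner rectangle are cut off, and each
    contributes 0. Differentiability is therefore asked everywhere except in the open inner
    rectangle. *)
Lemma rect_shrink f a b c d a' b' c' d' :
  a <= a' -> a' <= b' -> b' <= b -> c <= c' -> c' <= d' -> d' <= d ->
  (forall x y, a <= x <= b -> c <= y <= d -> ~~ ((a' < x < b') && (c' < y < d')) ->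
    differentiable f (x +i* y : R[i]^o)) ->
  rect f a b c d = rect f a' b' c' d'.
Proof.
move=> aa' ab' bb' cc' cd' dd' df.
have [ab'' a'b] := (le_trans aa' ab', le_trans ab' bb').
have [cd'' c'd] := (le_trans cc' cd', le_trans cd' dd').
have [ab cd] := (le_trans aa' a'b, le_trans cc' c'd).
have nc : (c' < c < d') = false by rewrite ltNge cc'.
have nd : (c' < d < d') = false by rewrite [d < _]ltNge dd' andbF.
have Lh y : c <= y <= d -> ~~ (c' < y < d') -> diff_line f (0 +i* y) 1 a b.
  by move=> cyd yy t tab; rewrite hpointE; apply: df; rewrite // negb_and yy orbT.
have Lv x : a <= x <= b -> ~~ (a' < x < b') -> diff_line f x%:C 'i%C c d.
  by move=> cyd xx t tab; rewrite vpointE; apply: df; rewrite // negb_and xx.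
rewrite (@rect_hcat _ _ _ _ _ a')//; try (apply: Lh); rewrite ?nc ?nd ?lexx ?aa' ?cd//=.
rewrite rect_eq0 ?add0r//; last first.
  move=> x y /andP[h1 h2] h3; apply: df => //; rewrite ?h1 ?(le_trans h2)//=.
  by rewrite ltNge h2.
rewrite (@rect_hcat _ _ _ _ _ b') ?ab'//;
  try (apply: (diff_lineS aa' (lexx _)); apply: Lh);
  rewrite ?nc ?nd ?lexx ?cd//=.
rewrite [X in _ + X]rect_eq0 ?addr0//; last first.
  move=> x y /andP[h1 h2] h3; apply: df => //; rewrite ?h2 ?andbT ?(le_trans _ h1)//=.
  by rewrite [x < _]ltNge h1 andbF.
rewrite (@rect_vcat _ _ _ _ _ c') ?cc'//; try (apply: Lv);
  rewrite ?aa' ?ab'' ?bb' ?ltxx ?andbF//=.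
rewrite rect_eq0 ?add0r//; last first.
  move=> x y /andP[h1 h2] /andP[h3 h4]; apply: df.
  - by rewrite (le_trans aa' h1) (le_trans h2 bb').
  - by rewrite h3 (le_trans h4 c'd).
  - by rewrite [c' < _]ltNge h4 andbF.
rewrite (@rect_vcat _ _ _ _ _ d') ?cd'//;
  try (apply: (diff_lineS cc' (lexx _)); apply: Lv);
  rewrite ?aa' ?ab'' ?bb' ?ltxx ?andbF//=.
rewrite [X in _ + X]rect_eq0 ?addr0//.
move=> x y /andP[h1 h2] /andP[h3 h4]; apply: df.
- by rewrite (le_trans aa' h1) (le_trans h2 bb').
- by rewrite h4 (le_trans cd'' h3).
- by rewrite [y < _]ltNge h3 !andbF.
Qed.

(** A bounded singularity is invisible: the contour shrinks to a square of half-side e about it,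
    which contributes at most 16 e |M|. *)
Lemma rect_eq0_bounded_singularity f a b c d x0 y0 r M :
  0 < r -> a < x0 < b -> c < y0 < d ->
  (forall x y, a <= x <= b -> c <= y <= d -> x +i* y != x0 +i* y0 ->
    differentiable f (x +i* y : R[i]^o)) ->
  (forall w, w != x0 +i* y0 -> normc (w - (x0 +i* y0)) < r -> normc (f w) <= M) ->
  rect f a b c d = 0.
Proof.
move=> r0 /andP[ax xb] /andP[cy yd] df fM.
apply/eqP; rewrite -normc_eq0 eq_le normc_ge0 andbT.
apply/ler_addgt0Pl => k k0; rewrite addr0.
have M1 : 0 < 16 * (`|M| + 1) by rewrite mulr_gt0// ltr_wpDl.
(* Points of the small square are within 2 e of the centre, so [r / 4] keeps them in the disc where
   [f] is bounded; the last condition brings the contour bound below [k]. *)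
have [e [e0 e1 e2 e3 [e4 er ek]]] : exists e, [/\ 0 < e, e <= x0 - a, e <= b - x0,
    e <= y0 - c & [/\ e <= d - y0, e <= r / 4 & e <= k / (16 * (`|M| + 1))]].
  exists (Num.min (Num.min (Num.min (x0 - a) (b - x0)) (Num.min (y0 - c) (d - y0)))
    (Num.min (r / 4) (k / (16 * (`|M| + 1))))).
  by rewrite !ge_min !lexx !orbT !lt_min !subr_gt0 ax xb cy yd !divr_gt0.
have ne x y : ((x != x0) || (y != y0)) -> x +i* y != x0 +i* y0.
  by rewrite eq_complex/= negb_and.
have [E1 E2] : x0 - e < x0 /\ x0 < x0 + e by rewrite ltrBlDr !ltrDl.
have [E3 E4] : y0 - e < y0 /\ y0 < y0 + e by rewrite ltrBlDr !ltrDl.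
have [F1 F2] : a <= x0 - e /\ x0 + e <= b by split; clear -e1 e2; lra.
have [F3 F4] : c <= y0 - e /\ y0 + e <= d by split; clear -e3 e4; lra.
have {}df x y : a <= x <= b -> c <= y <= d ->
    ~~ ((x0 - e < x < x0 + e) && (y0 - e < y < y0 + e)) ->
    differentiable f (x +i* y : R[i]^o).
  move=> hx hy hn; apply: df => //; apply: ne.
  by apply: contraR hn; rewrite negb_or !negbK => /andP[/eqP-> /eqP->];
    rewrite E1 E2 E3 E4.
have [G1 G2] := (ltW (lt_trans E1 E2), ltW (lt_trans E3 E4)).
rewrite (rect_shrink F1 G1 F2 F3 G2 F4 df).
have [H1 H2] := (le_trans F1 G1, le_trans G1 F2).
have [H3 H4] := (le_trans F3 G2, le_trans G2 F4).
apply: (le_trans (rect_bound (M := `|M|) G1 G2 _ _ _ _ _)).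
- move=> t /andP[t1 t2]; rewrite hpointE; apply: df.
  + by rewrite (le_trans F1) ?(le_trans t2).
  + by rewrite F3 H4.
  + by rewrite ltxx /= !andbF.
- move=> t /andP[t1 t2]; rewrite hpointE; apply: df.
  + by rewrite (le_trans F1) ?(le_trans t2).
  + by rewrite F4 H3.
  + by rewrite ltxx /= !andbF.
- move=> t /andP[t1 t2]; rewrite vpointE; apply: df.
  + by rewrite F1 H2.
  + by rewrite (le_trans F3) ?(le_trans t2).
  + by rewrite ltxx.
- move=> t /andP[t1 t2]; rewrite vpointE; apply: df.
  + by rewrite F2 H1.
  + by rewrite (le_trans F3) ?(le_trans t2).
  + by rewrite ltxx /= andbF.
- move=> x y /andP[h1 h2] /andP[h3 h4] bd; apply: (le_trans _ (ler_norm M)).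
  apply: fM.
    apply: ne; case/or4P: bd => /eqP ->.
    + by rewrite (lt_eqF E1).
    + by rewrite (gt_eqF E2).
    + by rewrite (lt_eqF E3) orbT.
    + by rewrite (gt_eqF E4) orbT.
  apply: (le_lt_trans (normc_le_ReIm _)) => /=.
  apply: (@le_lt_trans _ _ (e + e)); last by clear -er r0; lra.
  by apply: lerD; rewrite ler_distl ?h1 ?h2 ?h3 ?h4.
move: ek; rewrite ler_pdivlMr// => ek.
have -> : 4 * (x0 + e - (x0 - e) + (y0 + e - (y0 - e))) * `|M| = e * (16 * `|M|) by ring.
by apply: le_trans ek; rewrite ler_wpM2l ?(ltW e0)// ler_wpM2l// lerDl.
Qed.

End Goursat.

(** * The complex exponential *)

Section ComplexExponential.
Context {R : realType}.
Implicit Types (z w : R[i]) (x y t : R).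

Lemma derive_eps0 (f : R -> R) (l : R) : is_derive (0 : R) 1 f l ->
  forall e, 0 < e -> exists2 d, 0 < d &
    forall x, `|x| < d -> `|f x - f 0 - l * x| <= e * `|x|.
Proof.
move=> dfl e e0; have df : differentiable f 0.
  by apply/derivable1_diffP; case: dfl.
have /diff_locallyP[_ h] := df.
have : \forall w \near (0 : R), `|f (w + 0) - f 0 - 'd f 0 w| <= e * `|w|.
  by have /eqaddoP/(_ _ e0) := h; apply: filterS => w /=; rewrite opprD addrA.
move=> /nbhs_ballP[d /= d0 H]; exists d => // x xd.
have /= := H x; rewrite /ball/= sub0r normrN addr0 => /(_ xd).
have -> // : 'd f 0 x = l * x.
rewrite -[x in LHS]mulr1 -[x * 1]/(x *: (1 : R)) linearZ/=.
by have [_ <-] := dfl; rewrite -deriveE// mulrC.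
Qed.

Lemma cexpD z w : cexp (z + w) = cexp z * cexp w.
Proof.
case: z => a b; case: w => c d; rewrite /cexp /= expRD cosD sinD.
by apply/eqP; rewrite eq_complex/=; apply/andP; split; apply/eqP; ring.
Qed.

Lemma cexp0 : cexp (0 : R[i]) = 1.
Proof. by rewrite /cexp /= expR0 cos0 sin0; simpc. Qed.

Lemma normc_cexp z : normc (cexp z) = expR (complex.Re z).
Proof.
rewrite /cexp normcM normc_real ger0_norm ?expR_ge0//=.
by rewrite cos2Dsin2 sqrtr1 mulr1.
Qed.

Lemma cexp_neq0 z : cexp z != 0.
Proof. by rewrite -normc_gt0 normc_cexp expR_gt0. Qed.

Lemma cexpN z : cexp (- z) = (cexp z)^-1.
Proof.
by apply: (mulfI (cexp_neq0 z)); rewrite -cexpD subrr cexp0 divff// cexp_neq0.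
Qed.

Lemma cexp_imag t : cexp (0 +i* t) = cos t +i* sin t.
Proof. by rewrite /cexp /= expR0 mul1r. Qed.

Lemma cexp_eps (e : R) : 0 < e -> exists2 d, 0 < d &
  forall z, normc z < d -> normc (cexp z - 1 - z) <= e * normc z.
Proof.
(* 9 = 6 + 1 + 2: the three terms of the decomposition below are at most 3 (k n + k n), k n and (n +
   n) k, the last because n <= k. *)
move=> e0; pose k := Num.min (e / 9) 1.
have k0 : 0 < k by rewrite lt_min ltr01 andbT divr_gt0.
have [k1 ke] : k <= 1 /\ k <= e / 9 by rewrite /k !ge_min !lexx orbT.
clearbody k; have [d1 d10 H1] := derive_eps0 (is_derive_expR 0) k0.
have [d2 d20 H2] := derive_eps0 (is_derive_cos 0) k0.
have [d3 d30 H3] := derive_eps0 (is_derive_sin 0) k0.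
exists (Num.min (Num.min d1 d2) (Num.min d3 k)).
  by rewrite !lt_min d10 d20 d30 k0.
move=> z; rewrite !lt_min => /andP[/andP[zd1 zd2] /andP[zd3 zk]].
have rz := Re_le_normc z; have iz := Im_le_normc z.
have {}H1 := H1 _ (le_lt_trans rz zd1).
have {}H2 := H2 _ (le_lt_trans iz zd2).
have {}H3 := H3 _ (le_lt_trans iz zd3).
pose n := normc z; have n0 : 0 <= n by apply: normc_ge0.
pose E := expR (complex.Re z).
pose v := cos (complex.Im z) +i* sin (complex.Im z) - (1 + 'i%C * (complex.Im z)%:C).
pose a := E - 1 - complex.Re z.
have -> : cexp z - 1 - z = E%:C * v + a%:C + (E - 1)%:C * ('i%C * (complex.Im z)%:C).
  by rewrite /v /a /cexp -/E {3}[z]complexE !rmorphB/= rmorph1; ring.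
rewrite expR0 cos0 sin0 mul1r oppr0 mul0r !subr0 in H1 H2 H3.
rewrite mul1r addr0 in H3.
have Ha : `|a| <= k * n by apply: le_trans H1 _; rewrite ler_wpM2l// ltW.
have Hv : normc v <= k * n + k * n.
  apply: (le_trans (normc_le_ReIm _)); rewrite /v.
  have -> : 1 + 'i%C * (complex.Im z)%:C = 1 +i* complex.Im z :> R[i].
    by apply/eqP; rewrite eq_complex/=; apply/andP; split; apply/eqP; ring.
  rewrite /=.
  apply: lerD; [apply: le_trans H2 _|apply: le_trans H3 _];
    by rewrite ler_wpM2l// ltW.
have nk : n <= k := ltW zk.
have kn : k * n <= n by rewrite ler_piMl.
have HE1 : `|E - 1| <= n + n.
  have -> : E - 1 = a + complex.Re z by rewrite /a subrK.
  by apply: (le_trans (ler_normD _ _)); rewrite lerD// (le_trans Ha).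
have HE : `|E| <= 3.
  rewrite -(subrK 1 E); apply: (le_trans (ler_normD _ _)); rewrite normr1.
  by clear -HE1 nk k1; lra.
apply: (le_trans (le_normcD _ _)); apply: (le_trans (lerD (le_normcD _ _) (lexx _))).
rewrite !normcM normci mul1r !normc_real.
apply: (@le_trans _ _ (3 * (k * n + k * n) + k * n + (n + n) * k)).
  apply: lerD; first apply: lerD => //.
    by apply: ler_pM => //; apply: normc_ge0.
  by apply: ler_pM => //; apply: le_trans iz _.
have -> : 3 * (k * n + k * n) + k * n + (n + n) * k = k * 9 * n by ring.
by rewrite ler_wpM2r// -ler_pdivlMr.
Qed.

Lemma differentiable_cexp (z : R[i]^o) : differentiable (cexp : R[i]^o -> R[i]^o) z.
Proof.
apply/derivable1_diffP.
apply/cvg_ex; exists (cexp z : R[i]^o).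
apply/cvgrPdist_le => /= e e0.
have eR : e = (complex.Re e)%:C by rewrite RRe_real// gtr0_real.
have e0' : 0 < complex.Re e / normc (cexp z).
  by rewrite divr_gt0 ?normc_gt0 ?cexp_neq0// -ltcR -eR.
have [d d0 H] := cexp_eps e0'.
apply/nbhs_ballP; exists d%:C; first by rewrite /= ltcR.
move=> h; rewrite /ball/= sub0r normrN normE ltcR => /H {}H h0.
rewrite normE eR lecR.
have -> : cexp z - h^-1 *: (cexp (h%:A + z) - cexp z) =
    - (cexp z * (h^-1 * (cexp h - 1 - h))).
  rewrite -[h%:A]/(h * 1) mulr1 cexpD -[h^-1 *: _]/(h^-1 * _).
  rewrite [h^-1 * (_ - h)]mulrBr mulVf//; ring.
have N : 0 < normc (cexp z) by rewrite normc_gt0 cexp_neq0.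
move: (cexp z) N H {e0'} => c N H.
rewrite normcN !normcM normcV mulrCA.
rewrite mulrC ler_pdivrMr ?normc_gt0//.
apply: (le_trans (ler_wpM2l (ltW N) H)).
by rewrite mulrA mulrCA divff ?gt_eqF// mulr1.
Qed.

End ComplexExponential.

(** * Polynomial approximation on Bernstein discs *)

Section PeriodicStrip.
Context {R : realType}.
Implicit Types (f g : R[i]^o -> R[i]^o) (a b x y t M : R) (z w : R[i]).

(** Integral over one period of the vertical line of abscissa x, without the factor i. *)
Definition vint f x : R[i] := lint f x%:C 'i%C (- pi) pi.

Lemma pi_window : - pi <= pi :> R.
Proof. by rewrite ge0_cp// pi_ge0. Qed.

Lemma vint_eq f a b : a <= b -> rect f a b (- pi) pi = 0 ->
  (forall x, a <= x <= b -> f (x +i* - pi) = f (x +i* pi)) -> vint f a = vint f b.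
Proof.
move=> ab; rewrite /rect => H per; move/eqP: H.
have -> : lint f (0 +i* - pi) 1 a b = lint f (0 +i* pi) 1 a b.
  rewrite /lint; congr (_ +i* _); apply: eq_Rintegral => x;
  by rewrite inE/= in_itv/= => /per; rewrite !hpointE => ->.
rewrite subrr add0r mulf_eq0 -normc_eq0 normci oner_eq0 /= subr_eq0 => /eqP.
by move=> H; rewrite /vint H.
Qed.

(** By periodicity and Goursat's lemma the integral does not depend on the abscissa, and it is small
    on a line where f is uniformly small. *)
Lemma vint_eq0 f x : (forall w, differentiable f (w : R[i]^o)) ->
  (forall y, f (y +i* - pi) = f (y +i* pi)) ->
  (forall e, 0 < e -> exists y, forall t, normc (f (y +i* t)) <= e) ->
  vint f x = 0.
Proof.
move=> df per dec; apply/eqP; rewrite -normc_eq0 eq_le normc_ge0 andbT.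
apply/ler_addgt0Pl => e e0; rewrite addr0.
have p0 : 0 < 4 * pi :> R by rewrite mulr_gt0// pi_gt0.
have [y yP] := dec (e / (4 * pi)) (divr_gt0 e0 p0).
have -> : vint f x = vint f y.
  have dr a b : diff_rect f a b (- pi) pi by move=> ? ? _ _; exact: df.
  have [xy|/ltW yx] := leP x y.
    by apply: vint_eq => //; apply: rect_eq0 => //; exact: pi_window.
  by apply/esym/vint_eq => //; apply: rect_eq0 => //; exact: pi_window.
apply: (le_trans (lint_bound (M := e / (4 * pi)) _ _ _)).
- exact: pi_window.
- by move=> t _; exact: df.
- by move=> t _; rewrite vpointE.
- have E (P : R) : 0 < P -> 2 * (P + P) * (e / (4 * P)) = e.
    by move=> P0; field; apply: lt0r_neq0.
  by rewrite opprK E// pi_gt0.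
Qed.

Lemma cexp_pi x : cexp (x +i* - pi) = cexp (x +i* pi) :> R[i].
Proof. by rewrite /cexp /= cosN sinN sinpi oppr0. Qed.

Lemma differentiable_cexpN (w : R[i]^o) :
  differentiable (fun v : R[i]^o => cexp (- v) : R[i]^o) w.
Proof.
have -> : (fun v : R[i]^o => cexp (- v) : R[i]^o) =
    (cexp : R[i]^o -> R[i]^o) \o (fun v : R[i]^o => - v : R[i]^o) by [].
apply: differentiable_comp; last exact: differentiable_cexp.
exact: differentiableN.
Qed.

Lemma expR_small (e : R) (n : nat) : 0 < e -> (0 < n)%N ->
  exists y : R, expR y ^+ n <= e.
Proof.
move=> e0 n0; exists (ln (Num.min e 1)); rewrite lnK ?posrE ?lt_min ?e0 ?ltr01//.
case: n n0 => // n _; rewrite exprS.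
apply: (@le_trans _ _ (Num.min e 1)); last by rewrite ge_min lexx.
have u1 : Num.min e 1 <= 1 by rewrite ge_min lexx orbT.
have u0 : 0 <= Num.min e 1 by rewrite le_min (ltW e0) ler01.
by rewrite ler_piMr// exprn_ile1.
Qed.

(** The line is moved far to the left; for the negative powers in the next lemma, far to the
    right. *)
Lemma vint_cexp_expr n x : (0 < n)%N -> vint (fun w => cexp w ^+ n) x = 0.
Proof.
move=> n0; apply: vint_eq0 => [w|y|e e0].
- exact/differentiable_exp/differentiable_cexp.
- by rewrite cexp_pi.
- have [y ye] := expR_small e0 n0; exists y => t.
  by rewrite normcX normc_cexp.
Qed.

Lemma vint_cexpN_expr n x : (0 < n)%N -> vint (fun w => cexp (- w) ^+ n) x = 0.
Proof.
move=> n0; apply: vint_eq0 => [w|y|e e0].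
- exact/differentiable_exp/differentiable_cexpN.
- by rewrite !cexpN cexp_pi.
- have [y ye] := expR_small e0 n0; exists (- y) => t.
  by rewrite normcX normc_cexp /= opprK.
Qed.

Lemma cos_eq1 t : - pi *+ 2 < t < pi *+ 2 -> cos t = 1 -> t = 0.
Proof.
move=> /andP[t1 t2] ct.
have s0 : sin (t / 2) = 0.
  have : cos (t / 2 + t / 2) = 1 by rewrite -splitr.
  rewrite cosD -!expr2 => H; have := cos2Dsin2 (t / 2) => H2.
  have /eqP : sin (t / 2) ^+ 2 = 0 by lra.
  by rewrite sqrf_eq0 => /eqP.
have [t0|t0|//] := ltgtP t 0.
- have : 0 < sin (- (t / 2)) by rewrite sin_gt0_pi//; apply/andP; split; lra.
  by rewrite sinN s0 oppr0 ltxx.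
- have : 0 < sin (t / 2) by rewrite sin_gt0_pi//; apply/andP; split; lra.
  by rewrite s0 ltxx.
Qed.

(** [tau] avoids the ends of the window so that |y - tau| < 2 pi. The two ends share one
    exponential, so a singularity there would be met twice. *)
Lemma cexp_inj_window x y tau : - pi <= y <= pi -> - pi < tau < pi ->
  cexp (x +i* y) = cexp (0 +i* tau) -> x +i* y = 0 +i* tau.
Proof.
move=> /andP[y1 y2] /andP[t1 t2] E.
have x0 : x = 0.
  have : normc (cexp (x +i* y)) = normc (cexp (0 +i* tau)) by rewrite E.
  by rewrite !normc_cexp /= => /expR_inj.
move: E; rewrite x0 !cexp_imag => -[cyt syt].
have : cos (y - tau) = 1 by rewrite cosB cyt syt -!expr2 cos2Dsin2.
move=> /cos_eq1 H; congr (_ +i* _); apply/eqP; rewrite -subr_eq0; apply/eqP.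
by apply: H; apply/andP; split; lra.
Qed.

(* With [e = e^w] and [z0 = e^w0], the Cauchy kernel [e / (e - z0)] is expanded
   in powers of [z0 / e] on the right of [w0], of [e / z0] on its left. *)
Lemma kernel_right (z0 e : R[i]) m : e != 0 -> e != z0 ->
  e / (e - z0) = \sum_(n < m) (z0 / e) ^+ n + (z0 / e) ^+ m * (e / (e - z0)).
Proof.
move=> e0 ez; have d0 : e - z0 != 0 by rewrite subr_eq0.
elim: m => [|m IH]; first by rewrite big_ord0 expr0 mul1r add0r.
rewrite big_ord_recr/= {1}IH -addrA; congr (_ + _).
by rewrite exprSr; field; rewrite d0 e0.
Qed.

Lemma kernel_left (z0 e : R[i]) m : z0 != 0 -> e != z0 ->
  e / (e - z0) = - \sum_(n < m) (e / z0) ^+ n.+1 + (e / z0) ^+ m * (e / (e - z0)).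
Proof.
move=> e0 ez; have d0 : e - z0 != 0 by rewrite subr_eq0.
elim: m => [|m IH]; first by rewrite big_ord0 oppr0 expr0 mul1r add0r.
rewrite big_ord_recr/= {1}IH opprD -addrA; congr (_ + _).
by rewrite !exprSr; field; rewrite d0 e0.
Qed.

End PeriodicStrip.

Section BernsteinApproximation.
Context {R : realType}.
Implicit Types (x y t M : R) (z w : R[i]).

(** Maps the circle |z| = r to the ellipse with foci -1 and 1 and sum of focal distances r + 1/r;
    composed with [cexp] it is cosh. *)
Definition joukowski z : R[i] := (z + z^-1) / 2.

Lemma normc2 z : normc z ^+ 2 = complex.Re z ^+ 2 + complex.Im z ^+ 2.
Proof. by case: z => a b /=; rewrite sqr_sqrtr// addr_ge0// sqr_ge0. Qed.

Lemma normc_natr n : normc (n%:R : R[i]) = n%:R.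
Proof. by rewrite -(rmorph_nat (real_complex R)) normc_real normr_nat. Qed.

(** Both differences are squares divided by 2 z, and the parallelogram law evaluates |z - 1|^2 + |z
    + 1|^2. *)
Lemma joukowski_sum z : z != 0 ->
  normc (joukowski z - 1) + normc (joukowski z + 1) = normc z + (normc z)^-1.
Proof.
move=> z0; have n0 : normc z != 0 by rewrite normc_eq0.
have -> : joukowski z - 1 = (z - 1) ^+ 2 / (2 * z) by rewrite /joukowski; field.
have -> : joukowski z + 1 = (z + 1) ^+ 2 / (2 * z) by rewrite /joukowski; field.
have N w : normc (w ^+ 2 / (2 * z)) = normc w ^+ 2 / (2 * normc z).
  by rewrite normcM normcX normcV normcM normc_natr.
rewrite !N -mulrDl.
have -> : normc (z - 1) ^+ 2 + normc (z + 1) ^+ 2 = 2 * (normc z ^+ 2 + 1).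
  by rewrite !normc2; case: z {z0 n0 N} => a b /=; ring.
by field.
Qed.

Lemma addV_lt (rho x : R) : 1 < rho -> rho^-1 < x -> x < rho ->
  x + x^-1 < rho + rho^-1.
Proof.
move=> r1 rx xr; have r0 : 0 < rho by apply: lt_trans r1.
have x0 : 0 < x by apply: lt_trans rx; rewrite invr_gt0.
rewrite -subr_gt0.
have -> : rho + rho^-1 - (x + x^-1) = (rho - x) * ((rho * x - 1) / (rho * x)).
  by field; rewrite !gt_eqF.
rewrite mulr_gt0 ?subr_gt0// divr_gt0 ?mulr_gt0// subr_gt0.
by rewrite mulrC -ltr_pdivrMr// div1r.
Qed.

Lemma joukowski_disc (rho : R) z : 1 < rho -> rho^-1 < normc z < rho ->
  bernstein_disc rho (joukowski z).
Proof.
move=> r1 /andP[h1 h2]; rewrite /bernstein_disc/= joukowski_sum ?addV_lt//.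
by rewrite -normc_gt0; apply: lt_trans h1; rewrite invr_gt0 (lt_trans _ r1).
Qed.

Lemma joukowski_cos t : joukowski (cexp (0 +i* t)) = (cos t)%:C.
Proof.
rewrite /joukowski -cexpN.
have -> : - (0 +i* t) = 0 +i* (- t) by rewrite -[LHS]/((- 0) +i* (- t)) oppr0.
rewrite !cexp_imag cosN sinN.
have -> : cos t +i* sin t + (cos t +i* - sin t) = 2 * (cos t)%:C.
  by apply/eqP; rewrite eq_complex/=; apply/andP; split; apply/eqP; ring.
by rewrite mulrC mulKf// pnatr_eq0.
Qed.

(* The pair [(T_n, T_(n+1))]. *)
Fixpoint chebyshev (n : nat) : {poly R[i]} * {poly R[i]} :=
  if n is n'.+1 then
    let: (p, q) := chebyshev n' in (q, 2 *: ('X * q) - p)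
  else (1, 'X).

Lemma size_chebyshev n :
  (size (chebyshev n).1 <= n.+1)%N /\ (size (chebyshev n).2 <= n.+2)%N.
Proof.
elim: n => [|n]; first by rewrite /= size_poly1 size_polyX.
rewrite /=; case: (chebyshev n) => p q /= [sp sq]; split=> //.
apply: (leq_trans (size_polyD _ _)); rewrite size_polyN geq_max.
have h : (size ('X * q)%R <= n.+3)%N.
  by apply: (leq_trans (size_polyMleq _ _)); rewrite size_polyX.
rewrite (leq_trans (size_scale_leq _ _) h) (leq_trans sp)//.
by rewrite ltnW.
Qed.

Lemma chebyshev_joukowski n z : z != 0 ->
  (chebyshev n).1.[joukowski z] = joukowski (z ^+ n) /\
  (chebyshev n).2.[joukowski z] = joukowski (z ^+ n.+1).
Proof.
move=> z0; elim: n => [|n].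
  by rewrite /= hornerC hornerX expr0 expr1 /joukowski invr1 -mulr2n divff// pnatr_eq0.
rewrite /=; case: (chebyshev n) => p q /= [sp sq]; split=> //.
rewrite hornerD hornerN hornerZ hornerM hornerX sp sq /joukowski !exprS.
move: (z ^+ n) (expf_neq0 n z0) => u u0.
by field; rewrite z0 u0.
Qed.

Section Contour.
Variables (f : R[i]^o -> R[i]^o) (rho r M : R).
Hypotheses (r1 : 1 < r) (rrho : r < rho).
Hypothesis df : forall z, bernstein_disc rho z -> differentiable f (z : R[i]^o).
Hypothesis fM : forall z, bernstein_disc rho z -> normc (f z) <= M.

Let s := ln r.
Let G (w : R[i]^o) : R[i]^o := f (joukowski (cexp w)).

Let r0 : 0 < r. Proof. exact: lt_trans r1. Qed.
Let s0 : 0 < s. Proof. by rewrite ln_gt0. Qed.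
Let es : expR s = r. Proof. by rewrite lnK ?posrE. Qed.

Lemma strip_sub_disc x y : - s <= x <= s -> bernstein_disc rho (joukowski (cexp (x +i* y))).
Proof.
move=> /andP[sx xs]; have rho0 := lt_trans r0 rrho.
apply: joukowski_disc; first exact: lt_trans rrho.
rewrite normc_cexp /=; apply/andP; split.
  apply: (@lt_le_trans _ _ r^-1); first by rewrite ltf_pV2.
  by rewrite -es -expRN ler_expR.
by apply: le_lt_trans rrho; rewrite -es ler_expR.
Qed.

Lemma differentiable_strip x y : - s <= x <= s -> differentiable G (x +i* y : R[i]^o).
Proof.
move=> xs.
have -> : G = f \o (fun w : R[i]^o => joukowski (cexp w) : R[i]^o) by [].
apply: differentiable_comp; last exact/df/strip_sub_disc.
rewrite /joukowski; apply: differentiable_mul; last exact: differentiable_const.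
apply: differentiable_add; first exact: differentiable_cexp.
by apply: differentiable_inv; [exact: differentiable_cexp|exact: cexp_neq0].
Qed.

Lemma strip_bound x y : - s <= x <= s -> normc (G (x +i* y)) <= M.
Proof. by move=> /strip_sub_disc => H; apply: fM. Qed.

Lemma strip_periodic x : G (x +i* - pi) = G (x +i* pi).
Proof. by rewrite /G cexp_pi. Qed.

Definition vdiff (F : R[i]^o -> R[i]^o) x := forall y, differentiable F (x +i* y : R[i]^o).

Lemma vdiff_line F x : vdiff F x -> diff_line F x%:C 'i%C (- pi) pi.
Proof. by move=> dF t _; rewrite vpointE; exact: dF. Qed.

Lemma vint_lin (a b : R[i]) (F H : R[i]^o -> R[i]^o) x : vdiff F x -> vdiff H x ->
  vint (fun w => a * F w + b * H w) x = a * vint F x + b * vint H x.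
Proof.
move=> dF dH; rewrite /vint lintD; last 2 first.
- by apply: vdiff_line => y; apply: differentiable_scale.
- by apply: vdiff_line => y; apply: differentiable_scale.
by rewrite !lintZ//; exact: vdiff_line.
Qed.

Lemma vintZ (a : R[i]) (F : R[i]^o -> R[i]^o) x : vdiff F x ->
  vint (fun w => a * F w) x = a * vint F x.
Proof. by move=> dF; rewrite /vint lintZ//; exact: vdiff_line. Qed.

Lemma vint_sum n (F : 'I_n -> R[i]^o -> R[i]^o) x : (forall j, vdiff (F j) x) ->
  vint (fun w => \sum_j F j w) x = \sum_j vint (F j) x.
Proof.
elim: n F => [|n IH] F dF.
  rewrite big_ord0 /vint (@eq_lint _ _ (fun=> 0)) => [|t _]; last by rewrite big_ord0.
  by rewrite lint_cst ?pi_window// mulr0.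
rewrite big_ord_recr/= -IH// /vint -lintD; last 2 first.
- apply: vdiff_line => y; apply: differentiable_sumr => j; exact: dF.
- by apply: vdiff_line; apply: dF.
by apply: eq_lint => t _; rewrite big_ord_recr.
Qed.

Lemma vint_bound (F : R[i]^o -> R[i]^o) x K : vdiff F x ->
  (forall y, normc (F (x +i* y)) <= K) -> normc (vint F x) <= 4 * pi * K.
Proof.
move=> dF FK; have := @lint_bound _ F x%:C 'i%C (- pi) pi K pi_window (vdiff_line dF).
have -> : 2 * (pi - - pi) = 4 * pi :> R.
  by rewrite opprK; move: (pi : R) => P; ring.
by apply=> t _; rewrite vpointE.
Qed.

Lemma vint_one x : vint (fun=> 1) x = (2 * pi)%:C.
Proof.
rewrite /vint lint_cst ?pi_window// opprK mulr1; congr (_%:C).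
by move: (pi : R) => P; ring.
Qed.

Section Point.
Variable tau : R.
Hypothesis tauP : - pi < tau < pi.

Let w0 : R[i] := 0 +i* tau.
Let z0 := cexp w0.
Let c0 := G w0.
(** Subtracting [c0] keeps the integrand bounded at [w0], so its two vertical integrals agree
    without a residue. The value [c0] reappears as the constant term in [right_side]. *)
Let h (w : R[i]^o) : R[i]^o := (G w - c0) * (cexp w / (cexp w - z0)).

Let z01 : normc z0 = 1. Proof. by rewrite normc_cexp /= expR0. Qed.

Lemma differentiable_cauchy_integrand x y : - s <= x <= s -> cexp (x +i* y) != z0 ->
  differentiable h (x +i* y : R[i]^o).
Proof.
move=> xs hz; have dG := differentiable_strip y xs.
apply: differentiable_mul.
  by apply: differentiable_sub => //; exact: differentiable_const.
apply: differentiable_mul; first exact: differentiable_cexp.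
apply: differentiable_inv; last by rewrite subr_eq0.
apply: differentiable_sub; first exact: differentiable_cexp.
exact: differentiable_const.
Qed.

Lemma cauchy_integrand_bounded : exists d K, 0 < d /\
  forall w, w != w0 -> normc (w - w0) < d -> normc (h w) <= K.
Proof.
have s_le : - s <= 0 <= s by rewrite oppr_le0 !ltW.
have [l hl] := diff_eps (differentiable_strip tau s_le); have [d1 d10 H1] := hl 1 ltr01.
(* The choice 1/2 gives |e^u - 1| >= |u| / 2, and |u| < 1 gives |e^u| <= 3; with |G w - c0| <= (1 +
   |l|) |u| this makes up the constant below. *)
have [d2 d20 H2] := @cexp_eps R (1 / 2) ltac:(by rewrite divr_gt0).
exists (Num.min d1 (Num.min d2 1)), (2 * (1 + normc l) * 3).
split; first by rewrite !lt_min d10 d20 ltr01.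
move=> w ww; rewrite !lt_min => /and3P[/H1 {}H1 /H2 {}H2 H3].
have u0 : 0 < normc (w - w0) by rewrite normc_gt0 subr_eq0.
have E : cexp w = z0 * cexp (w - w0) by rewrite /z0 -cexpD addrC subrK.
pose u := w - w0; rewrite -/u in u0 H1 H2 H3 E.
have HG : normc (G w - c0) <= (1 + normc l) * normc u.
  rewrite -[G w - c0](subrK (l * u)) (le_trans (le_normcD _ _))//.
  by rewrite normcM mulrDl lerD.
have HL : normc u / 2 <= normc (cexp u - 1).
  have : normc u <= normc (cexp u - 1) + normc (cexp u - 1 - u).
    have -> : normc u = normc ((cexp u - 1) - (cexp u - 1 - u)) by congr normc; ring.
    exact: le_normcB.
  by move: H2; lra.
have HU : normc (cexp u) <= 3.
  have -> : normc (cexp u) = normc (cexp u - 1 - u + (1 + u)) by congr normc; ring.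
  apply: (le_trans (le_normcD _ _)); apply: (le_trans (lerD H2 (le_normcD _ _))).
  by rewrite normc1; lra.
rewrite /h -/c0 E.
have -> : z0 * cexp u / (z0 * cexp u - z0) = cexp u / (cexp u - 1).
  have z0n : z0 != 0 by apply: cexp_neq0.
  rewrite -[X in _ - X]mulr1 -mulrBr invfM mulrACA divff// mul1r.
  by [].
rewrite normcM normcM normcV.
have cu0 : 0 < normc (cexp u - 1) by apply: lt_le_trans HL; rewrite divr_gt0.
rewrite mulrA ler_pdivrMr//.
apply: (@le_trans _ _ ((1 + normc l) * normc u * 3)).
  by rewrite ler_pM// normc_ge0.
have -> : (1 + normc l) * normc u * 3 = 2 * (1 + normc l) * 3 * (normc u / 2) by field.
by rewrite ler_wpM2l// !mulr_ge0// addr_ge0// normc_ge0.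
Qed.

Lemma vint_cauchy_integrand : vint h (- s) = vint h s.
Proof.
have hne x y : - pi <= y <= pi -> x +i* y != w0 -> cexp (x +i* y) != z0.
  by move=> yp; apply: contraNneq => /(cexp_inj_window yp tauP) ->.
apply: vint_eq.
- by rewrite ge0_cp// ltW.
- have [d [K [d0 hK]]] := cauchy_integrand_bounded.
  apply: (@rect_eq0_bounded_singularity _ h _ _ _ _ 0 tau d K d0 _ tauP _ hK).
    by rewrite oppr_lt0 s0.
  by move=> x y xs yp xy; apply: differentiable_cauchy_integrand => //; exact: hne.
- by move=> x _; rewrite /h strip_periodic cexp_pi.
Qed.

(** Up to the factor 2 pi, [A n] and [B n] are the coefficients of e^(n w) and e^(- n w) in the
    Laurent expansion of [G], each taken on the side where the kernel expansion produces it. *)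
Let A n := vint (fun w => G w * cexp (- w) ^+ n) s.
Let B n := vint (fun w => G w * cexp w ^+ n) (- s).

Let s_in : - s <= s <= s. Proof. by rewrite lexx ge0_cp// ltW. Qed.
Let Ns_in : - s <= - s <= s. Proof. by rewrite lexx ge0_cp// ltW. Qed.

Let z0_right y : cexp (s +i* y) != z0.
Proof.
apply/negP => /eqP E; have : normc (cexp (s +i* y)) = normc z0 by rewrite E.
by rewrite normc_cexp z01 /= es => E'; move: r1; rewrite E' ltxx.
Qed.

Let z0_left y : cexp (- s +i* y) != z0.
Proof.
apply/negP => /eqP E; have : normc (cexp (- s +i* y)) = normc z0 by rewrite E.
rewrite normc_cexp z01 /= expRN es => E'; move: r1.
by rewrite -invf_lt1// E' ltxx.
Qed.

Let c0M : normc c0 <= M.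
Proof. by apply: strip_bound; rewrite oppr_le0 !ltW. Qed.

Let GcM x y : - s <= x <= s -> normc (G (x +i* y) - c0) <= 2 * M.
Proof.
move=> xs; rewrite mulr2n mulrDl !mul1r.
by apply: (le_trans (le_normcB _ _)); rewrite lerD// strip_bound.
Qed.

Let rm1 : 0 < r - 1. Proof. by rewrite subr_gt0. Qed.

Let k_right y :
  normc (cexp (s +i* y) / (cexp (s +i* y) - z0)) <= r / (r - 1).
Proof.
set e := cexp _; have er : normc e = r by rewrite normc_cexp.
have d : r - 1 <= normc (e - z0).
  rewrite lerBlDr -z01 -{1}er -[X in normc X <= _](subrK z0).
  exact: le_normcD.
rewrite normcM normcV er ler_pM2l// lef_pV2// posrE//.
exact: lt_le_trans d.
Qed.

Let k_left y :
  normc (cexp (- s +i* y) / (cexp (- s +i* y) - z0)) <= (r - 1)^-1.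
Proof.
set e := cexp _; have er : normc e = r^-1 by rewrite normc_cexp /= expRN es.
have d : 1 - r^-1 <= normc (e - z0).
  rewrite lerBlDr normcB -z01 -{1}er -[X in normc X <= _](subrK e).
  exact: le_normcD.
have r10 : 0 < 1 - r^-1 by rewrite subr_gt0 invf_lt1.
rewrite normcM normcV er.
have -> : (r - 1)^-1 = r^-1 / (1 - r^-1).
  by field; rewrite !gt_eqF//.
rewrite ler_pM2l ?invr_gt0// lef_pV2// posrE//.
exact: lt_le_trans d.
Qed.

Let vdiff_G_mul (E : R[i]^o -> R[i]^o) x : - s <= x <= s -> vdiff E x ->
  vdiff (fun w => (G w - c0) * E w) x.
Proof.
move=> xs dE y; apply: differentiable_mul; last exact: dE.
by apply: differentiable_sub; [exact: differentiable_strip|exact: differentiable_const].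
Qed.

Let vint_G_mul (E : R[i]^o -> R[i]^o) x : - s <= x <= s -> vdiff E x ->
  vint (fun w => (G w - c0) * E w) x = vint (fun w => G w * E w) x - c0 * vint E x.
Proof.
move=> xs dE.
have dGE : vdiff (fun w => G w * E w) x.
  by move=> y; apply: differentiable_mul; [exact: differentiable_strip|exact: dE].
rewrite -[X in X - _]mul1r -mulNr -vint_lin//; congr vint.
by apply: funext => w; ring.
Qed.

Let vdiff_kernel x : (forall y, cexp (x +i* y) != z0) ->
  vdiff (fun w => cexp w / (cexp w - z0)) x.
Proof.
move=> ne y; apply: differentiable_mul; first exact: differentiable_cexp.
apply: differentiable_inv; last by rewrite subr_eq0.
apply: differentiable_sub; first exact: differentiable_cexp.
exact: differentiable_const.
Qed.

Let remainder_bound (E : R[i]^o -> R[i]^o) x K : - s <= x <= s -> vdiff E x ->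
  (forall y, normc (E (x +i* y)) <= K) ->
  normc (vint (fun w => (G w - c0) * E w) x) <= 8 * pi * M * K.
Proof.
move=> xs dE EK; apply: (le_trans (vint_bound (K := 2 * M * K) _ _)).
- exact: vdiff_G_mul.
- by move=> y; rewrite normcM ler_pM ?normc_ge0// GcM.
- by rewrite le_eqVlt; apply/orP; left; apply/eqP; move: (pi : R) => P; ring.
Qed.

(** The integrals of e^(- n w) vanish for n > 0, so [c0] survives only at n = 0. There is one term
    more than on the left: it makes up for the kernel, whose bound is larger here by the factor r,
    and the two remainder bounds agree. *)
Lemma right_side m : exists2 rem, normc rem <= 8 * pi * M * (r ^- m / (r - 1)) &
  vint h s = \sum_(n < m.+1) z0 ^+ n * A n - (2 * pi)%:C * c0 + rem.
Proof.
pose E w := (z0 * cexp (- w)) ^+ m.+1 * (cexp w / (cexp w - z0)).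
have dP n : vdiff (fun w => (z0 * cexp (- w)) ^+ n) s.
  move=> y; apply/differentiable_exp/differentiable_scale.
  exact: differentiable_cexpN.
have dE : vdiff E s.
  by move=> y; apply: differentiable_mul; [exact: dP|exact: vdiff_kernel].
exists (vint (fun w => (G w - c0) * E w) s).
  apply: remainder_bound => // y; rewrite /E normcM normcX normcM z01 mul1r.
  have -> : normc (cexp (- (s +i* y))) = r^-1 by rewrite normc_cexp /= expRN es.
  rewrite exprVn.
  have -> : r ^- m / (r - 1) = r ^- m.+1 * (r / (r - 1)).
    by rewrite exprSr; field; rewrite !gt_eqF// exprn_gt0.
  by rewrite ler_pM2l ?invr_gt0 ?exprn_gt0// k_right.
have -> : vint h s = vint (fun w => \sum_(n < m.+1)
    (G w - c0) * (z0 * cexp (- w)) ^+ n + (G w - c0) * E w) s.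
  apply: eq_lint => t _; rewrite vpointE /h.
  rewrite (kernel_right m.+1 (cexp_neq0 _) (z0_right t)) mulrDr mulr_sumr.
  by rewrite /E cexpN.
rewrite /vint lintD; last 2 first.
- apply: vdiff_line => y; apply: differentiable_sumr => j.
  exact: vdiff_G_mul.
- by apply: vdiff_line; exact: vdiff_G_mul.
congr (_ + _); rewrite -/(vint _ _) vint_sum; last first.
  by move=> j; exact: vdiff_G_mul.
have H n : vint (fun w => (G w - c0) * (z0 * cexp (- w)) ^+ n) s =
    z0 ^+ n * A n - c0 * (z0 ^+ n * vint (fun w => cexp (- w) ^+ n) s).
  have de : vdiff (fun w => cexp (- w) ^+ n) s.
    by move=> y; apply: differentiable_exp; exact: differentiable_cexpN.
  rewrite vint_G_mul//.
  have dg : vdiff (fun w => G w * cexp (- w) ^+ n) s.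
    by move=> y; apply: differentiable_mul; [exact: differentiable_strip|exact: de].
  have -> : z0 ^+ n * A n = vint (fun w => z0 ^+ n * (G w * cexp (- w) ^+ n)) s.
    exact: (esym (vintZ (z0 ^+ n) dg)).
  have -> : z0 ^+ n * vint (fun w => cexp (- w) ^+ n) s =
      vint (fun w => z0 ^+ n * cexp (- w) ^+ n) s.
    exact: (esym (vintZ (z0 ^+ n) de)).
  have -> : (fun w => G w * (z0 * cexp (- w)) ^+ n) =
      (fun w => z0 ^+ n * (G w * cexp (- w) ^+ n)).
    by apply: funext => w; rewrite exprMn mulrCA.
  have -> // : (fun w => (z0 * cexp (- w)) ^+ n) = (fun w => z0 ^+ n * cexp (- w) ^+ n).
  by apply: funext => w; rewrite exprMn.
under eq_bigr do rewrite H.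
rewrite sumrB; congr (_ - _).
rewrite big_ord_recl /= big1 ?addr0 => [|n _].
  rewrite expr0 mul1r mulrC; congr (_ * _).
  by rewrite -(vint_one s); apply: eq_lint => t _; rewrite expr0.
by rewrite vint_cexpN_expr// !mulr0.
Qed.

(** The geometric series has only positive powers of e^w here, so [c0] drops out of the sum. *)
Lemma left_side m : exists2 rem, normc rem <= 8 * pi * M * (r ^- m / (r - 1)) &
  vint h (- s) = - \sum_(n < m) z0 ^- n.+1 * B n.+1 + rem.
Proof.
have z0n : z0 != 0 by apply: cexp_neq0.
pose E w := (cexp w / z0) ^+ m * (cexp w / (cexp w - z0)).
have dP n : vdiff (fun w => (cexp w / z0) ^+ n) (- s).
  move=> y; apply/differentiable_exp/differentiable_mul.
    exact: differentiable_cexp.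
  exact: differentiable_const.
have dE : vdiff E (- s).
  by move=> y; apply: differentiable_mul; [exact: dP|exact: vdiff_kernel].
exists (vint (fun w => (G w - c0) * E w) (- s)).
  apply: remainder_bound => // y; rewrite /E normcM normcX normcM normcV z01.
  have -> : normc (cexp (- s +i* y)) = r^-1 by rewrite normc_cexp /= expRN es.
  rewrite invr1 mulr1 exprVn.
  by rewrite ler_pM2l ?invr_gt0 ?exprn_gt0// k_left.
have -> : vint h (- s) = vint (fun w => \sum_(n < m)
    (G w - c0) * (- (cexp w / z0) ^+ n.+1) + (G w - c0) * E w) (- s).
  apply: eq_lint => t _; rewrite vpointE /h.
  rewrite (kernel_left m z0n (z0_left t)) mulrDr -sumrN mulr_sumr.
  by [].
rewrite /vint lintD; last 2 first.
- apply: vdiff_line => y; apply: differentiable_sumr => j.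
  by apply: (vdiff_G_mul Ns_in) => ?; apply: differentiableN; exact: dP.
- by apply: vdiff_line; exact: vdiff_G_mul.
congr (_ + _); rewrite -/(vint _ _) vint_sum; last first.
  by move=> j; apply: (vdiff_G_mul Ns_in) => ?; apply: differentiableN; exact: dP.
rewrite -sumrN; apply: eq_bigr => n _.
have de : vdiff (fun w => cexp w ^+ n.+1) (- s).
  by move=> y; apply: differentiable_exp; exact: differentiable_cexp.
have -> : vint (fun w => (G w - c0) * (- (cexp w / z0) ^+ n.+1)) (- s) =
    (- z0 ^- n.+1) * vint (fun w => (G w - c0) * cexp w ^+ n.+1) (- s).
  rewrite -vintZ; last exact: vdiff_G_mul.
  congr vint; apply: funext => w; rewrite exprMn exprVn.
  by move: (G w - c0) (cexp w ^+ n.+1) => g e; ring.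
by rewrite vint_G_mul// vint_cexp_expr// mulr0 subr0 mulNr.
Qed.

(** Equating the two sides exhibits [c0] as a truncated Laurent sum in [z0]; the two remainders,
    with constant 16 pi M together, are divided by 2 pi. *)
Lemma contour_formula m :
  normc (c0 - (2 * pi)%:C^-1 * (\sum_(n < m.+1) z0 ^+ n * A n +
                \sum_(n < m) z0 ^- n.+1 * B n.+1)) <= 8 * M * (r ^- m / (r - 1)).
Proof.
have [rem1 b1 E1] := right_side m; have [rem2 b2 E2] := left_side m.
have p0 : 0 < 2 * pi :> R by rewrite mulr_gt0// pi_gt0.
have p0' : (2 * pi)%:C != 0 :> R[i].
  by rewrite -normc_eq0 normc_real normr_eq0 gt_eqF.
have := vint_cauchy_integrand; rewrite E1 E2.
set S1 := \sum_(n < m.+1) _; set S2 := \sum_(n < m) _ => E.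
have -> : c0 - (2 * pi)%:C^-1 * (S1 + S2) = (2 * pi)%:C^-1 * (rem1 - rem2).
  have -> : rem1 - rem2 = (2 * pi)%:C * c0 - (S1 + S2).
    rewrite -[rem1](addKr (S1 - (2 * pi)%:C * c0)) -E; ring.
  by rewrite mulrBr mulKf.
rewrite normcM normcV normc_real gtr0_norm// mulrC ler_pdivrMr//.
apply: (le_trans (le_normcB _ _)); apply: (le_trans (lerD b1 b2)).
by rewrite le_eqVlt; apply/orP; left; apply/eqP; move: (pi : R) => P; ring.
Qed.

End Point.

End Contour.

End BernsteinApproximation.

Section ChebyshevApproximation.
Context {R : realType}.
Variables (f : R[i]^o -> R[i]^o) (rho r M : R).
Hypotheses (r1 : 1 < r) (rrho : r < rho).
Hypothesis df : forall z, bernstein_disc rho z -> differentiable f (z : R[i]^o).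
Hypothesis fM : forall z, bernstein_disc rho z -> normc (f z) <= M.

Lemma bernstein_disc_real (x : R) : -1 <= x <= 1 -> bernstein_disc rho x%:C.
Proof.
move=> /andP[x1 x2]; rewrite /bernstein_disc/=.
have rho1 := lt_trans r1 rrho; have rho0 : 0 < rho by apply: lt_trans rho1.
rewrite addr0 subrr expr0n !addr0 !sqrtr_sqr ler0_norm ?subr_le0//.
rewrite ger0_norm -?lerBlDr ?sub0r//.
have -> : - (x - 1) + (x + 1) = 1 + 1^-1 by rewrite invr1; ring.
by apply: addV_lt => //; rewrite ?invf_lt1.
Qed.

(** The angles tau and -tau give the same value of f, with [z0] replaced by its inverse. The mean of
    the two Laurent sums is symmetric under this exchange, hence a Chebyshev sum of degree at most m
    in cos tau. *)
Lemma bernstein_approx m : exists p : {poly R[i]}, (size p <= m.+1)%N /\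
  forall x : R, -1 <= x <= 1 -> normc (f x%:C - p.[x%:C]) <= 8 * M * (r ^- m / (r - 1)).
Proof.
pose A n := vint (fun w => f (joukowski (cexp w)) * cexp (- w) ^+ n) (ln r).
pose B n := vint (fun w => f (joukowski (cexp w)) * cexp w ^+ n) (- ln r).
pose T n : {poly R[i]} := (chebyshev n).1.
pose p := ((2 * pi)%:C^-1 : R[i]) *:
  (\sum_(n < m.+1) A n *: T n + \sum_(n < m) B n.+1 *: T n.+1).
exists p; split.
  apply: (leq_trans (size_scale_leq _ _)).
  apply: (leq_trans (size_polyD _ _)); rewrite geq_max; apply/andP; split.
    apply: (leq_trans (size_sum _ _ _)); apply/bigmax_leqP => n _.
    apply: (leq_trans (size_scale_leq _ _)).
    by apply: (leq_trans (size_chebyshev n).1); exact: ltn_ord.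
  apply: (leq_trans (size_sum _ _ _)); apply/bigmax_leqP => n _.
  apply: (leq_trans (size_scale_leq _ _)).
  by apply: (leq_trans (size_chebyshev n.+1).1); exact: ltn_ord.
have main tau : - pi < tau < pi ->
    normc (f (cos tau)%:C - p.[(cos tau)%:C]) <= 8 * M * (r ^- m / (r - 1)).
  move=> tp; have tp' : - pi < - tau < pi by rewrite ltrN2 andbC -ltrNl; case/andP: tp => -> ->.
  have := contour_formula r1 rrho df fM tp' m.
  have := contour_formula r1 rrho df fM tp m.
  rewrite !joukowski_cos cosN.
  have -> : cexp (0 +i* - tau) = (cexp (0 +i* tau))^-1 :> R[i].
    by rewrite -cexpN; congr cexp; apply/eqP; rewrite eq_complex/= oppr0 !eqxx.
  have := joukowski_cos tau; have := cexp_neq0 (0 +i* tau : R[i]).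
  move: (cexp _) => z0 z0n jz.
  set K := _^-1; set S1 := (X in normc (_ - K * X) <= _ -> _) => H1.
  set S2 := (X in normc (_ - K * X) <= _ -> _) => H2.
  have -> : p.[(cos tau)%:C] = K * ((S1 + S2) / 2).
    have TE n : (T n).[(cos tau)%:C] = (z0 ^+ n + z0 ^- n) / 2.
      by rewrite -jz; have [-> _] := chebyshev_joukowski n z0n.
    rewrite /p hornerZ hornerD !horner_sum -/K; congr (_ * _).
    rewrite /S1 /S2 addrACA -!big_split/= mulrDl !mulr_suml.
    congr (_ + _); apply: eq_bigr => n _; rewrite hornerZ TE -/(A _) -/(B _).
      by rewrite exprVn; ring.
    by rewrite exprVn invrK; ring.
  have -> : f (cos tau)%:C - K * ((S1 + S2) / 2) =
      (f (cos tau)%:C - K * S1 + (f (cos tau)%:C - K * S2)) / 2.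
    by field.
  rewrite normcM normcV normc_natr ler_pdivrMr// [leRHS]mulr_natr mulr2n.
  by apply: (le_trans (le_normcD _ _)); apply: lerD.
have main' x : -1 < x <= 1 ->
    normc (f x%:C - p.[x%:C]) <= 8 * M * (r ^- m / (r - 1)).
  move=> /andP[x1 x2]; have x11 : -1 <= x <= 1 by rewrite ltW.
  rewrite -(acosK x11); apply: main.
  rewrite (lt_le_trans _ (acos_ge0 x11)) ?oppr_lt0 ?pi_gt0//=.
  by apply: acos_ltpi; rewrite x1.
move=> x; rewrite le_eqVlt => /andP[/predU1P[<- _|x1 x2]]; last first.
  by apply: main'; rewrite x1.
(* The endpoint [-1 = cos pi] is the singular point of the contour; it is
   recovered by continuity. *)
apply/ler_addgt0Pl => e e0.
have dg : differentiable (fun w => f w - p.[w] : R[i]^o) (0 + (-1)%:C * 1 : R[i]^o).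
  rewrite add0r mulr1; apply: differentiable_sub.
    by apply/df/bernstein_disc_real; rewrite lexx ge0_cp.
  exact: differentiable_polyC.
have [d d0 H] := diff_line_cts dg e0.
pose t := -1 + Num.min (d / 2) 1.
have u0 : 0 < Num.min (d / 2) 1 by rewrite lt_min divr_gt0 ?ltr01.
have u1 : Num.min (d / 2) 1 <= 1 by rewrite ge_min lexx orbT.
have ud : Num.min (d / 2) 1 < d by rewrite gt_min; apply/orP; left; move: d0; lra.
have := H t; rewrite /t addrAC subrr add0r gtr0_norm// => /(_ ud).
rewrite !add0r !mulr1 => {}H.
set F := f _ - _; set F' := (f _ - p.[_]) in H.
have -> : F = F' - (F' - F) by ring.
apply: (le_trans (le_normcB _ _)); rewrite addrC; apply: lerD => //.
apply: main'; rewrite ltrDl u0/=.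
by move: u1; lra.
Qed.

End ChebyshevApproximation.

(** * Geometry of Bernstein discs *)

Section BernsteinDiscs.
Context {R : realType}.
Implicit Types (a b x y t M N q rho sigma : R) (z w : R[i]).

(** The roots of u^2 - 2 z u + 1 have product 1, so one of them has modulus at least 1. *)
Lemma joukowski_surj z : exists2 u, 1 <= normc u & joukowski u = z.
Proof.
pose u := z + sqrtc (z ^+ 2 - 1).
have uE : u * (2 * z - u) = 1.
  have -> : u * (2 * z - u) = z ^+ 2 - sqrtc (z ^+ 2 - 1) ^+ 2 by rewrite /u; ring.
  by rewrite sqr_sqrtc; ring.
have u0 : u != 0.
  by apply/eqP => u0; move: uE; rewrite u0 mul0r => /eqP; rewrite eq_sym oner_eq0.
have uV : u^-1 = 2 * z - u.
  by apply: (mulfI u0); rewrite uE divff.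
have ju : joukowski u = z by rewrite /joukowski uV addrC subrK; field.
have [n1|n1] := leP 1 (normc u); first by exists u.
exists u^-1; last by rewrite -ju /joukowski invrK addrC.
by rewrite normcV invf_ge1 ?normc_gt0// ltW.
Qed.

Lemma bernstein_disc_joukowski rho z : 1 < rho -> bernstein_disc rho z ->
  exists u, [/\ 1 <= normc u, normc u < rho & joukowski u = z].
Proof.
move=> rho1; have [u u1 <-] := joukowski_surj z.
rewrite /bernstein_disc/= joukowski_sum; last first.
  by rewrite -normc_gt0 (lt_le_trans _ u1).
move=> H; exists u; split=> //; rewrite ltNge; apply/negP => ru.
move: H; rewrite ltNge => /negP[].
move: ru; rewrite le_eqVlt => /predU1P[<-//|ru].
have u1' := lt_trans rho1 ru.
apply/ltW/addV_lt => //; apply: lt_trans rho1.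
by rewrite invf_lt1// (lt_trans _ u1').
Qed.

(** The preimage u is projected to v = u / |u|, whose image is the real number Re v. The two images
    differ by at most the mean of |u| - 1 and 1 - 1/|u|, hence by at most |u| - 1. *)
Lemma bernstein_disc_near rho z : 1 < rho -> bernstein_disc rho z ->
  exists2 t, -1 <= t <= 1 & normc (z - t%:C) < rho - 1.
Proof.
move=> rho1 /(bernstein_disc_joukowski rho1)[u [u1 ur <-]].
have n0 : 0 < normc u by apply: lt_le_trans u1.
have u0 : u != 0 by rewrite -normc_gt0.
pose n := (normc u)%:C; have nn : n != 0 by rewrite -normc_eq0 normc_real normr_eq0 gt_eqF.
pose v := u / n.
have v1 : normc v = 1 by rewrite normcM normcV normc_real gtr0_norm// divff// gt_eqF.
have v0 : v != 0 by rewrite mulf_neq0// invr_neq0.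
have vV : v^-1 = complex.Re v -i* complex.Im v.
  apply: (mulfI v0); rewrite divff//; apply/esym/eqP.
  have := normc2 v; rewrite v1 expr1n; case: (v) => x y /= E.
  rewrite eq_complex/= mulrN opprK -!expr2 -E eqxx /=.
  by rewrite mulrN mulrC addrC subrr.
have jv : joukowski v = (complex.Re v)%:C.
  rewrite /joukowski vV; case: (v) => x y /=.
  have -> : x +i* y + (x +i* - y) = 2 * x%:C.
    by apply/eqP; rewrite eq_complex/=; apply/andP; split; apply/eqP; ring.
  by rewrite mulrC mulKf// pnatr_eq0.
exists (complex.Re v); first by rewrite -ler_norml (le_trans (Re_le_normc _)) ?v1.
have uE : u = n * v by rewrite /v mulrCA divff// mulr1.
clearbody v.
have -> : joukowski u - (complex.Re v)%:C = ((n - 1) * v + (n^-1 - 1) * v^-1) / 2.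
  by rewrite -jv uE /joukowski; field; rewrite v0 nn.
have n1 : normc (n - 1) = normc u - 1.
  by rewrite /n -(rmorph1 (real_complex R)) -rmorphB normc_real ger0_norm// subr_ge0.
have n2 : normc (n^-1 - 1) = 1 - (normc u)^-1.
  rewrite normcB /n -fmorphV -(rmorph1 (real_complex R)) -rmorphB normc_real.
  by rewrite ger0_norm// subr_ge0 invf_le1.
rewrite normcM normcV normc_natr ltr_pdivrMr//.
apply: (le_lt_trans (le_normcD _ _)); rewrite !normcM n1 n2 normcV v1 invr1 !mulr1.
have : 1 <= normc u + (normc u)^-1 - 1.
  have -> : normc u + (normc u)^-1 - 1 = 1 + (normc u - 1) ^+ 2 / normc u.
    by field; rewrite gt_eqF.
  by rewrite lerDl divr_ge0 ?sqr_ge0 ?ltW.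
by move: ur; lra.
Qed.

Lemma bernstein_disc_onP rho a b z : a < b ->
  bernstein_disc_on rho a b z <->
  normc (z - b%:C) + normc (z - a%:C) < (b - a) / 2 * (rho + rho^-1).
Proof.
move=> ab; have h0 : 0 < (b - a) / 2 by rewrite divr_gt0// subr_gt0.
have hn : ((b - a) / 2)%:C != 0 :> R[i] by rewrite -normc_eq0 normc_real normr_eq0 gt_eqF.
have E w : normc (((a + b) / 2)%:C + ((b - a) / 2)%:C * w - b%:C) +
    normc (((a + b) / 2)%:C + ((b - a) / 2)%:C * w - a%:C) =
    (b - a) / 2 * (normc (w - 1) + normc (w + 1)).
  have -> : ((a + b) / 2)%:C + ((b - a) / 2)%:C * w - b%:C = ((b - a) / 2)%:C * (w - 1).
    have -> : b%:C = ((a + b) / 2)%:C + ((b - a) / 2)%:C :> R[i].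
      by rewrite -rmorphD; congr (_%:C); field.
    by ring.
  have -> : ((a + b) / 2)%:C + ((b - a) / 2)%:C * w - a%:C = ((b - a) / 2)%:C * (w + 1).
    have -> : a%:C = ((a + b) / 2)%:C - ((b - a) / 2)%:C :> R[i].
      by rewrite -rmorphB; congr (_%:C); field.
    by ring.
  by rewrite !normcM normc_real gtr0_norm// mulrDr.
split=> [[w wd <-]|H]; first by rewrite E ltr_pM2l.
pose w := (z - ((a + b) / 2)%:C) / ((b - a) / 2)%:C.
have Ez : ((a + b) / 2)%:C + ((b - a) / 2)%:C * w = z.
  by rewrite /w mulrCA divff// mulr1 addrC subrK.
by exists w => //; rewrite /bernstein_disc/= -(ltr_pM2l h0) -E Ez.
Qed.

(** Moving the foci from a', b' to a, b raises the sum of focal distances by at most (b - a) - (b' -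
    a'). It remains to compare the excesses of these sums over the distance of the foci, and they
    scale with the side lengths. *)
Lemma bernstein_disc_on_subset q sigma rho a b a' b' z :
  1 < sigma -> 1 < rho -> a <= a' -> a' < b' -> b' <= b -> b' - a' <= q * (b - a) ->
  q * (sigma + sigma^-1 - 2) <= rho + rho^-1 - 2 ->
  bernstein_disc_on sigma a' b' z -> bernstein_disc_on rho a b z.
Proof.
move=> s1 r1 aa ab' bb hq qs.
have ab : a < b by apply: (le_lt_trans aa); apply: lt_le_trans bb.
rewrite !bernstein_disc_onP// => H.
have h1 : normc (z - b%:C) <= normc (z - b'%:C) + (b - b').
  have -> : z - b%:C = z - b'%:C - (b - b')%:C by rewrite rmorphB; ring.
  apply: (le_trans (le_normcB _ _)).
  by rewrite normc_real ger0_norm// subr_ge0.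
have h2 : normc (z - a%:C) <= normc (z - a'%:C) + (a' - a).
  have -> : z - a%:C = z - a'%:C + (a' - a)%:C by rewrite rmorphB; ring.
  apply: (le_trans (le_normcD _ _)).
  by rewrite normc_real ger0_norm// subr_ge0.
have s2 : 0 <= sigma + sigma^-1 - 2.
  have s0 : 0 < sigma by apply: lt_trans s1.
  have -> : sigma + sigma^-1 - 2 = (sigma - 1) ^+ 2 / sigma by field; rewrite gt_eqF.
  by rewrite divr_ge0 ?sqr_ge0 ?ltW.
have h3 : (b' - a') * (sigma + sigma^-1 - 2) <= (b - a) * (rho + rho^-1 - 2).
  apply: (le_trans (ler_wpM2r s2 hq)); rewrite -mulrA mulrCA ler_wpM2l//.
  by rewrite subr_ge0 ltW.
move: H h1 h2 h3; move: (normc _) (normc _) (normc _) (normc _) => n1 n2 n3 n4.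
move: (sigma + sigma^-1) (rho + rho^-1) => S Q; lra.
Qed.

Lemma bernstein_disc_on_convex rho a b z w t : a < b -> 0 <= t <= 1 ->
  bernstein_disc_on rho a b z -> bernstein_disc_on rho a b w ->
  bernstein_disc_on rho a b (z + t%:C * (w - z)).
Proof.
move=> ab /andP[t0 t1]; rewrite !bernstein_disc_onP// => hz hw.
have E c : normc (z + t%:C * (w - z) - c) <= (1 - t) * normc (z - c) + t * normc (w - c).
  have -> : z + t%:C * (w - z) - c = (1 - t)%:C * (z - c) + t%:C * (w - c).
    by rewrite rmorphB rmorph1; ring.
  apply: (le_trans (le_normcD _ _)); rewrite !normcM !normc_real.
  by rewrite !ger0_norm// subr_ge0.
apply: (le_lt_trans (lerD (E _) (E _))).
have -> : (1 - t) * normc (z - b%:C) + t * normc (w - b%:C) +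
   ((1 - t) * normc (z - a%:C) + t * normc (w - a%:C)) =
   (1 - t) * (normc (z - b%:C) + normc (z - a%:C)) +
   t * (normc (w - b%:C) + normc (w - a%:C)) by ring.
move: hz hw; move: (_ + _) (_ + _) ((b - a) / 2 * _) => A B K hA hB.
have -> : K = (1 - t) * K + t * K by ring.
move: t0; rewrite le_eqVlt => /predU1P[<-|t0].
  by rewrite subr0 !mul1r !mul0r !addr0.
by apply: ler_ltD; [rewrite ler_wpM2l ?subr_ge0// ltW|rewrite ltr_pM2l].
Qed.

Lemma bernstein_disc_on_real rho a b t : 1 < rho -> a < b -> a <= t <= b ->
  bernstein_disc_on rho a b t%:C.
Proof.
move=> r1 ab /andP[at_ tb]; rewrite bernstein_disc_onP//.
rewrite -!rmorphB !normc_real ler0_norm ?subr_le0// ger0_norm ?subr_ge0//.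
have rV : rho^-1 < 1 by rewrite invf_lt1// (lt_trans _ r1).
have H := addV_lt r1 rV r1; rewrite invr1 in H.
have -> : - (t - b) + (t - a) = (b - a) / 2 * (1 + 1) by field.
by rewrite ltr_pM2l// divr_gt0// subr_gt0.
Qed.

End BernsteinDiscs.

(** * Interpolation *)

Section UnivariateInterpolation.
Context {R : realType} {m : nat}.
Variable xi : 'I_m.+1 -> R.
Hypothesis xi_inj : injective xi.
Hypothesis xi_in : forall j, -1 <= xi j <= 1.
Local Notation ell j t := (lagrange_poly xi j).[t].

Lemma lagrange_node j k : ell j (xi k) = (j == k)%:R.
Proof.
rewrite /lagrange_poly horner_prod; have [->|jk] := eqVneq j k.
  rewrite big1 // => i ik.
  rewrite hornerZ hornerD hornerN hornerX hornerC mulVf// subr_eq0.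
  by apply: contraNneq ik => /xi_inj ->.
rewrite (bigD1 k)/= 1?eq_sym// hornerZ hornerD hornerN hornerX hornerC.
by rewrite subrr mulr0 mul0r.
Qed.

Lemma size_lagrange j : (size (lagrange_poly xi j) <= m.+1)%N.
Proof.
apply: (leq_trans (size_prod_leq _ _)).
rewrite (@leq_trans ((\sum_(k < m.+1 | k != j) 2).+1 - #|predC1 j|))//.
  apply: leq_sub2r; rewrite ltnS; apply: leq_sum => k _.
  by apply: (leq_trans (size_scale_leq _ _)); rewrite size_XsubC.
rewrite sum_nat_const (eq_card (B := predC1 j))// cardC1 card_ord /=.
by rewrite muln2 -addnn subSn ?leq_addr// addnK.
Qed.

(* The interpolant of the signs of the [ell j t], clipped to [-1, 1], is a
   continuous function of norm at most 1 that attains the sum. *)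
Lemma lebesgue_sum (Lam : R) :
  (lebesgue_constant xi <= Lam%:E)%E ->
  forall t, -1 <= t <= 1 -> \sum_j `|ell j t| <= Lam.
Proof.
move=> HL t tI; pose I : set R := `[-1, 1]%classic; pose sg j := Num.sg (ell j t).
pose p := \sum_j (sg j) *: lagrange_poly xi j.
pose clip (x : R) := Num.max (-1) (Num.min 1 x).
pose f (x : R) : R[i]^o := (clip p.[x])%:C.
have clip1 x : `|clip x| <= 1.
  by rewrite ler_norml /clip le_max lexx/= ge_max ge0_cp// ge_min lexx.
have clipP x : [\/ clip x = 1 /\ 1 < x, clip x = -1 /\ x <= -1 |
    clip x = x /\ -1 <= x <= 1].
  rewrite /clip; have [x1|x1] := ltP 1 x.
    by rewrite max_r ?ge0_cp//; apply: Or31.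
  have [x2|x2] := leP x (-1); first by apply: Or32.
  by apply: Or33; rewrite ltW.
have clip_lip x y : `|clip x - clip y| <= `|x - y|.
  have h1 := ler_norm (x - y); have h2 := ler_norm (- (x - y)).
  rewrite normrN in h2; have h0 := normr_ge0 (x - y).
  by rewrite ler_norml; case: (clipP x) => -[-> hx]; case: (clipP y) => -[-> hy];
    apply/andP; split; lra.
have pn j : p.[xi j] = sg j.
  rewrite horner_sum (bigD1 j)//= hornerZ lagrange_node eqxx mulr1 big1 ?addr0//.
  by move=> k kj; rewrite hornerZ lagrange_node (negbTE kj) mulr0.
have fn j : f (xi j) = (sg j)%:C.
  rewrite /f pn; congr (_%:C); rewrite /sg.
  by case: sgrP => _; [have := clipP 0|have := clipP 1|have := clipP (-1)];
    case=> -[-> h] //; lra.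
have fcts : {within I, continuous f}.
  apply: continuous_subspaceT => x; apply/cvgrPdist_le => /= e e0.
  have eR : e = (complex.Re e)%:C by rewrite RRe_real// gtr0_real.
  have e0' : 0 < complex.Re e by rewrite -ltcR -eR.
  have pc : {for x, continuous (horner p)} by exact: continuous_horner.
  have /cvgrPdist_le/(_ _ e0') := pc.
  apply: filterS => y /= H; rewrite normE /f -rmorphB normc_real eR lecR.
  exact: le_trans (clip_lip _ _) H.
have fle : (Linfty I (fun t => normc (f t)) <= 1%:E)%E.
  by apply: ge_ereal_sup => _ [x _ <-]; rewrite lee_fin /f normc_real.
have H : ((normc (interp xi f t))%:E <= Lam%:E)%E.
  apply: le_trans HL; apply: (@le_trans _ _ (Linfty I (fun t => normc (interp xi f t)))).
    by apply: ereal_sup_ubound; exists t => //=; rewrite /I/= in_itv.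
  by apply: ereal_sup_ubound; exists f.
move: H; rewrite lee_fin; apply: le_trans.
have -> : interp xi f t = (\sum_j `|ell j t|)%:C.
  rewrite /interp rmorph_sum/=; apply: eq_bigr => j _.
  by rewrite fn -[_ *: _]/(_ * _) -rmorphM/=; congr (_%:C); rewrite mulrC normrEsg.
by rewrite normc_real ger0_norm// sumr_ge0.
Qed.

Lemma interp_poly (p : {poly R[i]}) (t : R) : (size p <= m.+1)%N ->
  interp xi (fun x => p.[x%:C] : R[i]^o) t = p.[t%:C].
Proof.
move=> sp; pose L j := map_poly (real_complex R) (lagrange_poly xi j).
have LE j (x : R) : (L j).[x%:C] = (ell j x)%:C by rewrite horner_map.
pose d := p - \sum_j p.[(xi j)%:C] *: L j.
suff d0 : d = 0.
  have : d.[t%:C] = 0 by rewrite d0 horner0.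
  rewrite hornerD hornerN horner_sum => /eqP; rewrite subr_eq0 => /eqP ->.
  by apply: eq_bigr => j _; rewrite hornerZ LE mulrC.
apply/eqP; apply/negPn/negP => d0.
have /(max_poly_roots d0) : all (root d) [seq (xi j)%:C | j <- enum 'I_m.+1].
  apply/allP => _ /mapP[j _ ->]; apply/eqP.
  rewrite hornerD hornerN horner_sum (bigD1 j)//= hornerZ LE lagrange_node eqxx mulr1.
  by rewrite big1 ?addr0 ?subrr// => k kj; rewrite hornerZ LE lagrange_node (negbTE kj) mulr0.
rewrite map_inj_uniq ?enum_uniq => [/(_ isT)|]; last by move=> j k /complexI/xi_inj.
rewrite size_map size_enum_ord ltnNge => /negP[].
apply: (leq_trans (size_polyD _ _)); rewrite size_polyN geq_max sp/=.
apply: (leq_trans (size_sum _ _ _)); apply/bigmax_leqP => j _.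
apply: (leq_trans (size_scale_leq _ _)); apply: (leq_trans (size_poly _ _)).
exact: size_lagrange.
Qed.

Variable Lam : R.
Hypothesis LamP : forall t, -1 <= t <= 1 -> \sum_j `|ell j t| <= Lam.

Lemma interp_bound (f : R -> R[i]^o) N t : -1 <= t <= 1 ->
  (forall x, -1 <= x <= 1 -> normc (f x) <= N) -> normc (interp xi f t) <= Lam * N.
Proof.
move=> tI fN; apply: (le_trans (normc_sum _ _ _)).
have N0 : 0 <= N by apply: le_trans (fN _ tI); exact: normc_ge0.
apply: (@le_trans _ _ (\sum_j `|ell j t| * N)).
  by apply: ler_sum => j _; rewrite normcM normc_real ler_wpM2l// fN.
by rewrite -mulr_suml ler_wpM2r// LamP.
Qed.

(** Lebesgue's lemma: [p] is reproduced by interpolation, so the error of f is that of f - p. *)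
Lemma interp_error (f : R -> R[i]^o) (p : {poly R[i]}) e t : -1 <= t <= 1 ->
  (size p <= m.+1)%N ->
  (forall x, -1 <= x <= 1 -> normc (f x - p.[x%:C]) <= e) ->
  normc (f t - interp xi f t) <= (1 + Lam) * e.
Proof.
move=> tI sp fp.
have -> : f t - interp xi f t =
    (f t - p.[t%:C]) - interp xi (fun x => f x - p.[x%:C] : R[i]^o) t.
  have -> : interp xi (fun x => f x - p.[x%:C] : R[i]^o) t =
      interp xi f t - interp xi (fun x => p.[x%:C] : R[i]^o) t.
    by rewrite /interp -sumrB; apply: eq_bigr => j _; rewrite scalerBr.
  by rewrite interp_poly//; ring.
rewrite mulrDl mul1r; apply: (le_trans (le_normcB _ _)).
by apply: lerD; [exact: fp|exact: interp_bound].
Qed.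

Variables a b : R.
Hypothesis ab : a < b.

Let to_unit s : a <= s <= b -> -1 <= (s - (a + b) / 2) / ((b - a) / 2) <= 1.
Proof.
have h0 : 0 < (b - a) / 2 by rewrite divr_gt0// subr_gt0.
by move=> sab; rewrite ler_pdivlMr// ler_pdivrMr//; lra.
Qed.

Let of_unit t : -1 <= t <= 1 -> a <= (a + b) / 2 + (b - a) / 2 * t <= b.
Proof.
move=> /andP[t1 t2].
have h0 : 0 < (b - a) / 2 by rewrite divr_gt0// subr_gt0.
have := ler_wpM2l (ltW h0) t1; have := ler_wpM2l (ltW h0) t2.
by move=> ? ?; apply/andP; split; lra.
Qed.

Lemma interp_on_bound (f : R -> R[i]^o) N s : a <= s <= b ->
  (forall x, a <= x <= b -> normc (f x) <= N) ->
  normc (interp_on xi a b f s) <= Lam * N.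
Proof.
move=> sab fN; apply: interp_bound; first exact: to_unit.
by move=> x /of_unit; exact: fN.
Qed.

Lemma interp_on_error (f : R -> R[i]^o) (p : {poly R[i]}) e s : a <= s <= b ->
  (size p <= m.+1)%N ->
  (forall x, -1 <= x <= 1 ->
    normc (f ((a + b) / 2 + (b - a) / 2 * x) - p.[x%:C]) <= e) ->
  normc (f s - interp_on xi a b f s) <= (1 + Lam) * e.
Proof.
move=> sab sp fp.
have := interp_error (f := fun x => f ((a + b) / 2 + (b - a) / 2 * x)) (to_unit sab) sp fp.
have -> // : (a + b) / 2 + (b - a) / 2 * ((s - (a + b) / 2) / ((b - a) / 2)) = s.
by field; rewrite subr_eq0 gt_eqF.
Qed.

End UnivariateInterpolation.

(** * Growth of polynomials away from the interval *)

Section PolynomialGrowth.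
Context {R : realType}.
Implicit Types (M N rho delta : R) (z w : R[i]).

(** The mean over the unit circle, in the variable e^w, isolates the coefficient; the factor 2 is
    that of [lint_bound]. *)
Lemma poly_coef_bound (Q : {poly R[i]}) N n :
  (forall t, normc Q.[cexp (0 +i* t)] <= N) -> normc Q`_n <= 2 * N.
Proof.
move=> QN.
have N0 : 0 <= N by apply: le_trans (QN 0); exact: normc_ge0.
have [nQ|Qn] := ltnP n (size Q); last first.
  by rewrite nth_default// normc0 mulr_ge0.
pose F (w : R[i]^o) : R[i]^o := Q.[cexp w] * cexp (- w) ^+ n.
pose e (j : nat) (w : R[i]^o) : R[i]^o := cexp w ^+ j * cexp (- w) ^+ n.
have de j : vdiff (e j) 0.
  move=> y; apply: differentiable_mul; apply: differentiable_exp.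
    exact: differentiable_cexp.
  exact: differentiable_cexpN.
have E j : vint (e j) 0 = if j == n then (2 * pi)%:C else 0.
  case: (ltngtP j n) => [jn|nj|->].
  - rewrite -(vint_cexpN_expr 0 (_ : 0 < n - j)%N) ?subn_gt0//; congr vint.
    apply: funext => w; rewrite /e -{1}(subnKC (ltnW jn)) exprD mulrA -exprMn.
    by rewrite cexpN divff ?cexp_neq0// expr1n mul1r.
  - rewrite -(vint_cexp_expr 0 (_ : 0 < j - n)%N) ?subn_gt0//; congr vint.
    apply: funext => w; rewrite /e -{1}(subnK (ltnW nj)) exprD -mulrA -exprMn.
    by rewrite cexpN divff ?cexp_neq0// expr1n mulr1.
  - rewrite -(vint_one 0); congr vint; apply: funext => w.
    by rewrite /e -exprMn cexpN divff ?cexp_neq0// expr1n.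
have FE : vint F 0 = (2 * pi)%:C * Q`_n.
  have -> : F = (fun w => \sum_(j < size Q) Q`_j * e j w).
    by apply: funext => w; rewrite /F horner_coef mulr_suml; apply: eq_bigr => j _; rewrite mulrA.
  rewrite vint_sum => [|j y]; last by apply: differentiable_scale; exact: de.
  rewrite (bigD1 (Ordinal nQ))//= vintZ// E eqxx big1 ?addr0 1?mulrC// => j jn.
  rewrite vintZ// E; case: eqP => [jn'|]; last by rewrite mulr0.
  by move: jn; rewrite -(inj_eq val_inj)/= jn' eqxx.
have p0 : 0 < pi :> R by exact: pi_gt0.
have : normc (vint F 0) <= 4 * pi * N.
  apply: vint_bound => [y|y].
    apply: differentiable_mul; last first.
      exact/differentiable_exp/differentiable_cexpN.
    have -> : (fun w : R[i]^o => Q.[cexp w] : R[i]^o) =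
      (fun w : R[i]^o => Q.[w] : R[i]^o) \o (cexp : R[i]^o -> R[i]^o) by [].
    by apply: differentiable_comp; [exact: differentiable_cexp|exact: differentiable_polyC].
  rewrite normcM normcX; have -> : normc (cexp (- (0 +i* y))) = 1.
    by rewrite normc_cexp /= oppr0 expR0.
  by rewrite expr1n mulr1; exact: QN.
rewrite FE normcM normc_real gtr0_norm ?mulr_gt0//.
have -> : 4 * pi * N = 2 * pi * (2 * N) by move: (pi : R) => P; ring.
by rewrite ler_pM2l// mulr_gt0.
Qed.

(* [u ^+ m * p.[(u + u^-1) / 2]] is a polynomial in [u] of degree at most [2 m],
   whose coefficients are bounded by means over the unit circle. *)
Lemma poly_growth (p : {poly R[i]}) m N rho z : 1 < rho -> (size p <= m.+1)%N ->
  (forall x : R, -1 <= x <= 1 -> normc p.[x%:C] <= N) -> bernstein_disc rho z ->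
  normc p.[z] <= (2 * m).+1%:R * (2 * N) * rho ^+ m.
Proof.
move=> rho1 sp pN /(bernstein_disc_joukowski rho1)[u [u1 ur <-]].
have N0 : 0 <= N by apply: le_trans (pN 0 _); rewrite ?normc_ge0// ?ler01 ?oppr_le0 ?ler01.
pose J : {poly R[i]} := 2^-1 *: ('X^2 + 1).
pose Q := \sum_(k < m.+1) p`_k *: (J ^+ k * 'X^(m - k)).
have QE v : v != 0 -> Q.[v] = v ^+ m * p.[joukowski v].
  move=> v0; rewrite (horner_coef_wide _ sp) mulr_sumr horner_sum.
  apply: eq_bigr => k _; rewrite hornerZ hornerM horner_exp hornerXn.
  have -> : J.[v] = v * joukowski v.
    by rewrite hornerZ hornerD hornerXn hornerC /joukowski; field.
  have km : (k <= m)%N by rewrite -ltnS.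
  have -> : v ^+ m = v ^+ k * v ^+ (m - k) by rewrite -exprD subnKC.
  rewrite exprMn; ring.
have sQ : (size Q <= (2 * m).+1)%N.
  apply: (leq_trans (size_sum _ _ _)); apply/bigmax_leqP => k _.
  have km : (k <= m)%N by rewrite -ltnS.
  apply: (leq_trans (size_scale_leq _ _)); apply: (leq_trans (size_polyMleq _ _)).
  have sJ : (size J <= 3)%N.
    apply: (leq_trans (size_scale_leq _ _)); apply: (leq_trans (size_polyD _ _)).
    by rewrite size_polyXn size_poly1.
  have sJk : (size (J ^+ k)%R <= (2 * k).+1)%N.
    apply: (leq_trans (size_poly_exp_leq _ _)); rewrite ltnS leq_mul2r.
    by rewrite -subn1 leq_subLR sJ orbT.
  rewrite size_polyXn addnS /=; apply: (leq_trans (leq_add sJk (leqnn _))).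
  by rewrite addSn ltnS mul2n -addnn -addnA subnKC// mul2n -addnn leq_add2r.
have QN n : normc Q`_n <= 2 * N.
  apply: poly_coef_bound => t; rewrite QE ?cexp_neq0// normcM normcX normc_cexp /=.
  rewrite expR0 expr1n mul1r joukowski_cos pN//.
  by rewrite cos_geN1 cos_le1.
have u0 : u != 0 by rewrite -normc_gt0 (lt_le_trans _ u1).
have n0 : 0 < normc u by rewrite normc_gt0.
have : normc Q.[u] <= (2 * m).+1%:R * (2 * N) * (normc u ^+ m * normc u ^+ m).
  rewrite (horner_coef_wide _ sQ); apply: (le_trans (normc_sum _ _ _)).
  apply: (@le_trans _ _ (\sum_(i < (2 * m).+1) 2 * N * (normc u ^+ m * normc u ^+ m))).
    apply: ler_sum => i _; rewrite normcM normcX.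
    apply: ler_pM; rewrite ?normc_ge0 ?exprn_ge0 ?normc_ge0//.
    rewrite -exprD addnn -mul2n ler_weXn2l//.
    by rewrite -ltnS.
  by rewrite sumr_const card_ord -[leLHS]mulr_natl !mulrA.
rewrite QE// normcM normcX mulrCA ler_pM2l ?exprn_gt0// => /le_trans; apply.
rewrite ler_wpM2l//; last by apply: lerXn2r; rewrite ?nnegrE ?ltW// (lt_trans _ rho1).
by rewrite mulr_ge0// mulr_ge0.
Qed.

End PolynomialGrowth.

(** * Cauchy estimates for mixed second differences *)

Section CauchyLipschitz.
Context {R : realType}.
Implicit Types (M r delta : R) (z w : R[i]).

Definition near_unit delta z := exists2 t, 0 <= t <= 1 & normc (z - t%:C) < delta.

Lemma near_unit_real delta t : 0 < delta -> 0 <= t <= 1 -> near_unit delta t%:C.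
Proof. by move=> d0 t01; exists t => //; rewrite subrr normc0. Qed.

(* This is [bernstein_approx] with [m = 0]: on the segment [0, 1], [f] is close to
   a constant. *)
Lemma lipschitz_near_unit (f : R[i]^o -> R[i]^o) delta M : 0 < delta ->
  (forall z, near_unit delta z -> differentiable f (z : R[i]^o)) ->
  (forall z, near_unit delta z -> normc (f z) <= M) ->
  normc (f 1 - f 0) <= 16 * M / delta.
Proof.
move=> d0 df fM; pose F (w : R[i]^o) : R[i]^o := f ((1 + w) / 2).
(* The disc of parameter 1 + 2 delta stays within 2 delta of [-1, 1], which the map (1 + w) / 2
   turns into delta about [0, 1]. Approximation with r = 1 + delta then gives 1 / (r - 1) = 1 /
   delta. *)
have nearF w : bernstein_disc (1 + 2 * delta) w -> near_unit delta ((1 + w) / 2).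
  move=> /bernstein_disc_near[|t /andP[t1 t2] wt]; first by rewrite ltrDl mulr_gt0.
  exists ((1 + t) / 2); first by apply/andP; split; lra.
  have -> : (1 + w) / 2 - ((1 + t) / 2)%:C = (w - t%:C) / 2.
    by rewrite rmorphM fmorphV rmorphD rmorph1 rmorph_nat; field.
  rewrite normcM normcV normc_natr ltr_pdivrMr//.
  by move: wt; rewrite addrAC subrr add0r mulrC.
have dF w : bernstein_disc (1 + 2 * delta) w -> differentiable F (w : R[i]^o).
  move=> /nearF/df; have -> : F = f \o (fun w : R[i]^o => (1 + w) / 2 : R[i]^o) by [].
  move=> dfw; apply: differentiable_comp; last exact: dfw.
  apply: differentiable_mul; last exact: differentiable_const.
  by apply: differentiable_add; [exact: differentiable_const|exact: differentiable_ident].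
have FM w : bernstein_disc (1 + 2 * delta) w -> normc (F w) <= M.
  by move=> /nearF/fM.
have r1 : 1 < 1 + delta by rewrite ltrDl.
have rr : 1 + delta < 1 + 2 * delta by rewrite ltrD2l ltr_pMl// ltr1n.
have [p [sp H]] := bernstein_approx r1 rr dF FM 0.
have pc z w : p.[z] = p.[w] by rewrite (size1_polyC sp) !hornerC.
have -> : f 1 = F 1%:C by rewrite /F rmorph1 divff// pnatr_eq0.
have -> : f 0 = F (-1)%:C by rewrite /F rmorphN1 subrr mul0r.
have -> : F 1%:C - F (-1)%:C = F 1%:C - p.[1%:C] - (F (-1)%:C - p.[(-1)%:C]).
  by rewrite (pc (-1)%:C 1%:C) opprB addrA subrK.
apply: (le_trans (le_normcB _ _)).
have h1 := H 1; rewrite lexx ge0_cp// in h1.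
have h2 := H (-1); rewrite lexx ge0_cp// in h2.
apply: (le_trans (lerD (h1 isT) (h2 isT))).
rewrite expr0 invr1 le_eqVlt; apply/orP; left; apply/eqP; field.
by rewrite gt_eqF.
Qed.

(** The one-variable bound is applied to F s 1 - F s 0 as a function of s, itself bounded by the
    same estimate in t; hence 256, the square of 16. *)
Lemma mixed_difference_near_unit (F : R[i] -> R[i] -> R[i]) r1 r2 M :
  0 < r1 -> 0 < r2 ->
  (forall s t, near_unit r1 s -> near_unit r2 t ->
    differentiable (fun s : R[i]^o => F s t : R[i]^o) (s : R[i]^o)) ->
  (forall s t, near_unit r1 s -> near_unit r2 t ->
    differentiable (F s : R[i]^o -> R[i]^o) (t : R[i]^o)) ->
  (forall s t, near_unit r1 s -> near_unit r2 t -> normc (F s t) <= M) ->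
  normc (F 1 1 - F 1 0 - (F 0 1 - F 0 0)) <= 256 * M / (r1 * r2).
Proof.
move=> r10 r20 d1 d2 FM.
have n1 : near_unit r2 1 by rewrite -(rmorph1 (real_complex R)); apply: near_unit_real; rewrite ?lexx ?ler01.
have n0 : near_unit r2 0 by rewrite -(rmorph0 (real_complex R)); apply: near_unit_real; rewrite ?lexx ?ler01.
have -> : 256 * M / (r1 * r2) = 16 * (16 * M / r2) / r1 by field; rewrite !gt_eqF.
apply: (@lipschitz_near_unit (fun s => F s 1 - F s 0)) => // s hs.
  by apply: differentiable_sub; apply: d1.
by apply: (@lipschitz_near_unit (F s)) => // t ht; [apply: d2|apply: FM].
Qed.

End CauchyLipschitz.

Section MixedDifference.
Context {R : realType} {d : nat}.
Local Notation V := ('rV[R[i]^o]_d).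
Implicit Types (M eps : R) (U X Y : V).

Lemma cnormZ (k : R[i]) X : cnorm (k *: X) = normc k * cnorm X.
Proof.
rewrite /cnorm -[X in X * _](ger0_norm (normc_ge0 k)) -sqrtr_sqr.
rewrite -sqrtrM ?sqr_ge0// mulr_sumr; congr Num.sqrt; apply: eq_bigr => i _.
by rewrite mxE normcM exprMn.
Qed.

Lemma cnorm_ge0 X : 0 <= cnorm X.
Proof. exact: sqrtr_ge0. Qed.

Lemma cnorm_eq0 X : cnorm X = 0 -> X = 0.
Proof.
move=> /eqP; rewrite sqrtr_eq0 => H; apply/matrixP => i j; rewrite (ord1 i) mxE.
have s0 : \sum_(i < d) normc (X 0 i) ^+ 2 = 0.
  by apply/eqP; rewrite eq_le H sumr_ge0// => k _; rewrite sqr_ge0.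
have /eqP := s0; rewrite psumr_eq0 => [/allP/(_ j)|k _]; last by rewrite sqr_ge0.
by rewrite mem_index_enum => /(_ isT); rewrite sqrf_eq0 normc_eq0 => /eqP.
Qed.

Lemma differentiable_line (W : normedModType R[i]) (P U : W) (s : R[i]^o) :
  differentiable (fun s : R[i]^o => P + s *: U) s.
Proof.
apply: differentiableD; first exact: differentiable_cst.
by have [] := is_diff_scalel s U.
Qed.

Variables (Omega : set (V * V)) (Phi : V * V -> R[i]^o) (M eps : R).
Hypothesis eps0 : 0 < eps.
Hypothesis dPhi : holomorphic_on Omega Phi.
Hypothesis PhiM : forall z, Omega z -> normc (Phi z) <= M.

(** Both segments are parametrised by [0, 1]. In the parameters the balls of radius eps become
    neighbourhoods of radii eps / |X1 - X0| and eps / |Y1 - Y0|, which produce the two factors.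
    Vanishing displacements are treated apart, as these quotients are then meaningless. *)
Lemma mixed_difference X0 X1 Y0 Y1 :
  (forall s t, 0 <= s <= 1 -> 0 <= t <= 1 ->
    cball (X0 + s%:C *: (X1 - X0)) eps `*` cball (Y0 + t%:C *: (Y1 - Y0)) eps `<=` Omega) ->
  normc (Phi (X1, Y1) - Phi (X1, Y0) - (Phi (X0, Y1) - Phi (X0, Y0))) <=
    256 * M * (cnorm (X1 - X0) * cnorm (Y1 - Y0)) / eps ^+ 2.
Proof.
move=> sub.
have c00 (X : V) : X - X = 0 by rewrite subrr.
have cn0 : cnorm (0 : V) = 0.
  by rewrite -(scale0r (0 : V)) cnormZ normc0 mul0r.
have [/cnorm_eq0/eqP|nX] := eqVneq (cnorm (X1 - X0)) 0.
  rewrite subr_eq0 => /eqP ->; rewrite !subrr normc0 cn0 mul0r mulr0 mul0r.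
  by [].
have [/cnorm_eq0/eqP|nY] := eqVneq (cnorm (Y1 - Y0)) 0.
  rewrite subr_eq0 => /eqP ->; rewrite !subrr normc0 cn0 mulr0 mulr0 mul0r.
  by [].
have X0' : 0 < cnorm (X1 - X0) by rewrite lt_def nX cnorm_ge0.
have Y0' : 0 < cnorm (Y1 - Y0) by rewrite lt_def nY cnorm_ge0.
pose F (s t : R[i]) : R[i] := Phi (X0 + s *: (X1 - X0), Y0 + t *: (Y1 - Y0)).
pose r1 := eps / cnorm (X1 - X0); pose r2 := eps / cnorm (Y1 - Y0).
have inO s t : near_unit r1 s -> near_unit r2 t ->
    Omega (X0 + s *: (X1 - X0), Y0 + t *: (Y1 - Y0)).
  move=> [s0 s01 hs] [t0 t01 ht]; apply: (sub _ _ s01 t01); split; rewrite /cball/=.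
    rewrite opprD addrACA subrr add0r -scalerBl cnormZ -ltr_pdivlMr//.
  by rewrite opprD addrACA subrr add0r -scalerBl cnormZ -ltr_pdivlMr.
have -> : Phi (X1, Y1) - Phi (X1, Y0) - (Phi (X0, Y1) - Phi (X0, Y0)) =
    F 1 1 - F 1 0 - (F 0 1 - F 0 0).
  by rewrite /F !scale1r !scale0r !addr0 ![_ + (_ - _)]addrC !subrK.
have -> : 256 * M * (cnorm (X1 - X0) * cnorm (Y1 - Y0)) / eps ^+ 2 =
    256 * M / (r1 * r2).
  by rewrite /r1 /r2; field; rewrite nX nY gt_eqF.
apply: mixed_difference_near_unit; rewrite ?divr_gt0//.
- move=> s t hs ht.
  have -> : (fun s : R[i]^o => F s t : R[i]^o) = Phi \o
    (fun s : R[i]^o => (X0 + s *: (X1 - X0), Y0 + t *: (Y1 - Y0))) by [].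
  apply: differentiable_comp; last by apply: dPhi; exact: inO.
  by apply: differentiable_pair; [exact: differentiable_line|exact: differentiable_cst].
- move=> s t hs ht.
  have -> : (F s : R[i]^o -> R[i]^o) = Phi \o
    (fun t : R[i]^o => (X0 + s *: (X1 - X0), Y0 + t *: (Y1 - Y0))) by [].
  apply: differentiable_comp; last by apply: dPhi; exact: inO.
  by apply: differentiable_pair; [exact: differentiable_cst|exact: differentiable_line].
- by move=> s t hs ht; apply/PhiM/inO.
Qed.

End MixedDifference.

(** * Tensor product interpolation *)

Section TensorInterpolation.
Context {R : realType} {d m : nat}.
Variable xi : 'I_m.+1 -> R.
Hypothesis xi_inj : injective xi.
Hypothesis xi_in : forall j, -1 <= xi j <= 1.
Variable Lam : R.
Hypothesis Lam1 : 1 <= Lam.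
Hypothesis LamP : forall t, -1 <= t <= 1 ->
  \sum_j `|(lagrange_poly xi j).[t]| <= Lam.
Implicit Types (a b u : 'rV[R]_d) (f g : 'rV[R]_d -> R[i]^o) (i : 'I_d).

Let Lam0 : 0 <= Lam. Proof. exact: le_trans Lam1. Qed.

Lemma set_coord_self u i : set_coord u i (u 0 i) = u.
Proof. by apply/rowP => j; rewrite mxE; case: eqP => // ->. Qed.

Lemma set_coord_twice u i s t : set_coord (set_coord u i s) i t = set_coord u i t.
Proof. by apply/rowP => j; rewrite !mxE; case: eqP. Qed.

Lemma set_coord_swap u i k s t : i != k ->
  set_coord (set_coord u k s) i t = set_coord (set_coord u i t) k s.
Proof.
move=> ik; apply/rowP => j; rewrite !mxE; case: eqP => [->|//].
by rewrite (negbTE ik).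
Qed.

Lemma set_coord_eq u i s : set_coord u i s 0 i = s.
Proof. by rewrite mxE eqxx. Qed.

Lemma set_coord_neq u i k s : k != i -> set_coord u i s 0 k = u 0 k.
Proof. by move=> ki; rewrite mxE (negbTE ki). Qed.

Lemma box_set_coord a b u i s : box a b u -> a 0 i <= s <= b 0 i ->
  box a b (set_coord u i s).
Proof. by move=> bu hs j; rewrite mxE; case: eqP => [->//|_]; exact: bu. Qed.

Section Box.
Variables a b : 'rV[R]_d.
Hypothesis ab : forall i, a 0 i < b 0 i.

Let interp_seq (s : seq 'I_d) f := foldr (fun i g => interp_coord xi a b i g) f s.

Lemma interp_coord_bound f N i u : box a b u ->
  (forall v, box a b v -> normc (f v) <= N) ->
  normc (interp_coord xi a b i f u) <= Lam * N.
Proof.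
move=> bu fN; rewrite /interp_coord.
apply: (interp_on_bound xi_in LamP (ab i)) => [|s hs]; first exact: bu.
by apply: fN; exact: box_set_coord.
Qed.

Lemma interp_seq_bound s f N u : box a b u ->
  (forall v, box a b v -> normc (f v) <= N) ->
  normc (interp_seq s f u) <= Lam ^+ size s * N.
Proof.
move=> bu fN; elim: s u bu => [|i s IH] u bu /=; first by rewrite expr0 mul1r fN.
by rewrite exprS -mulrA; apply: interp_coord_bound.
Qed.

Lemma interp_coordB f g i u :
  interp_coord xi a b i f u - interp_coord xi a b i g u =
  interp_coord xi a b i (fun v => f v - g v) u.
Proof.
rewrite /interp_coord /interp_on /interp -sumrB; apply: eq_bigr => j _.
by rewrite scalerBr.
Qed.

(** From f - I_i I_s f = (f - I_i f) + I_i (f - I_s f): each coordinate adds one error e, amplified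
    by at most one Lebesgue factor per operator. *)
Lemma interp_seq_error s f e u : 0 <= e -> box a b u ->
  (forall i v, box a b v -> normc (f v - interp_coord xi a b i f v) <= e) ->
  normc (f u - interp_seq s f u) <= (size s)%:R * Lam ^+ size s * e.
Proof.
move=> e0 bu fe; elim: s u bu => [|i s IH] u bu /=.
  by rewrite subrr normc0 !mul0r.
have -> : f u - interp_coord xi a b i (interp_seq s f) u =
    (f u - interp_coord xi a b i f u) +
    interp_coord xi a b i (fun v => f v - interp_seq s f v) u.
  by rewrite -interp_coordB addrA subrK.
apply: (le_trans (le_normcD _ _)); apply: (le_trans (lerD (fe _ _ bu) _)).
  exact: (interp_coord_bound _ bu IH).
rewrite -natr1 mulrDl mulrDl mul1r addrC.
apply: lerD; last by rewrite ler_peMl// exprn_ege1.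
by rewrite le_eqVlt; apply/orP; left; apply/eqP; rewrite exprS; ring.
Qed.

Lemma interp_box_bound f N u : box a b u ->
  (forall v, box a b v -> normc (f v) <= N) ->
  normc (interp_box xi a b f u) <= Lam ^+ d * N.
Proof.
by move=> bu fN; rewrite -{2}(size_enum_ord d); exact: interp_seq_bound.
Qed.

Definition sep_poly g := forall u i, exists p : {poly R[i]},
  (size p <= m.+1)%N /\ forall s, g (set_coord u i s) = p.[s%:C].

(** Interpolation in coordinate i yields a polynomial on the whole coordinate line; interpolation in
    any other coordinate only forms linear combinations of such functions. *)
Lemma interp_seq_poly s f u i : i \in s -> exists p : {poly R[i]},
  (size p <= m.+1)%N /\ forall t, interp_seq s f (set_coord u i t) = p.[t%:C].
Proof.
elim: s u => [//|k s IH] u; rewrite inE.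
have [<- _|ik /= is_] := eqVneq i k.
  set g := interp_seq s f.
  pose y j := (a 0 i + b 0 i) / 2 + (b 0 i - a 0 i) / 2 * xi j.
  pose A : {poly R} := ((b 0 i - a 0 i) / 2)^-1 *: ('X - ((a 0 i + b 0 i) / 2)%:P).
  exists (\sum_j g (set_coord u i (y j)) *: map_poly (real_complex R) (lagrange_poly xi j \Po A)).
  split.
    apply: (leq_trans (size_sum _ _ _)); apply/bigmax_leqP => j _.
    apply: (leq_trans (size_scale_leq _ _)); apply: (leq_trans (size_poly _ _)).
    apply: (leq_trans (size_comp_poly_leq _ _)); rewrite ltnS.
    have sA : (size A <= 2)%N.
      by apply: (leq_trans (size_scale_leq _ _)); rewrite size_XsubC.
    have sl := size_lagrange xi j.
    apply: (@leq_trans ((size (lagrange_poly xi j)).-1 * 1)%N).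
      by rewrite leq_mul2l; apply/orP; right; case: (size A) sA => [|[|[]]].
    by rewrite muln1; case: (size _) sl.
  move=> t; rewrite /= -/g /interp_coord set_coord_eq /interp_on /interp.
  have AE : A.[t] = (t - (a 0 i + b 0 i) / 2) / ((b 0 i - a 0 i) / 2).
    by rewrite hornerZ hornerD hornerN hornerX hornerC mulrC.
  rewrite horner_sum; apply: eq_bigr => j _.
  by rewrite set_coord_twice hornerZ horner_map horner_comp AE [RHS]mulrC.
pose y j := (a 0 k + b 0 k) / 2 + (b 0 k - a 0 k) / 2 * xi j.
pose t0 := (u 0 k - (a 0 k + b 0 k) / 2) / ((b 0 k - a 0 k) / 2).
have H j := IH (set_coord u k (y j)) is_.
have [P PP] := choice H.
exists (\sum_j ((lagrange_poly xi j).[t0])%:C *: P j); split.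
  apply: (leq_trans (size_sum _ _ _)); apply/bigmax_leqP => j _.
  apply: (leq_trans (size_scale_leq _ _)); exact: (PP j).1.
move=> t; rewrite /interp_coord set_coord_neq 1?eq_sym// /interp_on /interp.
rewrite horner_sum; apply: eq_bigr => j _.
by rewrite hornerZ -(PP j).2 set_coord_swap 1?eq_sym.
Qed.

Lemma interp_box_poly f : sep_poly (interp_box xi a b f).
Proof. by move=> u i; apply: interp_seq_poly; rewrite mem_enum. Qed.

(** Extension in one variable only: tensor interpolation is estimated one coordinate at a time, the
    others being frozen at real values. *)
Definition hol_ext (rho x y K : R) (f : R -> R[i]^o) := exists F : R[i]^o -> R[i]^o,
  [/\ forall z, bernstein_disc_on rho x y z -> differentiable F (z : R[i]^o),
      forall z, bernstein_disc_on rho x y z -> normc (F z) <= K &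
      forall s, x <= s <= y -> F s%:C = f s].

Lemma interp_on_hol_ext rho r x y K (f : R -> R[i]^o) s : 1 < r -> r < rho -> x < y ->
  hol_ext rho x y K f -> x <= s <= y ->
  normc (f s - interp_on xi x y f s) <= (1 + Lam) * (8 * K * (r ^- m / (r - 1))).
Proof.
move=> r1 rr xy [F [dF FK Ff]] hs.
have h0 : 0 < (y - x) / 2 by rewrite divr_gt0// subr_gt0.
pose c := ((x + y) / 2)%:C : R[i]; pose h := ((y - x) / 2)%:C : R[i].
pose G (w : R[i]^o) : R[i]^o := F (c + h * w).
have inE w : bernstein_disc rho w -> bernstein_disc_on rho x y (c + h * w).
  by move=> wd; exists w.
have dG w : bernstein_disc rho w -> differentiable G (w : R[i]^o).
  move=> /inE/dF; have -> : G = F \o (fun w : R[i]^o => c + h * w : R[i]^o) by [].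
  move=> dw; apply: differentiable_comp; last exact: dw.
  apply: differentiable_add; first exact: differentiable_const.
  by apply: differentiable_scale; exact: differentiable_ident.
have GK w : bernstein_disc rho w -> normc (G w) <= K by move=> /inE/FK.
have [p [sp H]] := bernstein_approx r1 rr dG GK m.
apply: (interp_on_error xi_inj xi_in LamP xy hs sp) => t ht.
have := H t ht; rewrite /G /c /h -rmorphM -rmorphD Ff//.
by case/andP: ht => t1 t2; apply/andP; have := ler_wpM2l (ltW h0) t1;
  have := ler_wpM2l (ltW h0) t2; split; lra.
Qed.

Lemma interp_box_error rho r K f u : 1 < r -> r < rho -> 0 <= K ->
  (forall v i, box a b v -> hol_ext rho (a 0 i) (b 0 i) K (fun s => f (set_coord v i s))) ->
  box a b u ->
  normc (f u - interp_box xi a b f u) <=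
    d%:R * Lam ^+ d * ((1 + Lam) * (8 * K * (r ^- m / (r - 1)))).
Proof.
move=> r1 rr K0 fh bu; rewrite -{2 3}(size_enum_ord d).
apply: interp_seq_error => //.
  rewrite !mulr_ge0 ?addr_ge0 ?invr_ge0 ?exprn_ge0 ?subr_ge0//; first exact: ltW (lt_trans _ r1).
  exact: ltW.
move=> i v bv; rewrite -{1}(set_coord_self v i).
exact: (interp_on_hol_ext r1 rr (ab i) (fh v i bv) (bv i)).
Qed.

End Box.
End TensorInterpolation.

(** * Nested phase interpolation *)

Section Chain.
Context {R : realType} {d m : nat}.
Variable xi : 'I_m.+1 -> R.
Hypothesis xi_inj : injective xi.
Hypothesis xi_in : forall j, -1 <= xi j <= 1.
Variable Lam : R.
Hypothesis Lam1 : 1 <= Lam.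
Hypothesis LamP : forall t, -1 <= t <= 1 ->
  \sum_j `|(lagrange_poly xi j).[t]| <= Lam.
Variables (kappa : R) (L : nat) (phi : nat -> 'rV[R]_d -> R[i]).
Variables (a b : nat -> 'rV[R]_d) (q rho r sigma K : R).
Implicit Types (u v : 'rV[R]_d) (f : 'rV[R]_d -> R[i]^o) (i : 'I_d) (n : nat).
Hypothesis ab : forall n i, (n <= L)%N -> a n 0 i < b n 0 i.
Hypothesis nested : forall n i, (n < L)%N ->
  a n 0 i <= a n.+1 0 i /\ b n.+1 0 i <= b n 0 i.
Hypothesis shrink : forall n i, (n < L)%N ->
  b n.+1 0 i - a n.+1 0 i <= q * (b n 0 i - a n 0 i).
Hypothesis phi_real : forall n u, (n <= L)%N -> box (a 0%N) (b 0%N) u ->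
  complex.Im (phi n u) = 0.
Hypothesis phi_ext : forall n u i, (n < L)%N -> box (a n.+1) (b n.+1) u ->
  hol_ext rho (a n.+1 0 i) (b n.+1 0 i) K (fun s =>
    cexp ((0 +i* kappa) * (phi n (set_coord u i s) - phi n.+1 (set_coord u i s)))).
Hypotheses (K0 : 0 <= K) (sigma1 : 1 < sigma) (sigmar : sigma < r) (rrho : r < rho).
Hypothesis qsigma : q * (rho + rho^-1 - 2) <= sigma + sigma^-1 - 2.

Let Lam0 : 0 <= Lam. Proof. exact: le_trans Lam1. Qed.
Let r1 : 1 < r. Proof. exact: lt_trans sigmar. Qed.
Let rho1 : 1 < rho. Proof. exact: lt_trans rrho. Qed.
Let B n := box (a n) (b n).
Let chain n f := phase_interp_chain xi kappa phi a b n f.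
Let E n u : R[i] := cexp ((0 +i* kappa) * phi n u).

Lemma box_nested n u : (n < L)%N -> B n.+1 u -> B n u.
Proof.
move=> nL bu i; have [h1 h2] := nested i nL; have /andP[h3 h4] := bu i.
by rewrite (le_trans h1 h3) (le_trans h4 h2).
Qed.

Lemma box_nested0 n u : (n <= L)%N -> B n u -> B 0%N u.
Proof.
elim: n => [//|n IH] nL bu; apply: IH (ltnW nL) _; exact: box_nested.
Qed.

Lemma phase_unimodular n u : (n <= L)%N -> B 0%N u -> normc (E n u) = 1.
Proof.
move=> nL bu; rewrite /E normc_cexp; have := phi_real nL bu.
by case: (phi n u) => x y /= ->; rewrite mul0r mulr0 subrr expR0.
Qed.

Definition chain_poly n f : 'rV[R]_d -> R[i]^o :=
  interp_box xi (a n) (b n) (fun v => cexp (- ((0 +i* kappa) * phi n v)) *: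
    (if n is n'.+1 then chain n' f else f) v).

Lemma chainE n f u : chain n f u = E n u * chain_poly n f u.
Proof. by case: n. Qed.

Definition base_error K' := d%:R * Lam ^+ d * ((1 + Lam) * (8 * K' * (r ^- m / (r - 1)))).

(** The factor beside [K] is the bound of [poly_growth] on the disc of parameter [sigma] for the
    polynomial left by the previous level. *)
Definition step_error := base_error (K * ((2 * m).+1%:R * 2 * sigma ^+ m)).

Lemma base_error_ge0 K' : 0 <= K' -> 0 <= base_error K'.
Proof.
move=> h; rewrite !mulr_ge0 ?addr_ge0 ?exprn_ge0// ?invr_ge0 ?exprn_ge0 ?subr_ge0 ?ltW//.
exact: lt_trans r1.
Qed.

Lemma step_error_ge0 : 0 <= step_error.
Proof.
apply: base_error_ge0; rewrite !mulr_ge0// exprn_ge0// ltW//.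
exact: lt_trans sigma1.
Qed.

(** The previous output enters only through its bound on box n, which its polynomial factor shares
    because the phase is unimodular. *)
Lemma chain_step n f N : (n < L)%N -> 0 <= N ->
  (forall u, B n u -> normc (chain n f u) <= N) ->
  forall u, B n.+1 u -> normc (chain n f u - chain n.+1 f u) <= step_error * N.
Proof.
move=> nL N0 fN u bu.
have nL' := ltnW nL.
have polyN v : B n v -> normc (chain_poly n f v) <= N.
  move=> bv; have := fN v bv; rewrite chainE normcM phase_unimodular ?mul1r//.
  exact: box_nested0 bv.
pose D v := cexp ((0 +i* kappa) * (phi n v - phi n.+1 v)).
pose g v : R[i]^o := D v * chain_poly n f v.
have EN v : cexp (- ((0 +i* kappa) * phi n.+1 v)) * chain n f v = g v.
  by rewrite chainE /g /D /E mulrA -cexpD mulrBr addrC.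
have -> : chain n f u - chain n.+1 f u =
    E n.+1 u * (g u - interp_box xi (a n.+1) (b n.+1) g u).
  rewrite mulrBr; congr (_ - _).
    by rewrite -EN mulrA -cexpD subrr cexp0 mul1r.
  rewrite chainE; congr (_ * _); rewrite /chain_poly; congr (interp_box _ _ _ _ _).
  by apply: funext => v; rewrite -EN.
rewrite normcM phase_unimodular ?mul1r//; last exact: box_nested0 bu.
pose K' := K * ((2 * m).+1%:R * 2 * sigma ^+ m) * N.
have -> : step_error * N = base_error K' by rewrite /step_error /base_error /K'; ring.
have s0 : 0 <= sigma by rewrite ltW// (lt_trans _ sigma1).
have K'0 : 0 <= K' by rewrite !mulr_ge0// exprn_ge0.
apply: (interp_box_error xi_inj xi_in Lam1 LamP _ r1 rrho K'0) => // [i|v i bv].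
  exact: ab.
have [F [dF FK Ff]] := phi_ext i nL bv.
have [p [sp Hp]] := interp_box_poly xi (a n) (b n) (fun v =>
  cexp (- ((0 +i* kappa) * phi n v)) *: (if n is n'.+1 then chain n' f else f) v) v i.
rewrite -/(chain_poly n f) in Hp.
have [h1 h2] := nested i nL; have h3 := ab i nL; have h4 := ab i nL'.
exists (fun z => F z * p.[z]); split=> [z hz|z hz|s hs].
- by apply: differentiable_mul; [exact: dF|exact: differentiable_polyC].
- rewrite normcM /K' -mulrA; apply: ler_pM; rewrite ?normc_ge0 ?FK//.
  (* From the disc rho of the finer box into the disc sigma of the coarser one; [P] below is [p]
     transported to [-1, 1], as [poly_growth] requires. *)
  have := bernstein_disc_on_subset rho1 sigma1 h1 h3 h2 (shrink i nL) qsigma hz.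
  move=> [w wd <-].
  pose c := ((a n 0 i + b n 0 i) / 2)%:C : R[i]; pose h := ((b n 0 i - a n 0 i) / 2)%:C : R[i].
  pose P := p \Po (h *: 'X + c%:P).
  have PE x : P.[x] = p.[c + h * x].
    by rewrite horner_comp hornerD hornerZ hornerX hornerC addrC.
  rewrite -/c -/h -PE.
  have -> : (2 * m).+1%:R * 2 * sigma ^+ m * N = (2 * m).+1%:R * (2 * N) * sigma ^+ m by ring.
  apply: poly_growth => //.
    apply: leq_trans (size_comp_poly_leq _ _) _; rewrite ltnS.
    have sh : (size (h *: 'X + c%:P)%R <= 2)%N.
      apply: (leq_trans (size_polyD _ _)); rewrite geq_max.
      rewrite (leq_trans (size_scale_leq _ _)) ?size_polyX//.
      by rewrite (leq_trans (size_polyC_leq1 _)).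
    apply: (@leq_trans ((size p).-1 * 1)%N).
      by rewrite leq_mul2l; apply/orP; right; case: (size _) sh => [|[|[]]].
    by rewrite muln1; case: (size _) sp.
  move=> x /andP[x1 x2]; rewrite PE /c /h -rmorphM -rmorphD -Hp.
  apply/polyN/box_set_coord; first exact: box_nested.
  have h0 : 0 <= (b n 0 i - a n 0 i) / 2 by rewrite divr_ge0// subr_ge0 ltW.
  have := ler_wpM2l h0 x1; have := ler_wpM2l h0 x2.
  by move=> ? ?; apply/andP; split; lra.
- by rewrite Ff// /g -Hp.
Qed.

(** Only the first operator is bounded by its norm. Every later one is close to the identity on the
    output it receives and costs a factor 1 + [step_error]. *)
Lemma chain_bound n f N : (n <= L)%N -> 0 <= N ->
  (forall u, B 0%N u -> normc (f u) <= N) ->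
  forall u, B n u -> normc (chain n f u) <= (1 + step_error) ^+ n * (Lam ^+ d * N).
Proof.
move=> + N0 fN; have e0 := step_error_ge0.
elim: n => [_|n IH nL] u bu.
  rewrite expr0 mul1r chainE normcM phase_unimodular// mul1r.
  apply: (interp_box_bound xi_in LamP _ bu) => [i|v bv]; first exact: ab.
  by rewrite normcM cexpN normcV phase_unimodular// invr1 mul1r fN.
have N1 : 0 <= (1 + step_error) ^+ n * (Lam ^+ d * N).
  by rewrite !mulr_ge0 ?exprn_ge0// addr_ge0.
have IH' := IH (ltnW nL).
have S := chain_step nL N1 IH' bu.
rewrite -[chain n.+1 f u](subKr (chain n f u)).
apply: (le_trans (le_normcB _ _)).
apply: (le_trans (lerD (IH' _ (box_nested nL bu)) S)).
by rewrite le_eqVlt; apply/orP; left; apply/eqP; rewrite exprS; ring.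
Qed.

(** Telescoping over the levels. The extension is asked of f freed from the phase of level 0, which
    is what the first operator interpolates. *)
Lemma chain_error n f N K' : (n <= L)%N -> 0 <= N -> 0 <= K' ->
  (forall u, B 0%N u -> normc (f u) <= N) ->
  (forall u i, B 0%N u -> hol_ext rho (a 0%N 0 i) (b 0%N 0 i) K' (fun s =>
    cexp (- ((0 +i* kappa) * phi 0%N (set_coord u i s))) * f (set_coord u i s))) ->
  forall u, B n u -> normc (f u - chain n f u) <=
    base_error K' + n%:R * (step_error * ((1 + step_error) ^+ n * (Lam ^+ d * N))).
Proof.
move=> + N0 K'0 fN fh; have e0 := step_error_ge0.
elim: n => [_|n IH nL] u bu.
  rewrite mul0r addr0 chainE.
  pose g v : R[i]^o := cexp (- ((0 +i* kappa) * phi 0%N v)) * f v.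
  have -> : f u - E 0%N u * chain_poly 0 f u =
      E 0%N u * (g u - interp_box xi (a 0%N) (b 0%N) g u).
    by rewrite mulrBr /g mulrA -cexpD subrr cexp0 mul1r.
  rewrite normcM phase_unimodular// mul1r.
  apply: (interp_box_error xi_inj xi_in Lam1 LamP _ r1 rrho K'0) => // i.
  exact: ab.
have N1 : 0 <= (1 + step_error) ^+ n * (Lam ^+ d * N).
  by rewrite !mulr_ge0 ?exprn_ge0// addr_ge0.
have S := chain_step nL N1 (chain_bound (ltnW nL) N0 fN) bu.
have -> : f u - chain n.+1 f u = (f u - chain n f u) + (chain n f u - chain n.+1 f u).
  by rewrite addrA subrK.
apply: (le_trans (le_normcD _ _)).
apply: (le_trans (lerD (IH (ltnW nL) _ (box_nested nL bu)) S)).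
rewrite -addrA lerD2l; set T := step_error * _.
have -> : n%:R * T + T = n.+1%:R * T by rewrite -natr1 mulrDl mul1r.
rewrite ler_wpM2l// ler_wpM2l// ler_wpM2r ?mulr_ge0 ?exprn_ge0//.
by rewrite exprS ler_peMl ?exprn_ge0 ?addr_ge0// lerDl.
Qed.

End Chain.

(** * Diameters, admissible radii and complex coordinate lines *)

Section Diameter.
Context {R : realType} {d : nat}.
Implicit Types (a b u v : 'rV[R]_d).

Lemma rnorm_ge0 u : 0 <= rnorm u.
Proof. exact: sqrtr_ge0. Qed.

Lemma coord_le_rnorm u i : `|u 0 i| <= rnorm u.
Proof.
rewrite /rnorm -sqrtr_sqr ler_wsqrtr// (bigD1 i)//= lerDl.
by rewrite sumr_ge0// => j _; exact: sqr_ge0.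
Qed.

Lemma rnorm_le_diam a b u v : box a b u -> box a b v -> rnorm (u - v) <= diam (box a b).
Proof.
move=> bu bv; apply: ub_le_sup; last by exists (u, v).
exists (rnorm (b - a)) => _ [[s t] /= [bs bt] <-].
rewrite /rnorm ler_wsqrtr// ler_sum// => i _; rewrite !mxE -ler_sqrt ?sqr_ge0//.
have /andP[s1 s2] := bs i; have /andP[t1 t2] := bt i.
rewrite !sqrtr_sqr [X in _ <= X]ger0_norm; last by rewrite subr_ge0 (le_trans s1).
by rewrite ler_norml; apply/andP; split; lra.
Qed.

Lemma side_le_diam a b i : (forall i, a 0 i <= b 0 i) -> b 0 i - a 0 i <= diam (box a b).
Proof.
move=> ab; apply: (@le_trans _ _ (rnorm (b - a))).
  by apply: le_trans (coord_le_rnorm _ i); rewrite !mxE ler_norm.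
by apply: rnorm_le_diam => j; rewrite lexx ab.
Qed.

Lemma cnorm_to_complexB u v : cnorm (to_complex u - to_complex v) = rnorm (u - v).
Proof.
rewrite /cnorm /rnorm; congr Num.sqrt; apply: eq_bigr => i _.
by rewrite !mxE -rmorphB normc_real real_normK ?num_real.
Qed.

Lemma box_convex a b u v t : 0 <= t <= 1 -> box a b u -> box a b v ->
  box a b (u + t *: (v - u)).
Proof.
move=> /andP[t0 t1] bu bv i; have /andP[u1 u2] := bu i; have /andP[v1 v2] := bv i.
rewrite !mxE.
have -> : u 0 i + t * (v 0 i - u 0 i) = (1 - t) * u 0 i + t * v 0 i by ring.
have t1' : 0 <= 1 - t by rewrite subr_ge0.
have := ler_wpM2l t0 v1; have := ler_wpM2l t0 v2.
have := ler_wpM2l t1' u1; have := ler_wpM2l t1' u2.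
by move=> ? ? ? ?; apply/andP; split; lra.
Qed.

Lemma box_bounds a b a' b' : (forall i, a' 0 i < b' 0 i) ->
  box a' b' `<=` box a b -> forall i, a 0 i <= a' 0 i /\ b' 0 i <= b 0 i.
Proof.
move=> ab sub i.
have /sub/(_ i)/andP[-> _] : box a' b' a' by move=> j; rewrite lexx ltW.
by have /sub/(_ i)/andP[_ ->] : box a' b' b' by move=> j; rewrite lexx andbT ltW.
Qed.

End Diameter.

Section DistanceToBoundary.
Context {R : realType}.

(** An element above half the supremum costs the factor 4 = 2^2. If the supremum is +oo, an element
    e above both 1 and T / (4 gamma) serves, since then T / e^2 <= T / e. *)
Lemma near_sup_scale (S : set R) (T gamma : R) : 0 <= T -> 0 < gamma ->
  (forall e, S e -> 0 < e) -> (0 < ereal_sup [set e%:E | e in S])%E ->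
  (T%:E / ereal_sup [set e%:E | e in S] ^+ 2 <= gamma%:E)%E ->
  exists e, [/\ S e, 0 < e & T / e ^+ 2 <= 4 * gamma].
Proof.
move=> T0 g0 S0; set D := ereal_sup _ => D0 H.
have above (x : R) : (x%:E < D)%E -> exists2 e, S e & x < e.
  by move=> /ereal_sup_gt[_ [e Se <-]]; rewrite lte_fin; exists e.
move: H D0 above; case: D => [D|H _|//].
  rewrite lte_fin => H D0 above.
  have [e Se De] := above (D / 2) ltac:(by rewrite lte_fin ltr_pdivrMr// ltr_pMr// ltr1n).
  have e0 := S0 _ Se; exists e; split=> //.
  move: H; rewrite -EFin_expe inver expf_eq0 (gt_eqF D0) /= lee_fin.
  rewrite !ler_pdivrMr ?exprn_gt0// => /le_trans; apply.
  have -> : 4 * gamma * e ^+ 2 = gamma * (2 * e) ^+ 2 by ring.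
  rewrite ler_pM2l//.
  by rewrite lerXn2r ?nnegrE ?mulr_ge0 ?ltW// mulrC -ltr_pdivrMr.
move=> above.
have [e Se Te] := above (Num.max 1 (T / (4 * gamma))) ltac:(by rewrite ltry).
move: Te; rewrite gt_max => /andP[e1 Te].
have e0 := lt_trans ltr01 e1; exists e; split=> //.
rewrite ler_pdivrMr ?exprn_gt0// mulrC -ler_pdivrMr ?mulr_gt0//.
apply: (le_trans (ltW Te)); by rewrite expr2 ler_peMl// ltW.
Qed.

End DistanceToBoundary.

Section CoordinateLine.
Context {R : realType} {d : nat}.
Local Notation V := ('rV[R[i]^o]_d).
Implicit Types (a b u v : 'rV[R]_d) (i : 'I_d) (z : R[i]) (rho : R).

(** The complex line through [u] in direction i, parametrised by the i-th coordinate itself, so that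
    real parameters correspond to [set_coord]. *)
Definition cline u i z : V := to_complex u + (z - (u 0 i)%:C) *: delta_mx 0 i.

Lemma cline_self u i k z : cline u i z 0 k = if k == i then z else (u 0 k)%:C.
Proof.
rewrite !mxE eqxx /=; case: eqP => [->|_]; last by rewrite mulr0 addr0.
by rewrite mulr1 addrC subrK.
Qed.

Lemma cline_real u i (s : R) : cline u i s%:C = to_complex (set_coord u i s).
Proof. by apply/rowP => k; rewrite cline_self !mxE; case: eqP. Qed.

Lemma cline_start u i : cline u i (u 0 i)%:C = to_complex u.
Proof. by rewrite /cline subrr scale0r addr0. Qed.

Lemma cnorm_cline u i z w : cnorm (cline u i z - cline u i w) = normc (z - w).
Proof.
rewrite /cnorm (bigD1 i)//= big1 => [|k ki]; last first.
  by rewrite !mxE /= (negbTE ki) !mulr0 subrr normc0 expr0n.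
rewrite addr0 mxE [X in _ + X]mxE !cline_self eqxx.
by rewrite sqrtr_sqr ger0_norm// normc_ge0.
Qed.

Lemma clineE u i z : cline u i z = cline u i 0 + z *: delta_mx 0 i.
Proof. by rewrite /cline -addrA -scalerDl sub0r [- _ + _]addrC. Qed.

Lemma cline_combine u i z w (t : R[i]) :
  cline u i z + t *: (cline u i w - cline u i z) = cline u i (z + t * (w - z)).
Proof.
apply/rowP => k; rewrite !mxE /=; case: (k == i) => /=; ring.
Qed.

Lemma cline_polydisc rho a0 b0 a b u i z : 1 < rho ->
  (forall k, a 0 k < b 0 k) ->
  (forall k, a0 0 k <= a 0 k /\ b 0 k <= b0 0 k) -> box a b u ->
  bernstein_disc_on rho (a 0 i) (b 0 i) z -> bernstein_polydisc rho a0 b0 (cline u i z).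
Proof.
move=> rho1 ab sub bu hz k; rewrite cline_self.
have [h1 h2] := sub k; have abk := ab k.
case: eqP => [ki|_].
  rewrite ki in h1 h2 abk *.
  apply: (@bernstein_disc_on_subset _ 1 rho rho _ _ (a 0 i) (b 0 i)) => //.
    by rewrite mul1r lerB.
  by rewrite mul1r.
have /andP[u1 u2] := bu k; apply: bernstein_disc_on_real => //.
  by apply: (le_lt_trans h1); apply: lt_le_trans h2.
by rewrite (le_trans h1 u1) (le_trans u2 h2).
Qed.

(** A point between the foci is a convex combination of them, so its distance to z is at most the
    sum of the two focal distances. *)
Lemma disc_on_dist rho (x y s : R) z : x < y -> x <= s <= y ->
  bernstein_disc_on rho x y z -> normc (z - s%:C) <= (y - x) / 2 * (rho + rho^-1).
Proof.
move=> xy /andP[xs sy] /(bernstein_disc_onP _ _ xy) H.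
apply: le_trans (ltW H).
have yx0 : 0 < y - x by rewrite subr_gt0.
pose t := (s - x) / (y - x).
have t0 : 0 <= t by rewrite divr_ge0 ?subr_ge0// ltW.
have t1 : t <= 1 by rewrite ler_pdivrMr// mul1r lerB.
have -> : z - s%:C = t%:C * (z - y%:C) + (1 - t)%:C * (z - x%:C).
  have -> : s%:C = t%:C * y%:C + (1 - t)%:C * x%:C :> R[i].
    rewrite -!rmorphM -rmorphD; congr (_%:C); rewrite /t; field.
    by rewrite gt_eqF.
  by rewrite rmorphB rmorph1; ring.
apply: (le_trans (le_normcD _ _)); rewrite !normcM !normc_real.
rewrite !ger0_norm ?subr_ge0//; apply: lerD.
  by rewrite ler_piMl ?normc_ge0.
by rewrite ler_piMl ?normc_ge0// lerBlDr lerDl.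
Qed.

End CoordinateLine.

(** * Extension of phase differences, with [Om] and [Psi] abstract so as to serve either order of
    the arguments *)

Section PhaseExtension.
Context {R : realType} {d : nat}.
Local Notation V := ('rV[R[i]^o]_d).
Variables (Om : V -> V -> Prop) (Psi : V -> V -> R[i]) (M eps rho kappa gamma : R).
Variables (a0 b0 aL bL : 'rV[R]_d).
Hypothesis eps0 : 0 < eps.
Hypothesis rho1 : 1 < rho.
Hypothesis kappa0 : 0 <= kappa.
Hypothesis M0 : 0 <= M.
Hypothesis Psi_line : forall X U Y (s : R[i]^o), Om (X + s *: U) Y ->
  differentiable (fun s : R[i]^o => Psi (X + s *: U) Y : R[i]^o) s.
Hypothesis Psi_mixed : forall X0 X1 Y0 Y1,
  (forall s t, 0 <= s <= 1 -> 0 <= t <= 1 -> forall X Y,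
    cball (X0 + s%:C *: (X1 - X0)) eps X -> cball (Y0 + t%:C *: (Y1 - Y0)) eps Y ->
    Om X Y) ->
  normc (Psi X1 Y1 - Psi X1 Y0 - (Psi X0 Y1 - Psi X0 Y0)) <=
    256 * M * (cnorm (X1 - X0) * cnorm (Y1 - Y0)) / eps ^+ 2.
Hypothesis Om_nbhd : forall X v, bernstein_polydisc rho a0 b0 X -> box aL bL v ->
  forall X' Y', cball X eps X' -> cball (to_complex v) eps Y' -> Om X' Y'.
Hypothesis Psi_real : forall u v, box a0 b0 u -> box aL bL v ->
  complex.Im (Psi (to_complex u) (to_complex v)) = 0.

(* 512 = 4 * 256 / 2: the factor 4 is that of [near_sup_scale], 256 that of
   [mixed_difference], and 1/2 turns the side of a box into the radius of its
   Bernstein disc. *)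
Definition phase_const (rho gamma : R) := expR (512 * gamma * (rho + rho^-1)).

Lemma cball_center (X : V) : cball X eps X.
Proof.
rewrite /cball/= subrr; have -> : cnorm (0 : V) = 0 => //.
by rewrite -(scale0r (0 : V)) cnormZ normc0 mul0r.
Qed.

(** The modulus of e^(i kappa G) is e^(- kappa Im G), and Im G equals the imaginary part of a mixed
    difference [W] because [Psi] is real at the base point [u]. [S] may exceed the side, as the
    smallness condition refers to a coarser box; [alpha] is the amplitude at level 0 and 1 at later
    levels. *)
Lemma phase_extension (a b u v0 v1 : 'rV[R]_d) (i : 'I_d) (S Ma : R) (alpha : V -> R[i]) :
  (forall k, a 0 k < b 0 k) ->
  (forall k, a0 0 k <= a 0 k /\ b 0 k <= b0 0 k) ->
  b 0 i - a 0 i <= S -> box a b u -> box aL bL v0 -> box aL bL v1 ->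
  kappa * S * rnorm (v0 - v1) * M / eps ^+ 2 <= 4 * gamma ->
  (forall X U (s : R[i]^o), bernstein_polydisc rho a0 b0 (X + s *: U) ->
     differentiable (fun s : R[i]^o => alpha (X + s *: U) : R[i]^o) s) ->
  (forall X, bernstein_polydisc rho a0 b0 X -> normc (alpha X) <= Ma) ->
  hol_ext rho (a 0 i) (b 0 i) (phase_const rho gamma * Ma) (fun s =>
    cexp ((0 +i* kappa) * (Psi (to_complex (set_coord u i s)) (to_complex v0) -
                           Psi (to_complex (set_coord u i s)) (to_complex v1))) *
    alpha (to_complex (set_coord u i s))).
Proof.
move=> ab sub hS bu bv0 bv1 small dalpha alphaM.
pose G (z : R[i]^o) : R[i]^o := Psi (cline u i z) (to_complex v0) - Psi (cline u i z) (to_complex v1).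
exists (fun z => cexp ((0 +i* kappa) * G z) * alpha (cline u i z)).
have inE z : bernstein_disc_on rho (a 0 i) (b 0 i) z -> bernstein_polydisc rho a0 b0 (cline u i z).
  by move=> hz; apply: cline_polydisc hz.
have bu0 : box a0 b0 u.
  by move=> k; have [h1 h2] := sub k; have /andP[u1 u2] := bu k;
    rewrite (le_trans h1 u1) (le_trans u2 h2).
split=> [z hz|z hz|s hs]; last by rewrite /G cline_real.
- have dcl (h : V -> R[i]^o) : (forall X U (s : R[i]^o), X + s *: U = cline u i z ->
      differentiable (fun s : R[i]^o => h (X + s *: U) : R[i]^o) s) ->
      differentiable (fun z : R[i]^o => h (cline u i z) : R[i]^o) (z : R[i]^o).
    move=> /(_ (cline u i 0) (delta_mx 0 i) z (esym (clineE u i z))).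
    by under [X in _ -> differentiable X _]eq_fun do rewrite clineE.
  apply: differentiable_mul.
    have -> : (fun w : R[i]^o => cexp ((0 +i* kappa) * G w) : R[i]^o) =
      (cexp : R[i]^o -> R[i]^o) \o (fun w : R[i]^o => (0 +i* kappa) * G w : R[i]^o) by [].
    apply: differentiable_comp; last exact: differentiable_cexp.
    apply: differentiable_scale; apply: differentiable_sub.
      apply: (dcl (fun X => Psi X (to_complex v0))) => X U s E.
      apply: Psi_line; rewrite E.
      by apply: (Om_nbhd (inE z hz) bv0); exact: cball_center.
    apply: (dcl (fun X => Psi X (to_complex v1))) => X U s E.
    apply: Psi_line; rewrite E.
    by apply: (Om_nbhd (inE z hz) bv1); exact: cball_center.
  by apply: (dcl alpha) => X U s E; apply: dalpha; rewrite E; exact: inE.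
rewrite normcM; apply: ler_pM; rewrite ?normc_ge0 ?alphaM//; last exact: inE.
rewrite normc_cexp ler_expR.
have -> : complex.Re ((0 +i* kappa) * G z) = - (kappa * complex.Im (G z)).
  by case: (G z) => x y /=; rewrite mul0r sub0r.
apply: (le_trans (ler_norm _)); rewrite normrN normrM (ger0_norm kappa0).
pose X0 := to_complex u; pose X1 := cline u i z.
pose W := Psi X1 (to_complex v0) - Psi X1 (to_complex v1) -
    (Psi X0 (to_complex v0) - Psi X0 (to_complex v1)).
have ImE : complex.Im (G z) = complex.Im W.
  have ImB (x y : R[i]) : complex.Im (x - y) = complex.Im x - complex.Im y.
    by case: x; case: y.
  by rewrite /W /G -/X1 !ImB !Psi_real// subrr subr0.
have ui : bernstein_disc_on rho (a 0 i) (b 0 i) (u 0 i)%:C.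
  exact: bernstein_disc_on_real.
have HW : normc W <= 256 * M * (cnorm (X1 - X0) * rnorm (v0 - v1)) / eps ^+ 2.
  (* By convexity the segment from [X0] to [X1] stays in the Bernstein disc, and that from [v1] to
     [v0] in the real box. *)
  rewrite -cnorm_to_complexB; apply: Psi_mixed => s t s01 t01 X Y.
  have -> : X0 + s%:C *: (X1 - X0) = cline u i ((u 0 i)%:C + s%:C * (z - (u 0 i)%:C)).
    by rewrite -cline_combine cline_start.
  have -> : to_complex v1 + t%:C *: (to_complex v0 - to_complex v1) =
      to_complex (v1 + t *: (v0 - v1)).
    by apply/rowP => k; rewrite !mxE -rmorphB -rmorphM -rmorphD.
  apply: Om_nbhd; last exact: box_convex.
  by apply/inE/bernstein_disc_on_convex.
have n1 : cnorm (X1 - X0) <= S / 2 * (rho + rho^-1).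
  rewrite /X0 -(cline_start u i) cnorm_cline.
  have rp : 0 <= rho + rho^-1 by rewrite addr_ge0 ?invr_ge0// ltW// (lt_trans _ rho1).
  apply: (le_trans (disc_on_dist (ab i) (bu i) hz)).
  by rewrite ler_wpM2r// ler_pM2r// invr_gt0.
rewrite ImE.
apply: (@le_trans _ _ (kappa * (256 * M * (cnorm (X1 - X0) * rnorm (v0 - v1)) / eps ^+ 2))).
  by rewrite ler_wpM2l// (le_trans (Im_le_normc _)).
apply: (@le_trans _ _ (kappa * (256 * M * (S / 2 * (rho + rho^-1) * rnorm (v0 - v1)) / eps ^+ 2))).
  rewrite ler_wpM2l// ler_pM2r ?invr_gt0 ?exprn_gt0//.
  by rewrite ler_wpM2l ?mulr_ge0// ler_wpM2r// rnorm_ge0.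
have -> : kappa * (256 * M * (S / 2 * (rho + rho^-1) * rnorm (v0 - v1)) / eps ^+ 2) =
    128 * (kappa * S * rnorm (v0 - v1) * M / eps ^+ 2) * (rho + rho^-1).
  by move: (rho + rho^-1) => Q; field; rewrite gt_eqF.
rewrite ler_wpM2r ?addr_ge0 ?invr_ge0//; try (by rewrite ltW// (lt_trans _ rho1)).
have -> : 512 * gamma = 128 * (4 * gamma) by ring.
by rewrite ler_wpM2l.
Qed.

End PhaseExtension.

(** * Linearity of the operators and duality for vector values *)

Section Linearity.
Context {R : realType} {d m : nat}.
Implicit Types (V W : lmodType R[i]) (xi : 'I_m.+1 -> R) (a b u : 'rV[R]_d).

Section Morphism.
Context {V W : lmodType R[i]}.
Variable T : {linear V -> W}.
Implicit Types f : 'rV[R]_d -> V.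

Lemma interp_morph xi (g : R -> V) t : T (interp xi g t) = interp xi (T \o g) t.
Proof. by rewrite /interp linear_sum; apply: eq_bigr => j _; rewrite linearZ. Qed.

Lemma interp_box_morph xi a b f :
  T \o interp_box xi a b f = interp_box xi a b (T \o f).
Proof.
rewrite /interp_box; elim: (enum _) => [//|i s IH] /=; rewrite -IH.
by apply: funext => u /=; rewrite /interp_coord /interp_on interp_morph.
Qed.

Lemma phase_interp_morph xi kappa phi a b f :
  T \o phase_interp xi kappa phi a b f = phase_interp xi kappa phi a b (T \o f).
Proof.
apply: funext => u /=; rewrite /phase_interp linearZ/=.
congr (_ *: _); rewrite -[LHS]/((T \o _) u) interp_box_morph.
by congr (interp_box _ _ _ _ _); apply: funext => v /=; rewrite linearZ.
Qed.

Lemma phase_interp_chain_morph xi kappa phi (a b : nat -> 'rV[R]_d) n f :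
  T \o phase_interp_chain xi kappa phi a b n f =
  phase_interp_chain xi kappa phi a b n (T \o f).
Proof. by elim: n => [|n IH] /=; rewrite phase_interp_morph// IH. Qed.

Lemma tensor_op_morph xi kappa phi psi (a b a' b' : nat -> 'rV[R]_d) n k u v :
  T (tensor_op (phase_interp_chain xi kappa phi a b n)
               (phase_interp_chain xi kappa psi a' b' n) k u v) =
  tensor_op (phase_interp_chain xi kappa phi a b n)
            (phase_interp_chain xi kappa psi a' b' n) (fun x y => T (k x y)) u v.
Proof.
rewrite /tensor_op -[LHS]/((T \o _) u) phase_interp_chain_morph.
congr (phase_interp_chain _ _ _ _ _ _ _ _); apply: funext => x /=.
by rewrite -[LHS]/((T \o _) v) phase_interp_chain_morph.
Qed.

End Morphism.

Section Difference.
Context {V : lmodType R[i]}.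
Implicit Types f g : 'rV[R]_d -> V.

Lemma interp_boxB xi a b f g u :
  interp_box xi a b (fun v => f v - g v) u = interp_box xi a b f u - interp_box xi a b g u.
Proof.
rewrite /interp_box; elim: (enum _) u => [//|i s IH] u /=.
rewrite /interp_coord /interp_on /interp -sumrB; apply: eq_bigr => j _.
by rewrite IH scalerBr.
Qed.

Lemma phase_interp_chainB xi kappa phi (a b : nat -> 'rV[R]_d) n f g u :
  phase_interp_chain xi kappa phi a b n (fun v => f v - g v) u =
  phase_interp_chain xi kappa phi a b n f u - phase_interp_chain xi kappa phi a b n g u.
Proof.
have H l f' g' h w : (forall w, h w = f' w - g' w) ->
    phase_interp xi kappa (phi l) (a l) (b l) h w =
    phase_interp xi kappa (phi l) (a l) (b l) f' w -
    phase_interp xi kappa (phi l) (a l) (b l) g' w.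
  move=> hE; rewrite /phase_interp -scalerBr -interp_boxB; congr (_ *: interp_box _ _ _ _ _).
  by apply: funext => v; rewrite hE scalerBr.
by elim: n u => [|n IH] u /=; apply: H.
Qed.

End Difference.
End Linearity.

Section Functionals.
Context {R : realType} {p : nat}.
Implicit Types v w : 'rV[R[i]^o]_p.

(** From 0 <= sum (Y x_j - X y_j)^2 = 2 X Y (X Y - sum x_j y_j), with X Y = 0 treated apart. *)
Lemma cauchy_schwarz_sum n (x y : 'I_n -> R) :
  \sum_j x j * y j <= Num.sqrt (\sum_j x j ^+ 2) * Num.sqrt (\sum_j y j ^+ 2).
Proof.
set X := Num.sqrt _; set Y := Num.sqrt _.
have sq (z : 'I_n -> R) : 0 <= \sum_j z j ^+ 2 by apply: sumr_ge0 => j _; exact: sqr_ge0.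
have X2 : X ^+ 2 = \sum_j x j ^+ 2 by rewrite sqr_sqrtr.
have Y2 : Y ^+ 2 = \sum_j y j ^+ 2 by rewrite sqr_sqrtr.
have [X0 Y0] : 0 <= X /\ 0 <= Y by split; exact: sqrtr_ge0.
have zero (z z' : 'I_n -> R) : \sum_j z j ^+ 2 = 0 -> \sum_j z j * z' j = 0.
  move=> /eqP; rewrite psumr_eq0 => [/allP H|j _]; last exact: sqr_ge0.
  apply: big1 => j _; have := H j; rewrite mem_index_enum sqrf_eq0 => /(_ isT)/eqP ->.
  by rewrite mul0r.
have [X0'|Xn] := eqVneq X 0.
  by rewrite X0' mul0r zero// -X2 X0' expr0n.
have [Y0'|Yn] := eqVneq Y 0.
  rewrite Y0' mulr0; under eq_bigr do rewrite mulrC.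
  by rewrite zero// -Y2 Y0' expr0n.
have : 0 <= \sum_j (Y * x j - X * y j) ^+ 2 by apply: sq.
have -> : \sum_j (Y * x j - X * y j) ^+ 2 = 2 * (X * Y) * (X * Y - \sum_j x j * y j).
  have -> : \sum_j (Y * x j - X * y j) ^+ 2 =
      Y ^+ 2 * (\sum_j x j ^+ 2) + X ^+ 2 * (\sum_j y j ^+ 2) -
      2 * (X * Y) * \sum_j x j * y j.
    by rewrite !mulr_sumr -big_split -sumrB; apply: eq_bigr => j _ /=; ring.
  by rewrite -X2 -Y2; ring.
by rewrite pmulr_rge0 ?subr_ge0// !mulr_gt0// lt_def ?Xn ?Yn.
Qed.

(** Bilinear, without conjugation; [cnorm_le_pairing] puts the conjugation into the test vector,
    which yields |v|^2 <= D |v|. *)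
Definition pairing w v : R[i]^o := \sum_j w 0 j * v 0 j.

Lemma pairing_linear w : linear (pairing w).
Proof.
move=> c u v; rewrite /pairing scaler_sumr -big_split; apply: eq_bigr => j _ /=.
by rewrite !mxE -[_ *: _]/(_ * _) mulrDr mulrCA.
Qed.

HB.instance Definition _ w := GRing.isLinear.Build R[i] 'rV[R[i]^o]_p R[i]^o *:%R
  (pairing w) (pairing_linear w).

Lemma normc_pairing w v : normc (pairing w v) <= cnorm w * cnorm v.
Proof.
apply: le_trans (cauchy_schwarz_sum _ _); apply: (le_trans (normc_sum _ _ _)).
by apply: ler_sum => j _; rewrite normcM.
Qed.

Lemma cnorm_le_pairing v D : 0 <= D ->
  (forall w, normc (pairing w v) <= D * cnorm w) -> cnorm v <= D.
Proof.
move=> D0 /(_ (map_mx (@conjc R) v)).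
have -> : cnorm (map_mx (@conjc R) v : 'rV[R[i]^o]_p) = cnorm v.
  rewrite /cnorm; congr Num.sqrt; apply: eq_bigr => j _; rewrite mxE.
  by case: (v 0 j) => x y /=; rewrite sqrrN.
have -> : pairing (map_mx (@conjc R) v) v = (cnorm v ^+ 2)%:C.
  rewrite /cnorm sqr_sqrtr; last by apply: sumr_ge0 => j _; exact: sqr_ge0.
  rewrite rmorph_sum /pairing; apply: eq_bigr => j _; rewrite mxE normc2.
  case: (v 0 j) => x y /=; apply/eqP; rewrite eq_complex/=.
  by apply/andP; split; apply/eqP; ring.
have := cnorm_ge0 v; rewrite normc_real => v0; rewrite ger0_norm ?exprn_ge0//.
move: v0; rewrite le_eqVlt => /predU1P[<-//|v0].
by rewrite expr2 ler_pM2r.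
Qed.

End Functionals.

(** * Choice of the constants *)

Section Constants.
Context {R : realType}.
Implicit Types (g h : nat -> R) (c : R).

(** Growth below every exponential; closure under sums, products and powers absorbs the polynomial
    factors in m without tracking them. *)
Definition subexponential g := forall c, 0 < c ->
  exists2 C, 0 < C & forall n, g n <= C * expR (c * n%:R).

Lemma subexponential_cst (k : R) : subexponential (fun=> k).
Proof.
move=> c c0; exists (`|k| + 1) => [|n]; first by rewrite ltr_wpDl.
have e1 : 1 <= expR (c * n%:R).
  by rewrite -expR0 ler_expR mulr_ge0// ltW.
apply: (@le_trans _ _ ((`|k| + 1) * 1)).
  by rewrite mulr1 (le_trans (ler_norm k))// lerDl.
by rewrite ler_wpM2l// addr_ge0.
Qed.

Lemma subexponentialM g h : (forall n, 0 <= g n) -> (forall n, 0 <= h n) ->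
  subexponential g -> subexponential h -> subexponential (fun n => g n * h n).
Proof.
move=> g0 h0 sg sh c c0; have c2 : 0 < c / 2 by rewrite divr_gt0.
have [C C0 gC] := sg _ c2; have [D D0 hD] := sh _ c2.
exists (C * D) => [|n /=]; first exact: mulr_gt0.
have -> : C * D * expR (c * n%:R) =
    (C * expR (c / 2 * n%:R)) * (D * expR (c / 2 * n%:R)).
  by rewrite mulrACA -expRD; congr (_ * expR _); field.
by apply: ler_pM.
Qed.

Lemma subexponentialD g h : subexponential g -> subexponential h ->
  subexponential (fun n => g n + h n).
Proof.
move=> sg sh c c0; have [C C0 gC] := sg _ c0; have [D D0 hD] := sh _ c0.
by exists (C + D) => [|n /=]; [exact: addr_gt0|rewrite mulrDl lerD].
Qed.

Lemma subexponentialX g k : (forall n, 0 <= g n) ->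
  subexponential g -> subexponential (fun n => g n ^+ k).
Proof.
move=> g0 sg; elim: k => [|k IH].
  by under eq_fun do rewrite expr0; exact: subexponential_cst.
under eq_fun do rewrite exprS; apply: subexponentialM => // n.
by rewrite exprn_ge0.
Qed.

Lemma subexponential_succ : subexponential (fun n => n.+1%:R).
Proof.
move=> c c0; exists (1 + c^-1) => [|n]; first by rewrite addr_gt0// invr_gt0.
have n0 : 0 <= n%:R :> R by [].
apply: (@le_trans _ _ ((1 + c^-1) * (1 + c * n%:R))).
  have -> : (1 + c^-1) * (1 + c * n%:R) = n.+1%:R + (c * n%:R + c^-1).
    by rewrite -natr1; field; rewrite gt_eqF.
  by rewrite lerDl addr_ge0 ?invr_ge0 ?mulr_ge0// ltW.
by rewrite ler_wpM2l ?expR_ge1Dx// addr_ge0// invr_ge0 ltW.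
Qed.

Lemma subexponential_le g h : (forall n, g n <= h n) ->
  subexponential h -> subexponential g.
Proof.
move=> gh sh c c0; have [C C0 hC] := sh _ c0.
by exists C => // n; exact: le_trans (gh n) (hC n).
Qed.

Lemma subexponential_powR (l : R) : subexponential (fun n => n.+1%:R `^ l).
Proof.
pose k := (Num.truncn `|l|).+1.
apply: (@subexponential_le _ (fun n => n.+1%:R ^+ k)) => [n|].
  rewrite -powR_mulrn// ler_powR ?ler1n//.
  by rewrite (le_trans (ler_norm l))// ltW// truncnS_gt.
by apply: subexponentialX => //; exact: subexponential_succ.
Qed.

(** [err] is the error of one side per unit of amplitude; the last summand is the error of the other
    side after passing through a stable chain. *)
Definition chain_total_error (eps base Ld : R) (L : nat) : R :=
  let err := base + L%:R * (eps * ((1 + eps) ^+ L * Ld)) in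
  err + (1 + eps) ^+ L * (Ld * err).

(** Bookkeeping in powers of t, which is later exponentially small in m. Since L <= t^-2, L eps is
    at most C t^4 and (1 + eps)^L at most e^C; one stability factor C / t leaves [err] of order t^3,
    a second one leaves t^2. *)
Lemma chain_total_error_bound (C eps base Ld t : R) (L : nat) :
  0 <= C -> 0 < t -> t <= 1 -> t ^+ 2 * L.+2%:R <= 1 ->
  0 <= eps -> eps <= C * t ^+ 6 -> base <= C * t ^+ 6 ->
  0 <= Ld -> Ld <= C / t ->
  chain_total_error eps base Ld L <=
    (C + C ^+ 2 * expR C) * (1 + C * expR C) * t ^+ 2.
Proof.
move=> C0 t0 t1 tL e0 et bt Ld0 Ldt.
have t0' := ltW t0; have eC := expR_ge0 C.
have Le : L%:R * eps <= C * t ^+ 4.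
  apply: (le_trans (ler_wpM2l _ et)) => //.
  have -> : L%:R * (C * t ^+ 6) = C * t ^+ 4 * (t ^+ 2 * L%:R) by ring.
  rewrite ler_piMr ?mulr_ge0 ?exprn_ge0//; apply: le_trans tL.
  by rewrite ler_wpM2l ?exprn_ge0// ler_nat -addn2 leq_addr.
have G : (1 + eps) ^+ L <= expR C.
  apply: (@le_trans _ _ (expR eps ^+ L)).
    by rewrite lerXn2r ?nnegrE ?expR_ge0 ?addr_ge0// expR_ge1Dx.
  rewrite -expRM_natl ler_expR (le_trans Le)// ler_piMr// exprn_ile1//.
have G0 : 0 <= (1 + eps) ^+ L by rewrite exprn_ge0// addr_ge0.
rewrite /chain_total_error; set err := base + _.
have errt : err <= (C + C ^+ 2 * expR C) * t ^+ 3.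
  rewrite mulrDl; apply: lerD.
    by apply: (le_trans bt); rewrite ler_wpM2l// ler_wiXn2l.
  rewrite mulrA; apply: (@le_trans _ _ ((C * t ^+ 4) * (expR C * (C / t)))).
    by rewrite ler_pM ?mulr_ge0// ler_pM.
  by rewrite le_eqVlt; apply/orP; left; apply/eqP; field; rewrite gt_eqF.
have H0 : 0 <= C + C ^+ 2 * expR C by rewrite addr_ge0// mulr_ge0// exprn_ge0.
have -> : (C + C ^+ 2 * expR C) * (1 + C * expR C) * t ^+ 2 =
    (C + C ^+ 2 * expR C) * t ^+ 2 +
    expR C * ((C / t) * ((C + C ^+ 2 * expR C) * t ^+ 3)).
  by field; rewrite gt_eqF.
apply: lerD.
  by apply: (le_trans errt); rewrite ler_wpM2l// ler_wiXn2l.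
have E0 : 0 <= (C + C ^+ 2 * expR C) * t ^+ 3 by rewrite mulr_ge0// exprn_ge0.
apply: (@le_trans _ _ ((1 + eps) ^+ L * (Ld * ((C + C ^+ 2 * expR C) * t ^+ 3)))).
  by rewrite ler_wpM2l// ler_wpM2l.
rewrite ler_pM// ?mulr_ge0//.
by rewrite ler_wpM2r.
Qed.

Variables (d : nat) (gamma rho q CL lambda : R).
Hypotheses (gamma0 : 0 < gamma) (rho1 : 1 < rho) (q01 : 0 < q < 1) (CL0 : 0 < CL).

(* [(inner_rho - 1) ^+ 2 = q * (rho - 1) ^+ 2], so that the disc of parameter
   [rho] of a box lies in the disc of parameter [inner_rho] of its predecessor. *)
Definition inner_rho := 1 + Num.sqrt q * (rho - 1).
Definition middle_rho := (inner_rho + rho) / 2.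
(** The summand 1 provides the hypothesis 1 <= [Lam] of the interpolation estimates. *)
Definition stability (n : nat) := 1 + CL * n.+1%:R `^ lambda.

Lemma inner_rho_gt1 : 1 < inner_rho.
Proof. by rewrite ltrDl mulr_gt0 ?subr_gt0// sqrtr_gt0; case/andP: q01. Qed.

Lemma inner_rho_lt : inner_rho < rho.
Proof.
rewrite /inner_rho addrC -ltrBrDr gtr_pMl ?subr_gt0//.
case/andP: q01 => q0 q1; rewrite -[ltRHS]sqrtr1.
by rewrite ltr_sqrt.
Qed.

Lemma inner_lt_middle : inner_rho < middle_rho.
Proof. by have := inner_rho_lt; rewrite /middle_rho; lra. Qed.

Lemma middle_lt_rho : middle_rho < rho.
Proof. by have := inner_rho_lt; rewrite /middle_rho; lra. Qed.

(** With x + 1/x - 2 = (x - 1)^2 / x both sides have the same numerator by the choice of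
    [inner_rho], and the smaller denominator is on the right. *)
Lemma inner_rho_shrink :
  q * (rho + rho^-1 - 2) <= inner_rho + inner_rho^-1 - 2.
Proof.
have s0 := lt_trans ltr01 inner_rho_gt1; have rho0 := lt_trans ltr01 rho1.
have sq x : 0 < x -> x + x^-1 - 2 = (x - 1) ^+ 2 / x :> R.
  by move=> x0; field; rewrite gt_eqF.
rewrite !sq// {1}/inner_rho addrAC subrr add0r exprMn sqr_sqrtr; last first.
  by case/andP: q01 => /ltW.
have q0 : 0 <= q by case/andP: q01 => /ltW.
have q2 : 0 <= q * (rho - 1) ^+ 2 by apply: mulr_ge0 => //; exact: sqr_ge0.
rewrite mulrA ler_wpM2l//.
by rewrite lef_pV2 ?posrE// ltW// inner_rho_lt.
Qed.

Lemma stability_ge1 n : 1 <= stability n.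
Proof. by rewrite lerDl mulr_ge0 ?powR_ge0// ltW. Qed.

Section Decay.
Variables (sigma r K : R).
Hypotheses (s1 : 1 < sigma) (sr : sigma < r) (K0 : 0 <= K).

Let base n := @base_error R d n (stability n) r K.
Let eps n := @step_error R d n (stability n) r sigma K.

Lemma constants : exists C b b' : R, [/\ 0 < C, 0 < b, 0 < b' &
  forall L n, b' * ln L.+2%:R <= n%:R ->
    chain_total_error (eps n) (base n) (stability n ^+ d) L <= C * expR (- b * n%:R)].
Proof.
have s0 := lt_trans ltr01 s1; have r0 := lt_trans s0 sr.
have r1 := lt_trans s1 sr.
pose eta := ln (r / sigma).
have eta0 : 0 < eta by rewrite ln_gt0// ltr_pdivlMr// mul1r.
have mi0 : 0 < r / sigma by exact: divr_gt0.
have rm1 : 0 <= (r - 1)^-1 by rewrite invr_ge0 subr_ge0 ltW.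
have eE n : (sigma / r) ^+ n = expR (- (eta * n%:R)).
  rewrite -mulNr expRM_natr /eta expRN lnK ?posrE//.
  by congr (_ ^+ n); rewrite [RHS]invf_div.
have st0 n : 0 <= stability n by apply: le_trans (stability_ge1 n).
have sst : subexponential stability.
  apply: subexponentialD; first exact: subexponential_cst.
  apply: subexponentialM => [n|n||]; rewrite ?powR_ge0 ?(ltW CL0)//.
    exact: subexponential_cst.
  exact: subexponential_powR.
have sLd : subexponential (fun n => stability n ^+ d) by exact: subexponentialX.
pose P n := d%:R * stability n ^+ d * ((1 + stability n) *
  (8 * K * (2 * n).+1%:R * 2 / (r - 1))).
have sP : subexponential P.
  apply: subexponentialM => [n|n||].
  - by apply: mulr_ge0 => //; exact: exprn_ge0.
  - by apply: mulr_ge0; [exact: addr_ge0|rewrite !mulr_ge0].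
  - apply: subexponentialM => [//|n||//]; first exact: exprn_ge0.
    exact: subexponential_cst.
  - apply: subexponentialM => [n|n||].
    + exact: addr_ge0.
    + by rewrite !mulr_ge0//.
    + by apply: subexponentialD => //; exact: subexponential_cst.
    + apply: (@subexponential_le _ (fun n => (8 * K * 2 * 2 / (r - 1)) * n.+1%:R)).
        move=> n; have -> : 8 * K * (2 * n).+1%:R * 2 / (r - 1) =
            (8 * K * 2 / (r - 1)) * (2 * n).+1%:R by ring.
        have -> : 8 * K * 2 * 2 / (r - 1) * n.+1%:R =
            (8 * K * 2 / (r - 1)) * (2 * n.+1)%:R by rewrite natrM; ring.
        rewrite ler_wpM2l ?ler_nat ?mulnS//.
        by rewrite !mulr_ge0//.
      apply: subexponentialM => [n|//||]; last exact: subexponential_succ.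
        by rewrite !mulr_ge0//.
      exact: subexponential_cst.
(* The decay rate eta is spent in units of eta / 8, the rate of [t] below: [P] takes two of the
   eight and leaves t^6, and [stability n ^+ d] grows by one unit, that is 1 / t. *)
have [C1 C10 HC1] := sP (eta / 4) ltac:(by rewrite divr_gt0).
have [C2 C20 HC2] := sLd (eta / 8) ltac:(by rewrite divr_gt0).
pose C := C1 + C2.
have C0 : 0 < C by rewrite addr_gt0.
(* The rate eta / 4 is that of t^2, and 4 / eta is what makes t^2 (L + 2) <= 1. *)
exists ((C + C ^+ 2 * expR C) * (1 + C * expR C)), (eta / 4), (4 / eta).
split; rewrite ?divr_gt0//.
  by rewrite mulr_gt0// addr_gt0 ?mulr_gt0 ?exprn_gt0 ?expR_gt0.
move=> L n Ln; pose t := expR (- (eta / 8 * n%:R)).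
have t0 : 0 < t by exact: expR_gt0.
have tk k : t ^+ k = expR (- (k%:R * (eta / 8 * n%:R))) by rewrite -expRM_natl mulrN.
have -> : expR (- (eta / 4) * n%:R) = t ^+ 2.
  by rewrite tk; congr expR; field.
have t1 : t <= 1 by rewrite -expR0 ler_expR oppr_le0 !mulr_ge0// ltW// divr_gt0.
have epsE : eps n = P n * (sigma / r) ^+ n.
  rewrite /eps /step_error /base_error /P expr_div_n; ring.
have epst : eps n <= C * t ^+ 6.
  rewrite epsE eE; apply: (@le_trans _ _ (C1 * expR (eta / 4 * n%:R) * expR (- (eta * n%:R)))).
    by rewrite ler_wpM2r ?expR_ge0.
  rewrite -mulrA -expRD tk; have -> : eta / 4 * n%:R - eta * n%:R = - (6 * (eta / 8 * n%:R)) by field.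
  by rewrite ler_wpM2r ?expR_ge0// lerDl ltW.
apply: chain_total_error_bound => //.
- exact: ltW.
- rewrite tk -ler_pdivlMr// div1r -[leRHS]lnK ?posrE ?invr_gt0// ler_expR.
  rewrite lnV ?posrE// lerN2.
  move: Ln; rewrite mulrAC ler_pdivrMr// => Ln.
  by rewrite -(ler_pM2l (_ : 0 < 4)) //; apply: (le_trans Ln); lra.
- apply: step_error_ge0 => //; exact: stability_ge1.
(* The step error is the base error times the polynomial growth factor, which is at least 1. *)
- apply: le_trans epst; rewrite /base /eps /step_error /base_error.
  apply: ler_wpM2l; first by apply: mulr_ge0 => //; exact: exprn_ge0.
  apply: ler_wpM2l; first exact: addr_ge0.
  apply: ler_wpM2r; first by apply: mulr_ge0 => //; rewrite invr_ge0 exprn_ge0// ltW.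
  apply: ler_wpM2l => //; rewrite ler_peMr//.
  apply: mulr_ege1; last by rewrite exprn_ege1// ltW.
  by rewrite -natrM ler1n.
- exact: exprn_ge0.
- apply: (le_trans (HC2 n)).
  have -> : t^-1 = expR (eta / 8 * n%:R) by rewrite /t expRN invrK.
  by rewrite ler_wpM2r ?expR_ge0// lerDr ltW.
Qed.

End Decay.

End Constants.

(** * Stability and error of the chain on one side *)

Section OneSidedChain.
Context {R : realType} {d m : nat}.
Local Notation V := ('rV[R[i]^o]_d).
Variable xi : 'I_m.+1 -> R.
Hypothesis xi_inj : injective xi.
Hypothesis xi_in : forall j, -1 <= xi j <= 1.
Variables (gamma rho q CL lambda : R).
Hypotheses (rho1 : 1 < rho) (q01 : 0 < q < 1) (CL0 : 0 < CL).
Hypothesis leb : (lebesgue_constant xi <= (CL * m.+1%:R `^ lambda)%:E)%E.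
Variables (Om : V -> V -> Prop) (Psi : V -> V -> R[i]) (M kappa : R) (L : nat).
Variables (a b : nat -> 'rV[R]_d) (aL bL aY bY : 'rV[R]_d) (y : nat -> 'rV[R]_d).
Hypotheses (kappa0 : 0 <= kappa) (M0 : 0 <= M).
Hypothesis ab : forall n i, (n <= L)%N -> a n 0 i < b n 0 i.
Hypothesis nested : forall n i, (n < L)%N ->
  a n 0 i <= a n.+1 0 i /\ b n.+1 0 i <= b n 0 i.
Hypothesis shrink : forall n i, (n < L)%N ->
  b n.+1 0 i - a n.+1 0 i <= q * (b n 0 i - a n 0 i).
Hypothesis Psi_line : forall X U Y (s : R[i]^o), Om (X + s *: U) Y ->
  differentiable (fun s : R[i]^o => Psi (X + s *: U) Y : R[i]^o) s.
Hypothesis Psi_mixed : forall eps X0 X1 Y0 Y1, 0 < eps ->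
  (forall s t, 0 <= s <= 1 -> 0 <= t <= 1 -> forall X Y,
    cball (X0 + s%:C *: (X1 - X0)) eps X -> cball (Y0 + t%:C *: (Y1 - Y0)) eps Y ->
    Om X Y) ->
  normc (Psi X1 Y1 - Psi X1 Y0 - (Psi X0 Y1 - Psi X0 Y0)) <=
    256 * M * (cnorm (X1 - X0) * cnorm (Y1 - Y0)) / eps ^+ 2.
Hypothesis Psi_real : forall u v, box (a 0%N) (b 0%N) u -> box aL bL v ->
  complex.Im (Psi (to_complex u) (to_complex v)) = 0.
Hypothesis y_in : forall n, (n <= L)%N -> box aL bL (y n).

(** The second argument has a real centre: in a one-sided chain the other variable takes only real
    values. *)
Let admissible eps := 0 < eps /\
  forall X v, bernstein_polydisc rho (a 0%N) (b 0%N) X -> box aL bL v ->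
  forall X' Y', cball X eps X' -> cball (to_complex v) eps Y' -> Om X' Y'.

Hypothesis small_step : forall n, (n < L)%N -> exists2 eps, admissible eps &
  kappa * diam (box (a n) (b n)) * rnorm (y n - y n.+1) * M / eps ^+ 2 <= 4 * gamma.
Hypothesis small_base : forall v, box aY bY v -> exists2 eps, admissible eps &
  kappa * diam (box (a 0%N) (b 0%N)) * rnorm (v - y 0%N) * M / eps ^+ 2 <= 4 * gamma.
Hypothesis aYL : forall v, box aY bY v -> box aL bL v.

Let Lam := stability CL lambda m.
Let K := phase_const rho gamma.
Let phi n u := Psi (to_complex u) (to_complex (y n)).
Let eps := @step_error R d m Lam (middle_rho rho q) (inner_rho rho q) K.
Let base := @base_error R d m Lam (middle_rho rho q).
Let chain := phase_interp_chain (V := R[i]^o) xi kappa phi a b L.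

Let LamP t : -1 <= t <= 1 -> \sum_j `|(lagrange_poly xi j).[t]| <= Lam.
Proof.
move=> ht; apply: (lebesgue_sum xi_inj _ ht); apply: le_trans leb _.
by rewrite lee_fin /Lam /stability lerDr.
Qed.

Let Lam1 : 1 <= Lam. Proof. exact: stability_ge1. Qed.

Let nested0 n i : (n <= L)%N -> a 0%N 0 i <= a n 0 i /\ b n 0 i <= b 0%N 0 i.
Proof.
elim: n => [|n IH] nL; first by rewrite !lexx.
have [h1 h2] := IH (ltnW nL); have [h3 h4] := nested i nL.
by rewrite (le_trans h1 h3) (le_trans h4 h2).
Qed.

Let ext n u i : (n < L)%N -> box (a n.+1) (b n.+1) u ->
  hol_ext rho (a n.+1 0 i) (b n.+1 0 i) K (fun s =>
    cexp ((0 +i* kappa) * (phi n (set_coord u i s) - phi n.+1 (set_coord u i s)))).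
Proof.
move=> nL bu; have [e [e0 He] small] := small_step nL.
have yn := y_in (ltnW nL); have yn1 := y_in nL.
(* The smallness condition carries the diameter of the coarser box n, which dominates the sides of
   box n + 1. *)
have side : b n.+1 0 i - a n.+1 0 i <= diam (box (a n) (b n)).
  apply: (@le_trans _ _ (b n 0 i - a n 0 i)).
    by have [h1 h2] := nested i nL; rewrite lerB.
  by apply: side_le_diam => k; rewrite ltW// ab// ltnW.
have := phase_extension (alpha := fun=> 1) (Ma := 1) e0 rho1 kappa0 M0 Psi_line
  (fun X0 X1 Y0 Y1 => Psi_mixed e0) He Psi_real (fun k => ab k nL)
  (fun k => nested0 k nL) side bu yn yn1 small.
case=> [X U s _|X _|F [dF FK Ff]]; first exact: differentiable_const.
  by rewrite normc1.
exists F; split=> // [z /FK|s /Ff ->]; first by rewrite mulr1.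
by rewrite mulr1.
Qed.

Let K0 : 0 <= K. Proof. exact: expR_ge0. Qed.

Let phi_real n u : (n <= L)%N -> box (a 0%N) (b 0%N) u -> complex.Im (phi n u) = 0.
Proof. by move=> nL bu; apply: Psi_real => //; exact: y_in. Qed.

Lemma one_sided_stability f N : 0 <= N ->
  (forall u, box (a 0%N) (b 0%N) u -> normc (f u) <= N) ->
  forall u, box (a L) (b L) u -> normc (chain f u) <= (1 + eps) ^+ L * (Lam ^+ d * N).
Proof.
move=> N0 fN u bu.
exact: (chain_bound xi_inj xi_in Lam1 LamP ab nested shrink phi_real ext K0
  (inner_rho_gt1 rho1 q01) (inner_lt_middle rho1 q01) (middle_lt_rho rho1 q01)
  (inner_rho_shrink rho1 q01) (leqnn L) N0 fN bu).
Qed.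

(** The first operator removes the phase of [y 0] from a kernel taken at an arbitrary v of the level
    0 box; this difference of phases is what [small_base] controls. *)
Lemma one_sided_error v (alpha : V -> R[i]) Ma : box aY bY v -> 0 <= Ma ->
  (forall X U (s : R[i]^o), bernstein_polydisc rho (a 0%N) (b 0%N) (X + s *: U) ->
     differentiable (fun s : R[i]^o => alpha (X + s *: U) : R[i]^o) s) ->
  (forall X, bernstein_polydisc rho (a 0%N) (b 0%N) X -> normc (alpha X) <= Ma) ->
  let f u := cexp ((0 +i* kappa) * Psi (to_complex u) (to_complex v)) * alpha (to_complex u) in
  forall u, box (a L) (b L) u -> normc (f u - chain f u) <=
    Ma * (base K + L%:R * (eps * ((1 + eps) ^+ L * Lam ^+ d))).
Proof.
move=> bv Ma0 dalpha alphaM f u bu.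
have [e [e0 He] small] := small_base bv.
have fN w : box (a 0%N) (b 0%N) w -> normc (f w) <= Ma.
  move=> bw; rewrite normcM normc_cexp.
  have -> : complex.Re ((0 +i* kappa) * Psi (to_complex w) (to_complex v)) = 0.
    have := Psi_real bw (aYL bv).
    by case: (Psi _ _) => s t /= ->; rewrite mul0r mulr0 subrr.
  rewrite expR0 mul1r alphaM// => k; rewrite mxE.
  by apply: bernstein_disc_on_real => //; exact: ab.
have fh w i : box (a 0%N) (b 0%N) w ->
    hol_ext rho (a 0%N 0 i) (b 0%N 0 i) (K * Ma) (fun s =>
      cexp (- ((0 +i* kappa) * phi 0%N (set_coord w i s))) * f (set_coord w i s)).
  move=> bw.
  have side : b 0%N 0 i - a 0%N 0 i <= diam (box (a 0%N) (b 0%N)).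
    by apply: side_le_diam => k; rewrite ltW// ab.
  have := phase_extension (i := i) e0 rho1 kappa0 M0 Psi_line
    (fun X0 X1 Y0 Y1 => Psi_mixed e0) He Psi_real (fun k => ab k (leq0n L))
    (fun k => nested0 k (leq0n L)) side bw (aYL bv) (y_in (leq0n L)) small dalpha alphaM.
  case=> [F [dF FK Ff]]; exists F; split=> // s /Ff ->.
  by rewrite /f mulrA -cexpD; congr (cexp _ * _); rewrite /phi; ring.
apply: (le_trans (chain_error xi_inj xi_in Lam1 LamP ab nested shrink phi_real ext K0
  (inner_rho_gt1 rho1 q01) (inner_lt_middle rho1 q01) (middle_lt_rho rho1 q01)
  (inner_rho_shrink rho1 q01) (leqnn L) Ma0 (mulr_ge0 K0 Ma0) fN fh bu)).
rewrite le_eqVlt; apply/orP; left; apply/eqP.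
rewrite -/(base (K * Ma)) -/eps.
have -> : base (K * Ma) = Ma * base K by rewrite /base /base_error; ring.
ring.
Qed.

End OneSidedChain.

(** * Integer levels, slices of holomorphic functions and the final estimate *)

Lemma succZ (n : nat) : n.+1%:Z = n%:Z + 1.
Proof. lia. Qed.

Lemma opp_succZ (n : nat) : - n.+1%:Z = - n%:Z - 1.
Proof. lia. Qed.

Section Levels.
Context {R : realType} {d : nat}.
Variables (L : nat) (a b : int -> 'rV[R]_d).
Hypothesis ab : forall l, - L%:Z <= l <= L%:Z -> forall i, a l 0 i < b l 0 i.
Hypothesis nested : forall l, - L%:Z <= l < L%:Z ->
  box (a (l + 1)) (b (l + 1)) `<=` box (a l) (b l).

Lemma level_in (n : nat) : (n <= L)%N -> - L%:Z <= n%:Z <= L%:Z.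
Proof. by move=> nL; lia. Qed.

Lemma opp_level_in (n : nat) : (n <= L)%N -> - L%:Z <= - n%:Z <= L%:Z.
Proof. by move=> nL; lia. Qed.

Lemma level_lt (n : nat) : (n < L)%N -> - L%:Z <= n%:Z < L%:Z.
Proof. by move=> nL; lia. Qed.

Lemma level_subset l (k : nat) : - L%:Z <= l -> l + k%:Z <= L%:Z ->
  box (a (l + k%:Z)) (b (l + k%:Z)) `<=` box (a l) (b l).
Proof.
move=> lL; elim: k => [|k IH] kL; first by rewrite addr0.
apply: subset_trans (IH _); last by lia.
have -> : l + k.+1%:Z = l + k%:Z + 1 by lia.
by apply: nested; lia.
Qed.

Lemma level_subset_bottom l : - L%:Z <= l <= L%:Z ->
  box (a l) (b l) `<=` box (a (- L%:Z)) (b (- L%:Z)).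
Proof.
move=> lL; have := @level_subset (- L%:Z) (absz (l + L%:Z)).
by have -> : - L%:Z + (absz (l + L%:Z)) = l; [lia|apply; lia].
Qed.

Lemma level_subset0 (n : nat) : (n <= L)%N ->
  box (a n%:Z) (b n%:Z) `<=` box (a 0) (b 0).
Proof. by move=> nL; rewrite -[n%:Z]add0r; apply: level_subset; lia. Qed.

Lemma level_bounds (n : nat) i : (n < L)%N ->
  a n%:Z 0 i <= a n.+1%:Z 0 i /\ b n.+1%:Z 0 i <= b n%:Z 0 i.
Proof.
move=> nL; have E : n.+1%:Z = n%:Z + 1 by lia.
rewrite E; apply: box_bounds; first by apply: ab; lia.
by apply: nested; lia.
Qed.

End Levels.

Section Slices.
Context {R : realType} {V W : normedModType R[i]}.
Implicit Types (f : V * V -> W) (s : R[i]^o).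

Lemma differentiable_slice_l f (X U Y : V) s : differentiable f (X + s *: U, Y) ->
  differentiable (fun s : R[i]^o => f (X + s *: U, Y)) s.
Proof.
move=> df.
have -> : (fun s : R[i]^o => f (X + s *: U, Y)) =
  f \o (fun s : R[i]^o => (X + s *: U, Y)) by [].
exact: differentiable_comp.
Qed.

Lemma differentiable_slice_r f (X U Y : V) s : differentiable f (Y, X + s *: U) ->
  differentiable (fun s : R[i]^o => f (Y, X + s *: U)) s.
Proof.
move=> df.
have -> : (fun s : R[i]^o => f (Y, X + s *: U)) =
  f \o (fun s : R[i]^o => (Y, X + s *: U)) by [].
exact: differentiable_comp.
Qed.

End Slices.

Lemma differentiable_pairing {R : realType} {V : normedModType R[i]} {p : nat}
    (w : 'rV[R[i]^o]_p) (f : V -> 'rV[R[i]^o]_p) (X : V) :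
  differentiable f X -> differentiable (fun Y => pairing w (f Y)) X.
Proof.
move=> df; apply: differentiable_sumr => j; apply: differentiable_scale.
have -> : (fun Y => f Y 0 j : R[i]^o) =
  (fun N : 'rV[R[i]^o]_p => N 0 j : R[i]^o) \o f by [].
by apply: differentiable_comp => //; exact: differentiable_coord.
Qed.

Unset Implicit Arguments.
Set Strict Implicit.
Set Printing Implicit Defensive.

Theorem theorem2p6 (R : realType) (d : nat)
    (gamma rhoA rhoPhi q CLambda lambda : R) :
  (0 < d)%N -> 0 < gamma -> 1 < rhoA -> 1 < rhoPhi -> 0 < q < 1 ->
  0 < CLambda -> 0 < lambda ->
  exists C b b' : R, [/\ 0 < C, 0 < b, 0 < b' &
  forall (L : nat) (kappa : R) (p : nat)
    (aX bX aY bY x y : int -> 'rV[R]_d)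
    (Omega : set ('rV[R[i]^o]_d * 'rV[R[i]^o]_d))
    (Phi : 'rV[R[i]^o]_d * 'rV[R[i]^o]_d -> R[i]^o)
    (A : 'rV[R[i]^o]_d * 'rV[R[i]^o]_d -> 'rV[R[i]^o]_p)
    (MA MPhi : R)
    (nodes : forall n : nat, 'I_n.+1 -> R),
  let BX l := box (aX l) (bX l) in
  let BY l := box (aY l) (bY l) in
  let EAX := bernstein_polydisc rhoA (aX 0) (bX 0) in
  let EAY := bernstein_polydisc rhoA (aY 0) (bY 0) in
  let EPhiX := bernstein_polydisc rhoPhi (aX (- L%:Z)) (bX (- L%:Z)) in
  let EPhiY := bernstein_polydisc rhoPhi (aY (- L%:Z)) (bY (- L%:Z)) in
  let dOmega := omega_dist Omega (EAX `*` EPhiY `|` EPhiX `*` EAY) in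
  let PhiR (u v : 'rV[R]_d) : R[i] := Phi (to_complex u, to_complex v) in
  let k (u v : 'rV[R]_d) : 'rV[R[i]^o]_p :=
    cexp ((0 +i* kappa) * PhiR u v) *: A (to_complex u, to_complex v) in
  0 <= kappa ->
  (forall l : int, - L%:Z <= l <= L%:Z ->
    (forall i, aX l 0 i < bX l 0 i) /\ (forall i, aY l 0 i < bY l 0 i)) ->
  (forall l : int, - L%:Z <= l < L%:Z ->
    BX (l + 1) `<=` BX l /\ BY (l + 1) `<=` BY l) ->
  (forall l : int, - L%:Z <= l <= L%:Z -> BX l (x l) /\ BY l (y l)) ->
  (forall u v, BX (- L%:Z) u -> BY (- L%:Z) v -> PhiR u v \is Num.real) ->
  holomorphic_on (EAX `*` EAY) A ->
  open Omega ->
  holomorphic_on Omega Phi ->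
  EPhiX `*` EPhiY `<=` Omega ->
  EAX `*` EAY `<=` EPhiX `*` EPhiY ->
  MA%:E = Linfty (EAX `*` EAY) (fun z => cnorm (A z)) ->
  MPhi%:E = Linfty Omega (fun z => normc (Phi z)) ->
  (0 < dOmega)%E ->
  (forall (i : 'I_d) (l : int), - L%:Z <= l < L%:Z ->
    bX (l + 1) 0 i - aX (l + 1) 0 i <= q * (bX l 0 i - aX l 0 i) /\
    bY (l + 1) 0 i - aY (l + 1) 0 i <= q * (bY l 0 i - aY l 0 i)) ->
  (forall l : int, 0 <= l < L%:Z ->
    ((kappa * diam (BX l) * rnorm (y (- l) - y (- l - 1)) * MPhi)%:E
       / dOmega ^+ 2 <= gamma%:E)%E /\
    ((kappa * diam (BY l) * rnorm (x (- l) - x (- l - 1)) * MPhi)%:E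
       / dOmega ^+ 2 <= gamma%:E)%E) ->
  ((kappa * diam (BX 0) * diam (BY 0) * MPhi)%:E
     / dOmega ^+ 2 <= gamma%:E)%E ->
  (forall n, injective (nodes n) /\ forall j, -1 <= nodes n j <= 1) ->
  (forall n, (lebesgue_constant (nodes n)
     <= (CLambda * n.+1%:R `^ lambda)%:E)%E) ->
  forall m : nat, b' * ln L.+2%:R <= m%:R ->
  let JX := phase_interp_chain (nodes m) kappa
    (fun l u => PhiR u (y (- l%:Z))) (fun l => aX l%:Z) (fun l => bX l%:Z) L in
  let JY := phase_interp_chain (nodes m) kappa
    (fun l v => PhiR (x (- l%:Z)) v) (fun l => aY l%:Z) (fun l => bY l%:Z) L in
  (Linfty (BX L%:Z `*` BY L%:Z)
     (fun uv => cnorm (k uv.1 uv.2 - tensor_op JX JY k uv.1 uv.2))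
   <= (C * expR (- b * m%:R) * MA)%:E)%E].
Proof.
move=> _ g0 rA1 rP1 q01 CL0 _.
(* The constants are fixed before L, kappa, the boxes and the functions are given; rho is [rhoA],
   the parameter of the discs on which amplitude and phase are both controlled. *)
have [C [b [b' [C0 b0 b'0 HC]]]] := constants d lambda CL0 (inner_rho_gt1 rA1 q01)
  (inner_lt_middle rA1 q01) (expR_ge0 _ : 0 <= phase_const rhoA gamma).
exists C, b, b'; split=> //.
move=> L kappa p aX bX aY bY x y Omega Phi A MA MPhi nodes BX BY EAX EAY EPhiX EPhiY
  dOmega PhiR k kappa0 ab nested xy_in Phi_real holA _ holPhi subOmega _ MAE MPhiE dOmega0
  shrink cond cond0 nodesP leb m mb; lazy zeta.
have [xi_inj xi_in] := nodesP m.
have abX l (hl : - L%:Z <= l <= L%:Z) := (ab l hl).1.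
have abY l (hl : - L%:Z <= l <= L%:Z) := (ab l hl).2.
have nX l (hl : - L%:Z <= l < L%:Z) := (nested l hl).1.
have nY l (hl : - L%:Z <= l < L%:Z) := (nested l hl).2.
have PhiM z : Omega z -> normc (Phi z) <= MPhi.
  by move=> Oz; rewrite -lee_fin MPhiE; apply: ereal_sup_ubound; exists z.
have AM z : (EAX `*` EAY) z -> cnorm (A z) <= MA.
  by move=> Ez; rewrite -lee_fin MAE; apply: ereal_sup_ubound; exists z.
have L0 : - L%:Z <= 0 <= L%:Z by exact: (level_in (leq0n L)).
have LL : - L%:Z <= L%:Z <= L%:Z by exact: (level_in (leqnn L)).
have NLL : - L%:Z <= - L%:Z <= L%:Z by exact: (opp_level_in (leqnn L)).
have in_poly (rho : R) (a1 b1 u : 'rV[R]_d) : 1 < rho -> (forall i, a1 0 i < b1 0 i) ->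
    box a1 b1 u -> bernstein_polydisc rho a1 b1 (to_complex u).
  by move=> r1 lt1 bu i; rewrite mxE; apply: bernstein_disc_on_real => //; exact: bu.
have XL u : BX 0 u -> BX (- L%:Z) u by apply: (level_subset_bottom nX).
have YL v : BY 0 v -> BY (- L%:Z) v by apply: (level_subset_bottom nY).
have [x0 y0] := xy_in 0 L0.
have M0 : 0 <= MPhi.
  apply: le_trans (normc_ge0 _) (PhiM (to_complex (x 0), to_complex (y 0)) _).
  by apply: subOmega; split; apply: in_poly => //; [exact: abX|exact: XL|exact: abY|exact: YL].
have MA0 : 0 <= MA.
  apply: le_trans (cnorm_ge0 _) (AM (to_complex (x 0), to_complex (y 0)) _).
  by split; apply: in_poly => //; [exact: abX|exact: abY].
have diam0X l : - L%:Z <= l <= L%:Z -> 0 <= diam (BX l).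
  move=> hl; have [xl _] := xy_in l hl.
  by apply: le_trans (rnorm_ge0 (x l - x l)) _; exact: rnorm_le_diam.
have diam0Y l : - L%:Z <= l <= L%:Z -> 0 <= diam (BY l).
  move=> hl; have [_ yl] := xy_in l hl.
  by apply: le_trans (rnorm_ge0 (y l - y l)) _; exact: rnorm_le_diam.
(* Membership in the set whose supremum is [dOmega]; each smallness condition selects its own such
   radius. *)
pose good (e : R) := 0 < e /\ forall z, (EAX `*` EPhiY `|` EPhiX `*` EAY) z ->
  cball z.1 e `*` cball z.2 e `<=` Omega.
have scale T : 0 <= T -> (T%:E / dOmega ^+ 2 <= gamma%:E)%E ->
    exists2 e, good e & T / e ^+ 2 <= 4 * gamma.
  move=> T0 HT; have [e [ge _ small]] := @near_sup_scale R good T gamma T0 g0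
    (fun e h => h.1) dOmega0 HT.
  by exists e.
have y_opp n : (n <= L)%N -> BY (- L%:Z) (y (- n%:Z)).
  move=> nL; have hl := opp_level_in nL.
  by apply: (level_subset_bottom nY hl); exact: (xy_in _ hl).2.
have x_opp n : (n <= L)%N -> BX (- L%:Z) (x (- n%:Z)).
  move=> nL; have hl := opp_level_in nL.
  by apply: (level_subset_bottom nX hl); exact: (xy_in _ hl).1.
have ImPhi u v : BX (- L%:Z) u -> BY (- L%:Z) v ->
    complex.Im (Phi (to_complex u, to_complex v)) = 0.
  move=> bu bv; have := Phi_real u v bu bv; rewrite /PhiR.
  by case: (Phi _) => s t; rewrite complex_real => /eqP.
(* The two sides differ only by the roles of the two arguments of [Phi] and [A]. *)
have stepX n : (n < L)%N -> exists2 e, good e &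
    kappa * diam (box (aX n%:Z) (bX n%:Z)) * rnorm (y (- n%:Z) - y (- n.+1%:Z)) * MPhi / e ^+ 2
    <= 4 * gamma.
  move=> nL; rewrite opp_succZ; apply: scale.
    by rewrite !mulr_ge0 ?rnorm_ge0// diam0X//; apply: level_in; exact: ltnW.
  by have [] := cond n%:Z nL.
have stepY n : (n < L)%N -> exists2 e, good e &
    kappa * diam (box (aY n%:Z) (bY n%:Z)) * rnorm (x (- n%:Z) - x (- n.+1%:Z)) * MPhi / e ^+ 2
    <= 4 * gamma.
  move=> nL; rewrite opp_succZ; apply: scale.
    by rewrite !mulr_ge0 ?rnorm_ge0// diam0Y//; apply: level_in; exact: ltnW.
  by have [] := cond n%:Z nL.
have [e0 ge0 small0] : exists2 e, good e &
    kappa * diam (BX 0) * diam (BY 0) * MPhi / e ^+ 2 <= 4 * gamma.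
  by apply: scale => //; rewrite !mulr_ge0// ?diam0X ?diam0Y.
have e0sq : 0 <= e0 ^- 2 by rewrite invr_ge0 exprn_ge0// ltW// ge0.1.
have baseX v : BY 0 v -> exists2 e, good e &
    kappa * diam (box (aX 0%N%:Z) (bX 0%N%:Z)) * rnorm (v - y (- 0%N%:Z)) * MPhi / e ^+ 2
    <= 4 * gamma.
  move=> bv; exists e0 => //; apply: le_trans small0.
  rewrite ler_wpM2r// ler_wpM2r// oppr0 ler_wpM2l ?mulr_ge0 ?diam0X//.
  exact: rnorm_le_diam.
have baseY u : BX 0 u -> exists2 e, good e &
    kappa * diam (box (aY 0%N%:Z) (bY 0%N%:Z)) * rnorm (u - x (- 0%N%:Z)) * MPhi / e ^+ 2
    <= 4 * gamma.
  move=> bu; exists e0 => //; apply: le_trans small0.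
  rewrite ler_wpM2r// ler_wpM2r// oppr0 [leRHS]mulrAC ler_wpM2l ?mulr_ge0 ?diam0Y//.
  exact: rnorm_le_diam.
have shrinkX n i (nL : (n < L)%N) : bX n.+1%:Z 0 i - aX n.+1%:Z 0 i <= q * (bX n%:Z 0 i - aX n%:Z 0 i).
  by rewrite succZ; apply: (shrink i n%:Z (level_lt nL)).1.
have shrinkY n i (nL : (n < L)%N) : bY n.+1%:Z 0 i - aY n.+1%:Z 0 i <= q * (bY n%:Z 0 i - aY n%:Z 0 i).
  by rewrite succZ; apply: (shrink i n%:Z (level_lt nL)).2.
have lineX X U Y (s : R[i]^o) : Omega (X + s *: U, Y) ->
    differentiable (fun s : R[i]^o => Phi (X + s *: U, Y) : R[i]^o) s.
  by move=> /holPhi; exact: differentiable_slice_l.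
have lineY X U Y (s : R[i]^o) : Omega (Y, X + s *: U) ->
    differentiable (fun s : R[i]^o => Phi (Y, X + s *: U) : R[i]^o) s.
  by move=> /holPhi; exact: differentiable_slice_r.
have mixedX e X0 X1 Y0 Y1 : 0 < e ->
    (forall s t, 0 <= s <= 1 -> 0 <= t <= 1 -> forall X Y,
       cball (X0 + s%:C *: (X1 - X0)) e X -> cball (Y0 + t%:C *: (Y1 - Y0)) e Y ->
       Omega (X, Y)) ->
    normc (Phi (X1, Y1) - Phi (X1, Y0) - (Phi (X0, Y1) - Phi (X0, Y0))) <=
    256 * MPhi * (cnorm (X1 - X0) * cnorm (Y1 - Y0)) / e ^+ 2.
  move=> e1 H; apply: (mixed_difference e1 holPhi PhiM) => s t s01 t01 [X Y] [hX hY].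
  exact: (H s t s01 t01 X Y hX hY).
(* A mixed difference is unchanged when the arguments are exchanged, up to regrouping its four
   terms. *)
have mixedY e X0 X1 Y0 Y1 : 0 < e ->
    (forall s t, 0 <= s <= 1 -> 0 <= t <= 1 -> forall X Y,
       cball (X0 + s%:C *: (X1 - X0)) e X -> cball (Y0 + t%:C *: (Y1 - Y0)) e Y ->
       Omega (Y, X)) ->
    normc (Phi (Y1, X1) - Phi (Y0, X1) - (Phi (Y1, X0) - Phi (Y0, X0))) <=
    256 * MPhi * (cnorm (X1 - X0) * cnorm (Y1 - Y0)) / e ^+ 2.
  move=> e1 H; rewrite [cnorm _ * cnorm _]mulrC.
  have -> : Phi (Y1, X1) - Phi (Y0, X1) - (Phi (Y1, X0) - Phi (Y0, X0)) =
      Phi (Y1, X1) - Phi (Y1, X0) - (Phi (Y0, X1) - Phi (Y0, X0)).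
    have swap (z1 z2 z3 z4 : R[i]) : z1 - z2 - (z3 - z4) = z1 - z3 - (z2 - z4) by ring.
    exact: swap.
  apply: (mixed_difference e1 holPhi PhiM) => s t s01 t01 [Y X] [hY hX].
  exact: (H t s t01 s01 X Y hX hY).
have ImY v u : BY (- L%:Z) v -> BX (- L%:Z) u ->
    complex.Im (Phi (to_complex u, to_complex v)) = 0 by move=> bv bu; apply: ImPhi.
pose admX e := 0 < e /\ forall X v, EAX X -> BY (- L%:Z) v ->
    forall X' Y', cball X e X' -> cball (to_complex v) e Y' -> Omega (X', Y').
pose admY e := 0 < e /\ forall X v, EAY X -> BX (- L%:Z) v ->
    forall X' Y', cball X e X' -> cball (to_complex v) e Y' -> Omega (Y', X').
(* Real points of the largest box lie in its Bernstein polydisc, so each half of the union in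
   [dOmega] supplies the neighbourhoods for one side. *)
have goodX e : good e -> admX e.
  move=> [e1 He]; split=> // X v EX bv X' Y' hX hY.
  apply: (He (X, to_complex v)) => //; left; split=> //=.
  by apply: in_poly => //; exact: abY.
have goodY e : good e -> admY e.
  move=> [e1 He]; split=> // X v EX bv X' Y' hX hY.
  apply: (He (to_complex v, X)) => //; right; split=> //=.
  by apply: in_poly => //; exact: abX.
have relax (adm : R -> Prop) (T : R -> R) : (forall e, good e -> adm e) ->
    (exists2 e, good e & T e <= 4 * gamma) -> exists2 e, adm e & T e <= 4 * gamma.
  by move=> sub [e /sub ae small]; exists e.
have stepX' n nL := relax _ _ goodX (stepX n nL).
have stepY' n nL := relax _ _ goodY (stepY n nL).
have baseX' v bv := relax _ _ goodX (baseX v bv).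
have baseY' v bv := relax _ _ goodY (baseY v bv).
have abX' n i (nL : (n <= L)%N) := abX n%:Z (level_in nL) i.
have abY' n i (nL : (n <= L)%N) := abY n%:Z (level_in nL) i.
have boundsX n i (nL : (n < L)%N) := level_bounds abX nX i nL.
have boundsY n i (nL : (n < L)%N) := level_bounds abY nY i nL.
have ImX0 u v : BX 0 u -> BY (- L%:Z) v -> complex.Im (Phi (to_complex u, to_complex v)) = 0.
  by move=> bu bv; apply: ImPhi => //; exact: XL.
have ImY0 v u : BY 0 v -> BX (- L%:Z) u -> complex.Im (Phi (to_complex u, to_complex v)) = 0.
  by move=> bv bu; apply: ImPhi => //; exact: YL.
have BXL0 u : BX L%:Z u -> BX 0 u := level_subset0 nX (leqnn L) (t := u).
have BYL0 v : BY L%:Z v -> BY 0 v := level_subset0 nY (leqnn L) (t := v).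
apply: ge_ereal_sup => _ [[u v] [/= bu bv] <-]; rewrite lee_fin.
(* It remains to test against one [w]: the functional commutes with the operators and leaves a
   scalar kernel whose amplitude is at most MA |w|. *)
apply: cnorm_le_pairing => [|w].
  by rewrite !mulr_ge0 ?expR_ge0// ltW.
rewrite linearB/= tensor_op_morph.
pose kw (u v : 'rV[R]_d) : R[i]^o := cexp ((0 +i* kappa) * Phi (to_complex u, to_complex v)) *
  pairing w (A (to_complex u, to_complex v)).
have kwE u' v' : pairing w (k u' v') = kw u' v' by rewrite /k linearZ.
have -> : (fun u' v' => pairing w (k u' v')) = kw.
  by apply: funext => u'; apply: funext => v'; rewrite kwE.
rewrite kwE /tensor_op.
set chX := phase_interp_chain (nodes m) kappa _ _ _ L.
set chY := phase_interp_chain (nodes m) kappa _ _ _ L.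
pose Ma := MA * cnorm w; have Ma0 : 0 <= Ma by rewrite mulr_ge0// cnorm_ge0.
have pairM z : (EAX `*` EAY) z -> normc (pairing w (A z)) <= Ma.
  move=> Ez; apply: (le_trans (normc_pairing _ _)); rewrite mulrC.
  by rewrite ler_wpM2r ?cnorm_ge0// AM.
pose Lam := stability CLambda lambda m; pose K := phase_const rhoA gamma.
pose eps := @step_error R d m Lam (middle_rho rhoA q) (inner_rho rhoA q) K.
pose base := @base_error R d m Lam (middle_rho rhoA q) K.
pose err := base + L%:R * (eps * ((1 + eps) ^+ L * Lam ^+ d)).
have Lam1 : 1 <= Lam by exact: stability_ge1.
have Lam0 : 0 <= Lam by exact: le_trans Lam1.
have K0 : 0 <= K by exact: expR_ge0.
have base0 : 0 <= base.
  exact: (base_error_ge0 Lam1 (inner_rho_gt1 rA1 q01) (inner_lt_middle rA1 q01) K0).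
have eps0 : 0 <= eps.
  exact: (step_error_ge0 Lam1 K0 (inner_rho_gt1 rA1 q01) (inner_lt_middle rA1 q01)).
have err0 : 0 <= err.
  apply: addr_ge0 => //; do 2 apply: mulr_ge0 => //.
  by apply: mulr_ge0; apply: exprn_ge0 => //; exact: addr_ge0.
have stabX f N : 0 <= N -> (forall u, BX 0 u -> normc (f u) <= N) ->
    normc (chX f u) <= (1 + eps) ^+ L * (Lam ^+ d * N).
  move=> N0 fN.
  exact: (one_sided_stability xi_inj xi_in rA1 q01 CL0 (leb m) kappa0 M0 abX' boundsX
    shrinkX lineX mixedX ImX0 y_opp stepX' N0 fN bu).
have errX : normc (kw u v - chX (kw^~ v) u) <= Ma * err.
  have bv0 := BYL0 v bv.
  have tv : EAY (to_complex v) by apply: in_poly => //; exact: abY.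
  apply: (one_sided_error xi_inj xi_in rA1 q01 CL0 (leb m) kappa0 M0 abX' boundsX
    shrinkX lineX mixedX ImX0 y_opp stepX' baseX' YL bv0 Ma0
    (alpha := fun X => pairing w (A (X, to_complex v))) _ _ bu).
    move=> X U s EX; apply: differentiable_pairing; apply: differentiable_slice_l.
    exact: holA.
  by move=> X EX; exact: pairM.
(* Needed for every u' in the level 0 box, since the stability of the x-chain refers to a bound on
   all of it. *)
have errY u' : BX 0 u' -> normc (kw u' v - chY (kw u') v) <= Ma * err.
  move=> bu0; have tu : EAX (to_complex u') by apply: in_poly => //; exact: abX.
  apply: (one_sided_error xi_inj xi_in rA1 q01 CL0 (leb m) kappa0 M0 abY' boundsY
    shrinkY lineY mixedY ImY0 x_opp stepY' baseY' XL bu0 Ma0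
    (alpha := fun Y => pairing w (A (to_complex u', Y))) _ _ bv).
    move=> X U s EX; apply: differentiable_pairing; apply: differentiable_slice_r.
    exact: holA.
  by move=> X EX; exact: pairM.
have -> : kw u v - chX (fun u' => chY (kw u') v) u =
    (kw u v - chX (kw^~ v) u) + chX (fun u' => kw u' v - chY (kw u') v) u.
  by rewrite /chX phase_interp_chainB addrA subrK.
apply: (le_trans (le_normcD _ _)).
apply: (le_trans (lerD errX (stabX _ _ (mulr_ge0 Ma0 err0) errY))).
have -> : Ma * err + (1 + eps) ^+ L * (Lam ^+ d * (Ma * err)) =
    chain_total_error eps base (Lam ^+ d) L * Ma.
  by rewrite /chain_total_error -/err; ring.
have -> : C * expR (- b * m%:R) * MA * cnorm w = C * expR (- b * m%:R) * Ma.
  by rewrite /Ma mulrA.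
by apply: ler_wpM2r => //; exact: HC.
Qed.
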